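(* (a) For every odd integer $t\ge 1$ there exist integers $g'_t$ and $D$ such that every planar (simple) graph $G$ of maximum degree $d\ge D$ and girth at least $g'_t$ satisfies $\chi'_t(G)\le \tau'_t(d)$. (b) For every even integer $t\ge 2$ there exist integers $g_t$ and $D$ such that every planar (simple) graph $G$ of maximum degree $d\ge D$ and girth at least $g_t$ satisfies $\chi_t(G)\le \tau_t(d)$. (c) For every even integer $t\ge 2$ there is no integer $g$ (depending only on $t$) with the property that, for all sufficiently large $d$, every planar graph $G$ of maximum degree $d$ and girth at least $g$ satisfies $\chi'_t(G)\le \tau'_t(d)$. (d) For every odd integer $t\ge 1$ there is no integer $g$ (depending only on $t$) with the property that, for all sufficiently large $d$, every planar graph $G$ of maximum degree $d$ and girth at least $g$ satisfies $\chi_t(G)\le \tau_t(d)$.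
   Context: For a graph $G$, the distance between two vertices is the number of edges of a shortest path joining them; the line graph $L(G)$ has vertex set $E(G)$, two distinct edges being adjacent iff they share an endpoint, and the distance between two edges is their distance in $L(G)$. The distance-$t$ chromatic index $\chi'_t(G)$ is the least number of colours in a colouring of $E(G)$ in which any two distinct edges at distance at most $t$ receive different colours. The distance-$t$ chromatic number $\chi_t(G)$ is the least number of colours in a colouring of $V(G)$ in which any two distinct vertices at distance at most $t$ receive different colours. The girth is the length of a shortest cycle (infinite for forests). For integers $t\ge1$ and $d\ge 3$: $\tau'_t(d)=\frac{1}{d-2}\big(2(d-1)^{t/2+1}-d\big)$ if $t$ is even and $\tau'_t(d)=\frac{1}{d-2}\big(d(d-1)^{(t+1)/2}-d\big)$ if $t$ is odd; $\tau_t(d)=\frac{1}{d-2}\big(d(d-1)^{t/2}-2\big)$ if $t$ is even and $\tau_t(d)=\frac{1}{d-2}\big(2(d-1)^{(t+1)/2}-2\big)$ if $t$ is odd. *)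

(* Defs.v *)
From HB Require Import structures.
From mathcomp Require Import all_boot all_order all_algebra.

Set Implicit Arguments.
Unset Strict Implicit.
Unset Printing Implicit Defensive.

Import Order.TTheory GRing.Theory Num.Theory.

Record sgraph := SGraph {
  vertex :> finType;
  adj : rel vertex;
  adj_sym : symmetric adj;
  adj_irrefl : irreflexive adj }.

Definition edge_set (G : sgraph) : {set {set G}} :=
  [set [set p.1; p.2] | p : G * G & adj p.1 p.2].

Definition edge (G : sgraph) : finType := {e : {set G} | e \in edge_set G}.

Definition max_degree (G : sgraph) : nat := \max_(x : G) #|[set y | adj x y]|.

Section Metric.
Variable G : sgraph.

Definition joined (n : nat) (x y : G) : bool :=
  [exists p : n.-tuple G, path (@adj G) x p && (last x p == y)].

(* [None] is the infinite distance. A shortest walk repeats no vertex, so it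
   has fewer than #|G| edges, and the bounded search finds it. *)
Definition gdist (x y : G) : option nat :=
  ohead [seq n <- iota 0 #|G| | joined n x y].

Definition within_dist (t : nat) (x y : G) : bool :=
  if gdist x y is Some n then (n <= t)%N else false.

(* [None] is the infinite girth of a forest. [ucycleb] also accepts the
   sequences of size at most 2 (an edge walked back and forth), which are not
   cycles of a simple graph; hence the search starts at length 3. *)
Definition girth : option nat :=
  ohead [seq n <- iota 3 #|G| | [exists c : n.-tuple G, ucycleb (@adj G) c]].

Definition girth_at_least (g : nat) : bool :=
  if girth is Some n then (g <= n)%N else true.

Definition dist_colourable (t k : nat) : bool :=
  [exists c : {ffun G -> 'I_k},
    [forall x, forall y, (x != y) && within_dist t x y ==> (c x != c y)]].

Lemma dist_colourable_ex (t : nat) : exists k, dist_colourable t k.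
Proof.
exists #|G|; apply/existsP; exists [ffun x => enum_rank x].
apply/forallP => x; apply/forallP => y; apply/implyP => /andP[xy _].
by rewrite !ffunE (inj_eq enum_rank_inj).
Qed.

Definition dist_chromatic_number (t : nat) : nat :=
  ex_minn (dist_colourable_ex t).

Definition line_adj : rel (edge G) :=
  [rel e f | (e != f) && (val e :&: val f != set0)].

Lemma line_adj_sym : symmetric line_adj.
Proof. by move=> e f; rewrite /line_adj /= eq_sym setIC. Qed.

Lemma line_adj_irrefl : irreflexive line_adj.
Proof. by move=> e; rewrite /line_adj /= eqxx. Qed.

Definition line_graph : sgraph := SGraph line_adj_sym line_adj_irrefl.

End Metric.

Definition dist_chromatic_index (t : nat) (G : sgraph) : nat :=
  dist_chromatic_number (line_graph G) t.

From mathcomp Require Import all_classical all_reals all_analysis.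
Import numFieldNormedType.Exports.

Section Planarity.
Local Open Scope ring_scope.
Local Open Scope classical_set_scope.

(* The topological notion, with arbitrary continuous simple arcs; outside
   [0, 1] the values of [arc e] are irrelevant. *)
Definition planar (R : realType) (G : sgraph) : Prop :=
  exists (pt : G -> R * R) (arc : edge G -> R -> R * R),
  [/\ injective pt,
      forall e : edge G,
        [/\ {within `[0, 1], continuous (arc e)},
            {in `[0, 1]%R &, injective (arc e)} &
            exists x y : G, [/\ val e = [set x; y]%SET,
                                arc e 0 = pt x & arc e 1 = pt y]],
      forall (e : edge G) (x : G) (s : R), s \in `]0, 1[%R -> arc e s <> pt x &
      forall (e f : edge G) (s u : R), e != f ->
        s \in `]0, 1[%R -> u \in `[0, 1]%R -> arc e s <> arc f u].

End Planarity.

Section Bounds.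
Local Open Scope ring_scope.

(* Both are meant for d >= 3 (division by 0 is 0 in [rat]). The halvings of
   [t] and [t.+1] are exact in the branches where they occur. *)
Definition tau_index (t d : nat) : rat :=
  if odd t
  then (d%:R * (d%:R - 1) ^+ (t.+1./2) - d%:R) / (d%:R - 2)
  else (2 * (d%:R - 1) ^+ (t./2.+1) - d%:R) / (d%:R - 2).

Definition tau_vertex (t d : nat) : rat :=
  if odd t
  then (2 * (d%:R - 1) ^+ (t.+1./2) - 2) / (d%:R - 2)
  else (d%:R * (d%:R - 1) ^+ (t./2) - 2) / (d%:R - 2).

End Bounds.

(* Main.v *)
(** Upper bounds: in a graph of large girth, a vertex (or edge) far from the
    core left by stripping leaves repeatedly sees a set of conflicts contained
    in a ball of a tree, so it can be coloured greedily within [tau]. If the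
    core is not empty, it has a long thread of vertices of degree 2: otherwise,
    contracting breadth-first trees around a maximal packing of its branch
    vertices gives a minor of large minimum degree, hence a K5 minor (Mader),
    and polygonal approximation of the arcs reduces its exclusion in the plane
    to van Kampen's parity argument. Near a thread conflicts are few, and
    induction on the graph without the thread applies.

    Lower bounds: hang trees of depth about t/2 at the vertices of a long odd
    cycle so that all inner vertices have degree d. With only [tau] colours,
    the colours of the tree at c_i and those at c_(i+2) almost coincide, as both
    avoid the colours around c_(i+1). Going around the odd cycle in steps of
    two, the colours at two adjacent vertices almost coincide as well, although
    they must be disjoint. *)

(* Both upper bounds are one statement about the subdivision of G, whose vertices are the vertices
   and the edges of G: distance t in G or in its line graph becomes distance 2t there. The parity of
   t decides what lies in the middle of such a path. If it is a vertex of G (edges coloured for odd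
   t, vertices for even t), the objects within distance t of it number at most [tau], which is what
   a deepest leaf needs. For the other parity the middle is an edge of G and [tau] counts only the
   ball around an edge; an odd cycle then forces more colours.

   The obstacle to greedy colouring is a leaf less than t levels away from the core. If all hanging
   trees are that shallow, an object near the middle of a thread sees a bounded number of balls of
   radius t - 1, whose total size is smaller than [tau] by a factor of order d; this is why d must
   be large compared with t. Deleting a vertex of the thread also destroys conflicts between objects
   on its two sides, so everything within reach of it has to be recoloured, not only the deleted
   vertex. *)
Require Import Defs.
From mathcomp Require boolp.
From mathcomp Require Import all_boot all_order all_algebra zify ring lra.

Set Implicit Arguments.
Unset Strict Implicit.
Unset Printing Implicit Defensive.

Import Order.TTheory GRing.Theory Num.Theory.

(** * Parity of crossings for abstract order types *)

Section Chirotope.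
(** [chi a b c] stands for a counterclockwise turn. [chi_four] and [chi_five] are what two
    identities between orientations say about signs, the affine relation of four points and the
    three-term Grassmann-Pluecker relation: nonzero terms with sum 0 cannot all have the same sign.
    Parity statements then become finite checks on Booleans. *)
Variables (I : eqType) (chi : I -> I -> I -> bool).
Hypothesis chi_rot : forall a b c, chi a b c = chi b c a.
Hypothesis chi_swap : forall a b c, uniq [:: a; b; c] -> chi b a c = ~~ chi a b c.
Hypothesis chi_degenerate : forall a c, chi a a c = false.
Hypothesis chi_four : forall a b c d, uniq [:: a; b; c; d] ->
  ~~ constant [:: chi b c d; ~~ chi a c d; chi a b d; ~~ chi a b c].
Hypothesis chi_five : forall a b c d e, uniq [:: a; b; c; d; e] ->
  ~~ constant [:: chi a b c == chi a d e; chi a b d != chi a c e;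
                  chi a b e == chi a c d].

Definition crossing a b c d :=
  (chi a b c != chi a b d) && (chi c d a != chi c d b).

Definition in_triangle a b c x := (chi a b x == chi b c x) && (chi b c x == chi c a x).

Lemma crossing_sym a b c d : crossing a b c d = crossing c d a b.
Proof. by rewrite /crossing andbC. Qed.

Lemma crossing_swap a b c d : c \notin [:: a; b] -> d \notin [:: a; b] ->
  crossing b a c d = crossing a b c d.
Proof.
rewrite !inE !negb_or => /andP[ca cb] /andP[da db].
have [->//|ab] := eqVneq a b.
rewrite /crossing !(chi_swap (a := a) (b := b)) /=; last 2 first.
- by rewrite !inE !negb_or ab !(eq_sym _ d) da db.
- by rewrite !inE !negb_or ab !(eq_sym _ c) ca cb.
by rewrite (eq_sym (chi c d b)); congr (_ && _); do 2 case: chi.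
Qed.

(** A segment changes sides at each crossing of the boundary. Degenerate triangles are allowed
    because the fan used below starts with one and a path may revisit a point. In the main case
    there are five distinct points, and their ten orientations are checked exhaustively. *)
Lemma triangle_parity a b c x y :
  x \notin [:: a; b; c] -> y \notin [:: a; b; c] ->
  crossing a b x y (+) crossing b c x y (+) crossing c a x y =
  in_triangle a b c x (+) in_triangle a b c y.
Proof.
(* Two equal corners: the contributions of the sides cancel, and the triangle test no longer depends
   on the point. *)
have flat u v : u \notin [:: a; b; c] -> v \notin [:: a; b; c] ->
    forall p q, p \in [:: a; b; c] -> q \in [:: a; b; c] ->
  [/\ crossing p p u v = false, crossing p q u v (+) crossing q p u v = false
    & (in_triangle p p q u = (p == q)) * (in_triangle p q q u = (p == q)) *
      (in_triangle q p q u = (p == q))].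
  move=> ui vi p q pi qi.
  have un w : w \notin [:: a; b; c] -> w \notin [:: p; q].
    by rewrite !inE in pi qi *; move=> wi; apply: contra wi => /orP[] /eqP->.
  split; first by rewrite /crossing !chi_degenerate.
    by rewrite -(crossing_swap (un _ ui) (un _ vi)) addbb.
  rewrite /in_triangle !chi_degenerate.
  have [->|pq] := eqVneq p q; first by rewrite !chi_degenerate.
  have u3 : uniq [:: p; q; u].
    move: (un _ ui); rewrite /= !inE !negb_or => /andP[up uq].
    by rewrite !(eq_sym _ u) up uq pq.
  by rewrite (chi_swap u3); case: chi.
move=> xi yi.
have [ab|ab] := eqVneq a b.
  have ai : a \in [:: a; b; c] by rewrite !inE eqxx.
  have ci : c \in [:: a; b; c] by rewrite !inE eqxx !orbT.
  have [h1 h2 h3] := flat _ _ xi yi _ _ ai ci.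
  have [_ _ h4] := flat _ _ yi xi _ _ ai ci.
  by rewrite -ab h1 -addbA h2 !h3 !h4 !addbb.
have [bc|bc] := eqVneq b c.
  have ai : a \in [:: a; b; c] by rewrite !inE eqxx.
  have bi : b \in [:: a; b; c] by rewrite !inE eqxx !orbT.
  have [_ h2 h3] := flat _ _ xi yi _ _ ai bi.
  have [h1 _ _] := flat _ _ xi yi _ _ bi bi.
  have [_ _ h4] := flat _ _ yi xi _ _ ai bi.
  by rewrite -bc h1 addbF h2 !h3 !h4 !addbb.
have [ca|ca] := eqVneq c a.
  have ai : a \in [:: a; b; c] by rewrite !inE eqxx.
  have bi : b \in [:: a; b; c] by rewrite !inE eqxx !orbT.
  have [_ h2 _] := flat _ _ xi yi _ _ ai bi.
  have [h1 _ _] := flat _ _ xi yi _ _ ai ai.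
  have [_ _ h3] := flat _ _ xi yi _ _ bi ai.
  have [_ _ h4] := flat _ _ yi xi _ _ bi ai.
  by rewrite ca h1 addbF h2 !h3 !h4 !addbb.
have [xy|xy] := eqVneq x y.
  by rewrite -xy addbb /crossing !eqxx.
have u5 : uniq [:: a; b; c; x; y].
  move: xi yi; rewrite /= !inE !negb_or => /and3P[xa xb xc] /and3P[ya yb yc].
  rewrite !(eq_sym _ x) !(eq_sym _ y) xa xb xc ya yb yc (eq_sym y) xy.
  by rewrite ab bc eq_sym ca.
have sel m := mask_uniq u5 m; pose T := true; pose F := false.
rewrite /crossing /in_triangle -!(chi_rot _ x y).
rewrite (chi_swap (sel [:: T; F; T; T]) : chi c a x = _).
rewrite (chi_swap (sel [:: T; F; T; F; T]) : chi c a y = _).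
move: (chi_four (sel [:: T; T; T; T])) (chi_four (sel [:: T; T; T; F; T])).
move: (chi_four (sel [:: T; T; F; T; T])) (chi_four (sel [:: T; F; T; T; T])).
move: (chi_four (sel [:: F; T; T; T; T])).
have px : uniq [:: x; a; b; c; y].
  by rewrite (perm_uniq (_ : perm_eq _ [:: a; b; c; x; y])) ?(perm_catCA [:: x] [:: a; b; c]).
have py : uniq [:: y; a; b; c; x].
  rewrite (perm_uniq (_ : perm_eq _ [:: a; b; c; x; y])) //.
  by rewrite -[[:: a; b; c; x; y]](@cat_rcons _ x [:: a; b; c] [:: y]) -perm_rcons.
move: (chi_five px) (chi_five py).
rewrite !(chi_rot x a) !(chi_rot y a) (chi_rot x b c) (chi_rot y b c).
rewrite (chi_swap (sel [:: F; F; T; T; T]) : chi x c y = _).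
rewrite (chi_swap (sel [:: F; T; F; T; T]) : chi x b y = _).
rewrite (chi_rot a y x) (chi_swap (_ : uniq [:: x; y; a])) -?(chi_rot a x y); last first.
  by rewrite (perm_uniq (_ : perm_eq _ [:: a; x; y])) ?(sel [:: T; F; F; T; T])
             // (perm_catC [:: x; y] [:: a]).
rewrite (chi_rot y c x) (chi_rot y b x).
by do 10 case: (chi _ _ _).
Qed.

Fixpoint seg_cross a b y ys :=
  if ys is z :: zs then crossing a b y z (+) seg_cross a b z zs else false.

Fixpoint path_cross x xs y ys :=
  if xs is z :: zs then seg_cross x z y ys (+) path_cross z zs y ys else false.

Lemma seg_cross_cat a b y ys zs :
  seg_cross a b y (ys ++ zs) = seg_cross a b y ys (+) seg_cross a b (last y ys) zs.
Proof. by elim: ys y => //= z ys IH y; rewrite IH addbA. Qed.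

Lemma path_cross_cat x xs y ys zs :
  path_cross x xs y (ys ++ zs) =
  path_cross x xs y ys (+) path_cross x xs (last y ys) zs.
Proof.
elim: xs x => //= z xs IH x; rewrite IH seg_cross_cat.
by rewrite -!addbA; congr addb; rewrite addbCA.
Qed.

Lemma path_cross_seg x xs a b : path_cross x xs a [:: b] = seg_cross a b x xs.
Proof.
by elim: xs x => //= z xs IH x; rewrite IH addbF crossing_sym.
Qed.

Lemma seg_cross_swap a b y ys : (forall z, z \in y :: ys -> z \notin [:: a; b]) ->
  seg_cross b a y ys = seg_cross a b y ys.
Proof.
elim: ys y => //= z ys IH y h; rewrite IH => [|w wz]; last first.
  by apply: h; rewrite inE wz orbT.
by rewrite crossing_swap // h // !inE eqxx ?orbT.
Qed.

(* The triangle test at both ends of each side of Y telescopes. *)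
Lemma triangle_polygon a b c y ys :
  (forall z, z \in y :: ys -> z \notin [:: a; b; c]) ->
  seg_cross a b y ys (+) seg_cross b c y ys (+) seg_cross c a y ys =
  in_triangle a b c y (+) in_triangle a b c (last y ys).
Proof.
elim: ys y => [|z ys IH] y h /=; first by rewrite addbb.
have h' w : w \in z :: ys -> w \notin [:: a; b; c].
  by move=> wz; apply: h; rewrite inE wz orbT.
have tp : _ := @triangle_parity a b c y z (h _ (mem_head _ _)) (h' _ (mem_head _ _)).
move: (IH z h') tp.
by do 3 case: (crossing _ _ _ _); do 3 case: (seg_cross _ _ _ _);
  do 3 case: (in_triangle _ _ _ _).
Qed.

(** A closed polygon crosses every triangle of the fan an even number of times, so each side of the
    path can be exchanged for two spokes from [o]; inner spokes cancel. *)
Lemma fan_path_cross o x xs y ys : last y ys = y ->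
  (forall z, z \in y :: ys -> z \notin o :: x :: xs) ->
  path_cross x xs y ys = seg_cross o x y ys (+) seg_cross o (last x xs) y ys.
Proof.
move=> cl; elim: xs x => [|w xs IH] x h /=; first by rewrite addbb.
rewrite IH => [|z /h]; last first.
  by rewrite !inE !negb_or => /and4P[-> _ -> ->].
have h3 z : z \in y :: ys -> z \notin [:: o; x; w].
  by move=> /h; rewrite !inE !negb_or => /and4P[-> -> -> _].
have := triangle_polygon h3; rewrite cl addbb (seg_cross_swap (a := o)).
  by do 4 case: (seg_cross _ _ _ _).
by move=> z /h3; rewrite !inE !negb_or => /and3P[-> _ ->].
Qed.

(* Fan triangulation from the first vertex of the path. *)
Lemma path_cross_polygon x xs y ys : last y ys = y ->
  (forall z, z \in y :: ys -> z \notin x :: xs) ->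
  path_cross x xs y ys = seg_cross x (last x xs) y ys.
Proof.
move=> cl h; rewrite (@fan_path_cross x) // => [|z /h]; last by rewrite !inE orbA orbb.
suff -> : seg_cross x x y ys = false by [].
by elim: ys y {cl h} => //= z ys IH w; rewrite IH /crossing !chi_degenerate.
Qed.

(** Normalises the three pairings of four points to the four orientations with arguments in the
    given order, so that five points involve only ten Booleans. *)
Lemma quadruple_parity p q r s : uniq [:: p; q; r; s] ->
  crossing p q r s (+) crossing p r q s (+) crossing p s q r =
  (chi p q r != chi p q s) && (chi p r s != chi q r s)
  (+) (chi p q r == chi p r s) && (chi p q s == chi q r s)
  (+) (chi p q s != chi p r s) && (chi p q r != chi q r s).
Proof.
move=> u; have sl m := mask_uniq u m; pose T := true; pose F := false.
rewrite /crossing -(chi_rot p r s) -(chi_rot q r s) -(chi_rot p q s) -(chi_rot p q r).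
have -> : chi p r q = ~~ chi p q r.
  by rewrite chi_rot (chi_swap (_ : uniq [:: q; r; p])) -?(chi_rot p q r) // (rot_uniq 1
      [:: p; q; r]) (sl [:: T; T; T]).
have -> : chi q s r = ~~ chi q r s.
  by rewrite chi_rot (chi_swap (_ : uniq [:: r; s; q])) -?(chi_rot q r s) // (rot_uniq 1
      [:: q; r; s]) (sl [:: F; T; T; T]).
have -> : chi p s q = ~~ chi p q s.
  by rewrite chi_rot (chi_swap (_ : uniq [:: q; s; p])) -?(chi_rot p q s) // (rot_uniq 1
      [:: p; q; s]) (sl [:: T; T; F; T]).
have -> : chi p s r = ~~ chi p r s.
  by rewrite chi_rot (chi_swap (_ : uniq [:: r; s; p])) -?(chi_rot p r s) // (rot_uniq 1
      [:: p; r; s]) (sl [:: T; F; T; T]).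
by do 4 case: (chi _ _ _).
Qed.

(** These are the fifteen pairs of independent edges of K5 drawn with segments. The orientation
    conditions leave finitely many sign patterns, each with an odd number of crossings. *)
Lemma five_points_parity a b c d e : uniq [:: a; b; c; d; e] ->
  \big[addb/false]_(q <- [:: (a, b, c, d); (a, c, b, d); (a, d, b, c);
    (a, b, c, e); (a, c, b, e); (a, e, b, c); (a, b, d, e); (a, d, b, e);
    (a, e, b, d); (a, c, d, e); (a, d, c, e); (a, e, c, d); (b, c, d, e);
    (b, d, c, e); (b, e, c, d)]) crossing q.1.1.1 q.1.1.2 q.1.2 q.2 = true.
Proof.
move=> u5; have sel m := mask_uniq u5 m; pose T := true; pose F := false.
rewrite !big_cons big_nil /=.
have E (x1 x2 x3 x4 x5 x6 x7 x8 x9 y1 y2 y3 y4 y5 y6 : bool) :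
  x1 (+) (x2 (+) (x3 (+) (x4 (+) (x5 (+) (x6 (+) (x7 (+) (x8 (+) (x9 (+)
  (y1 (+) (y2 (+) (y3 (+) (y4 (+) (y5 (+) (y6 (+) false)))))))))))))) =
  (x1 (+) x2 (+) x3) (+) (x4 (+) x5 (+) x6) (+) (x7 (+) x8 (+) x9) (+)
  (y1 (+) y2 (+) y3) (+) (y4 (+) y5 (+) y6) by rewrite !addbA addbF.
rewrite E !quadruple_parity ?(sel [:: T; T; T; T; F]) ?(sel [:: T; T; T; F; T])
  ?(sel [:: T; T; F; T; T]) ?(sel [:: T; F; T; T; T]) ?(sel [:: F; T; T; T; T]) //.
move: (chi_four (sel [:: T; T; T; T])) (chi_four (sel [:: T; T; T; F; T])).
move: (chi_four (sel [:: T; T; F; T; T])) (chi_four (sel [:: T; F; T; T; T])).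
move: (chi_four (sel [:: F; T; T; T; T])).
by do 10 case: (chi _ _ _).
Qed.

End Chirotope.

Section K5.
Variables (I : eqType) (chi : I -> I -> I -> bool).
Hypothesis chi_rot : forall a b c, chi a b c = chi b c a.
Hypothesis chi_swap : forall a b c, uniq [:: a; b; c] -> chi b a c = ~~ chi a b c.
Hypothesis chi_degenerate : forall a c, chi a a c = false.
Hypothesis chi_four : forall a b c d, uniq [:: a; b; c; d] ->
  ~~ constant [:: chi b c d; ~~ chi a c d; chi a b d; ~~ chi a b c].
Hypothesis chi_five : forall a b c d e, uniq [:: a; b; c; d; e] ->
  ~~ constant [:: chi a b c == chi a d e; chi a b d != chi a c e;
                  chi a b e == chi a c d].
Notation crossing := (crossing chi).
Notation seg_cross := (seg_cross chi).
Notation path_cross := (path_cross chi).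

(* van Kampen's parity argument: replacing one edge of a drawing of K5 by a
   segment does not change the parity of the crossings of independent edges,
   since the independent edges form a triangle. *)
Lemma K5_crossing (v : nat -> I) (P : nat -> nat -> seq I) :
  (forall i j, i < 5 -> j < 5 -> i != j -> last (v i) (P i j) = v j) ->
  (forall i j k l, uniq [:: i; j; k; l] -> i < 5 -> j < 5 -> k < 5 -> l < 5 ->
     {in v k :: P k l, forall z, z \notin v i :: P i j}) ->
  ~ (forall i j k l, uniq [:: i; j; k; l] -> i < 5 -> j < 5 -> k < 5 -> l < 5 ->
     path_cross (v i) (P i j) (v k) (P k l) = false).
Proof.
move=> Pl dis nocross.
have fifth s : size s < 5 -> exists2 e, e < 5 & e \notin s.
  move=> s5; have /allPn[e] : ~~ all [in s] (iota 0 5).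
    apply: contraL s5 => /allP h; rewrite -leqNgt.
    by have := uniq_leq_size (iota_uniq 0 5) h; rewrite size_iota.
  by rewrite mem_iota; exists e.
have vn i k l : uniq [:: i; k; l] -> i < 5 -> k < 5 -> l < 5 ->
    v i \notin v k :: P k l.
  move=> u i5 k5 l5; have [j j5 jn] := fifth [:: i; k; l] isT.
  apply: contraT; rewrite negbK => h.
  suff u4 : uniq [:: i; j; k; l] by have := dis _ _ _ _ u4 i5 j5 k5 l5 _ h; rewrite mem_head.
  move: u jn; rewrite /= !inE !negb_or !andbT => /andP[/andP[ik il] kl] /and3P[ji jk jl].
  by rewrite eq_sym ji ik il jk jl kl.
(* The mixed quantity between the drawing and the straight K5: the segment [a b] against the drawn
   edge [c d]. *)
pose m a b c d := seg_cross (v a) (v b) (v c) (P c d).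
pose ok s := uniq s && all (fun i => i < 5) s.
have okm msk s : ok s -> ok (mask msk s).
  move=> /andP[us /allP h]; rewrite /ok mask_uniq //=.
  by apply/allP => x /mem_mask/h.
have okp s t : perm_eq s t -> ok s -> ok t.
  by move=> st; rewrite /ok (perm_uniq st) (perm_all _ st).
have Pl' i j : ok [:: i; j] -> last (v i) (P i j) = v j.
  by rewrite /ok /= inE andbT => /and4P[ij i5 j5 _]; apply: Pl.
have dis' i j k l : ok [:: i; j; k; l] ->
    {in v k :: P k l, forall z, z \notin v i :: P i j}.
  by case/andP=> u /and5P[*]; apply: dis.
have cross' i j k l : ok [:: i; j; k; l] -> path_cross (v i) (P i j) (v k) (P k l) = false.
  by case/andP=> u /and5P[*]; apply: nocross.
have incat x s t (z : I) : z \in x :: s ++ t -> (z \in x :: s) || (z \in last x s :: t).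
  by rewrite -cat_cons mem_cat => /orP[->//|zt]; rewrite [in X in _ || X]inE zt !orbT.
pose T := true; pose F := false.
(* The drawn edge [a b] misses the closed curve through [c], [d], [e], and its segment meets that
   curve with the same parity. *)
have tri a b c d e : ok [:: a; b; c; d; e] ->
    m a b c d (+) m a b d e (+) m a b e c = false.
  move=> o5; have sel msk := okm msk _ o5.
  have ocd : last (v c) (P c d) = v d := Pl' _ _ (sel [:: F; F; T; T]).
  have ode : last (v d) (P d e) = v e := Pl' _ _ (sel [:: F; F; F; T; T]).
  have oec' : ok [:: e; c] by apply: okp (sel [:: F; F; T; F; T]); rewrite (perm_catC [:: c] [:: e]).
  have oec : last (v e) (P e c) = v c := Pl' _ _ oec'.
  have oabec : ok [:: a; b; e; c].
    by apply: okp (sel [:: T; T; T; F; T]); rewrite !perm_cons (perm_catC [:: c] [:: e]).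
  have cl : last (v c) (P c d ++ P d e ++ P e c) = v c by rewrite !last_cat ocd ode oec.
  have := @path_cross_polygon _ _ chi_rot chi_swap chi_degenerate chi_four chi_five
    (v a) (P a b) _ _ cl.
  rewrite (Pl' _ _ (sel [:: T; T])) !path_cross_cat !seg_cross_cat ocd ode.
  rewrite !cross' ?(sel [:: T; T; T; T]) ?(sel [:: T; T; F; T; T]) // /m -addbA => <- //.
  move=> z /incat/orP[/(dis' _ _ _ _ (sel [:: T; T; T; T]))//|]; rewrite ocd.
  move=> /incat/orP[/(dis' _ _ _ _ (sel [:: T; T; F; T; T]))//|]; rewrite ode.
  exact: (dis' _ _ _ _ oabec).
have vn' i k l : ok [:: i; k; l] -> v i \notin v k :: P k l.
  by case/andP=> u /and4P[*]; apply: vn.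
have vneq i j : ok [:: i; j] -> v i != v j.
  rewrite /ok /= inE andbT => /and4P[ij i5 j5 _].
  have [k k5 kn] := fifth [:: i; j] isT; apply: contraNneq (vn i j k _ i5 j5 k5) => [->|].
    exact: mem_head.
  by move: kn; rewrite /= !inE !negb_or ij !(eq_sym k) => /andP[-> ->].
(* The drawn edge [c d] is compared with its segment against the closed curve made of the segment
   [a b] and the drawn edges [b e] and [e a]; [tri] trades the two drawn edges for [m c d a b]. *)
have flip a b c d : ok [:: a; b; c; d] ->
    m a b c d (+) m c d a b = crossing (v a) (v b) (v c) (v d).
  move=> o4; have [e e5 en] := fifth [:: a; b; c; d] isT.
  have o5 : ok [:: c; d; a; b; e].
    apply: (okp [:: e; a; b; c; d]); last by rewrite /ok /= e5 en; exact: o4.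
    by apply/permP => p /=; clear; lia.
  have sel msk := okm msk _ o5.
  have obe : last (v b) (P b e) = v e := Pl' _ _ (sel [:: F; F; F; T; T]).
  have oea' : ok [:: e; a] by apply: okp (sel [:: F; F; T; F; T]); rewrite (perm_catC [:: a] [:: e]).
  have oea : last (v e) (P e a) = v a := Pl' _ _ oea'.
  have ocdea : ok [:: c; d; e; a].
    by apply: okp (sel [:: T; T; T; F; T]); rewrite !perm_cons (perm_catC [:: a] [:: e]).
  have cl : last (v a) ([:: v b] ++ P b e ++ P e a) = v a by rewrite !last_cat obe oea.
  have := @path_cross_polygon _ _ chi_rot chi_swap chi_degenerate chi_four chi_five
    (v c) (P c d) _ _ cl.
  rewrite (Pl' _ _ (sel [:: T; T])) !path_cross_cat !seg_cross_cat path_cross_seg /= obe.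
  rewrite !cross' ?(sel [:: T; T; F; T; T]) // !addbF (crossing_sym _ (v c)).
  move: (tri _ _ _ _ _ o5); rewrite /m => t ->.
    by move: t; case: (crossing _ _ _ _); do 3 case: (seg_cross _ _ _ _).
  have ndc i : ok [:: c; d; i] -> v i \notin v c :: P c d.
    by move=> o; apply: vn'; apply: okp o; apply/permP => p /=; clear; lia.
  move=> z; rewrite inE => /orP[/eqP->|]; first exact: ndc (sel [:: T; T; T]).
  rewrite -cat_cons => /incat/orP[|]; rewrite /= ?obe.
    exact: (dis' _ _ _ _ (sel [:: T; T; F; T; T])).
  exact: (dis' _ _ _ _ ocdea).
have sym a b c d : ok [:: a; b; c; d] -> m a b d c = m a b c d.
  move=> o4; have sel msk := okm msk _ o4.
  have o4' : ok [:: a; b; d; c] by apply: okp o4; apply/permP => p /=; clear; lia.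
  have oc : ok [:: c; a; b].
    by apply: okp (sel [:: T; T; T]); apply/permP => p /=; clear; lia.
  have od : ok [:: d; a; b].
    by apply: okp (sel [:: T; T; F; T]); apply/permP => p /=; clear; lia.
  have := flip _ _ _ _ o4'; rewrite /m.
  rewrite (seg_cross_swap chi_swap (a := v c) (b := v d)); last first.
    move=> z zab; rewrite !inE negb_or; apply/andP; split; apply: contraTneq zab => ->.
      exact: vn'.
    exact: vn'.
  rewrite crossing_sym (crossing_swap chi_swap (a := v c) (b := v d)); last 2 first.
  - rewrite !inE negb_or !vneq //; first exact: (sel [:: T; F; F; T]).
    exact: (sel [:: T; F; T]).
  - rewrite !inE negb_or !vneq //; first exact: (sel [:: F; T; F; T]).
    exact: (sel [:: F; T; T]).
  rewrite crossing_sym -(flip _ _ _ _ o4) -/(m c d a b) => /(congr1 (addb^~ (m c d a b))).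
  by rewrite -!addbA addbb !addbF.
have tri' a b c d e : ok [:: a; b; c; d; e] ->
    m a b c d (+) m a b d e (+) m a b c e = false.
  move=> o5; rewrite -(tri _ _ _ _ _ o5) (sym a b c e) //.
  exact: okm [:: T; T; T; F; T] _ o5.
(* Fifteen independent pairs in both orders, or ten edges each with the three sides of the opposite
   triangle: both list the same thirty mixed pairs. The first sum is the crossing parity of the
   straight K5, the second vanishes by [tri']. *)
pose quads := [:: (0, 1, 2, 3); (0, 2, 1, 3); (0, 3, 1, 2);
    (0, 1, 2, 4); (0, 2, 1, 4); (0, 4, 1, 2); (0, 1, 3, 4); (0, 3, 1, 4);
    (0, 4, 1, 3); (0, 2, 3, 4); (0, 3, 2, 4); (0, 4, 2, 3); (1, 2, 3, 4);
    (1, 3, 2, 4); (1, 4, 2, 3)].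
pose fives := [:: (0,1,2,3,4); (0,2,1,3,4); (0,3,1,2,4); (0,4,1,2,3); (1,2,0,3,4);
  (1,3,0,2,4); (1,4,0,2,3); (2,3,0,1,4); (2,4,0,1,3); (3,4,0,1,2)].
pose M q := m q.1.1.1 q.1.1.2 q.1.2 q.2.
pose fl (q : nat * nat * nat * nat) := [:: q; (q.1.2, q.2, q.1.1.1, q.1.1.2)].
pose tr (q : nat * nat * nat * nat * nat) := let: (a, b, c, d, e) := q in
  [:: (a, b, c, d); (a, b, d, e); (a, b, c, e)].
have perm : perm_eq (flatten (map fl quads)) (flatten (map tr fives)) by [].
have v5 : uniq [:: v 0; v 1; v 2; v 3; v 4].
  by rewrite /= !inE !negb_or !vneq.
have fives0 : \big[addb/false]_(q <- flatten (map tr fives)) M q = false.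
  rewrite big_flatten big_map big1_seq // => -[[[[a b] c] d] e] /andP[_ q5].
  rewrite /= !big_cons big_nil /M /= addbF addbA tri' //.
  have /allP/(_ _ q5) // : all (fun q => ok [:: q.1.1.1.1; q.1.1.1.2; q.1.1.2; q.1.2; q.2]) fives.
  by [].
have := five_points_parity chi_rot chi_swap chi_four v5.
rewrite -[X in \big[_/_]_(_ <- X) _ = _]/(map (fun q => (v q.1.1.1, v q.1.1.2, v q.1.2, v q.2)) quads).
rewrite big_map => e.
suff : false = true by [].
rewrite -[LHS]fives0 -[RHS]e -(perm_big _ perm) big_flatten big_map.
apply: eq_big_seq => -[[[a b] c] d] q4.
rewrite !big_cons big_nil /M /= addbF. rewrite flip //.
by have /allP/(_ _ q4) : all (fun q => ok [:: q.1.1.1; q.1.1.2; q.1.2; q.2]) quads by [].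
Qed.

End K5.

(** * Orientation in the coordinate plane *)

Section Orientation.
Local Open Scope ring_scope.
Variable R : realFieldType.
Implicit Types (p q r : R * R) (eps : R).

Definition orient p q r : R :=
  (q.1 - p.1) * (r.2 - p.2) - (q.2 - p.2) * (r.1 - p.1).

Definition near_points eps p q := (`|p.1 - q.1| < eps) && (`|p.2 - q.2| < eps).

Definition segment_point p q (s : R) : R * R :=
  ((1 - s) * p.1 + s * q.1, (1 - s) * p.2 + s * q.2).

Definition general_position (I : eqType) (q : I -> R * R) :=
  forall a b c, uniq [:: a; b; c] -> orient (q a) (q b) (q c) != 0.

Section Points.
Variables (I : eqType) (q : I -> R * R).
Hypothesis gp : general_position q.
Definition ccw a b c := 0 < orient (q a) (q b) (q c).

Lemma ccw_rot a b c : ccw a b c = ccw b c a.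
Proof. by congr (0 < _); rewrite /orient; ring. Qed.

Lemma ccw_swap a b c : uniq [:: a; b; c] -> ccw b a c = ~~ ccw a b c.
Proof.
move=> /gp; rewrite /ccw -leNgt le_eqVlt => /negPf->.
by rewrite -oppr_gt0; congr (0 < _); rewrite /orient; ring.
Qed.

Lemma ccw_degenerate a c : ccw a a c = false.
Proof.
rewrite /ccw (_ : orient _ _ _ = 0) ?ltxx // /orient; ring.
Qed.

Lemma ccw_four a b c d : uniq [:: a; b; c; d] ->
  ~~ constant [:: ccw b c d; ~~ ccw a c d; ccw a b d; ~~ ccw a b c].
Proof.
move=> u4; have sel m := mask_uniq u4 m; pose T := true; pose F := false.
have := gp (sel [:: T; T; T; F]); have := gp (sel [:: T; T; F; T]).
have := gp (sel [:: T; F; T; T]); have := gp (sel [:: F; T; T; T]).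
rewrite /ccw /=.
have : orient (q b) (q c) (q d) - orient (q a) (q c) (q d)
   + orient (q a) (q b) (q d) - orient (q a) (q b) (q c) = 0 by rewrite /orient; ring.
move: (orient _ _ _) (orient _ _ _) (orient _ _ _) (orient _ _ _) => x y z w.
by case: (ltrgt0P x); case: (ltrgt0P y); case: (ltrgt0P z); case: (ltrgt0P w) => //=; lra.
Qed.

Lemma ccw_five a b c d e : uniq [:: a; b; c; d; e] ->
  ~~ constant [:: ccw a b c == ccw a d e; ccw a b d != ccw a c e;
                  ccw a b e == ccw a c d].
Proof.
move=> u5; have sel m := mask_uniq u5 m; pose T := true; pose F := false.
have := gp (sel [:: T; T; T]); have := gp (sel [:: T; F; F; T; T]).
have := gp (sel [:: T; T; F; T]); have := gp (sel [:: T; F; T; F; T]).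
have := gp (sel [:: T; T; F; F; T]); have := gp (sel [:: T; F; T; T]).
rewrite /ccw /=.
have : orient (q a) (q b) (q c) * orient (q a) (q d) (q e) -
   orient (q a) (q b) (q d) * orient (q a) (q c) (q e)
   + orient (q a) (q b) (q e) * orient (q a) (q c) (q d) = 0 by rewrite /orient; ring.
have sg (u v : R) : u != 0 -> v != 0 -> ((0 < u) == (0 < v)) = (0 < u * v).
  case: (ltrgt0P u) => // u0 _; case: (ltrgt0P v) => // v0 _; apply/esym.
  - by rewrite mulr_gt0.
  - by apply/negbTE; rewrite -leNgt ltW // pmulr_rlt0.
  - by apply/negbTE; rewrite -leNgt ltW // nmulr_rlt0.
  - by rewrite nmulr_rgt0.
move=> E a1 a2 a3 a4 a5 a6; rewrite (sg _ _ a6 a5) (sg _ _ a4 a3) (sg _ _ a2 a1); move: E.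
move: (mulf_neq0 a6 a5) (mulf_neq0 a4 a3) (mulf_neq0 a2 a1).
move: (_ * _) (_ * _) (_ * _) => x y z.
case: (ltrgt0P x); case: (ltrgt0P y); case: (ltrgt0P z) => //=; lra.
Qed.

Lemma opposite_ratio (x y : R) : x != 0 -> y != 0 -> (0 < x) != (0 < y) ->
  x - y != 0 /\ 0 <= x / (x - y) <= 1.
Proof.
case: (ltrgt0P x) => // x0 _; case: (ltrgt0P y) => // y0 _ _.
  have xy : 0 < x - y by lra.
  by split; [lra|rewrite divr_ge0 ?(ltW x0) ?(ltW xy) //= ler_pdivrMr //; lra].
have xy : x - y < 0 by lra.
split; first lra.
by rewrite ler_ndivrMr // -mulrNN -invrN mulr_ge0 ?invr_ge0; lra.
Qed.

(** Orientation with respect to one line is affine along the other segment, so the meeting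
    parameters are ratios of orientations; opposite signs put them between 0 and 1. *)
Lemma crossing_meet a b c d : uniq [:: a; b; c; d] -> crossing ccw a b c d ->
  exists s u, [/\ 0 <= s <= 1, 0 <= u <= 1 &
    segment_point (q a) (q b) s = segment_point (q c) (q d) u].
Proof.
move=> un; have sel m := mask_uniq un m; pose T := true; pose F := false.
have n1 := gp (sel [:: T; T; T; F]); have n2 := gp (sel [:: T; T; F; T]).
have n3 : orient (q c) (q d) (q a) != 0.
  by apply: gp; rewrite (rot_uniq 1 [:: a; c; d]) (sel [:: T; F; T; T]).
have n4 : orient (q c) (q d) (q b) != 0.
  by apply: gp; rewrite (rot_uniq 1 [:: b; c; d]) (sel [:: F; T; T; T]).
case/andP => /(opposite_ratio n1 n2)[] nz u01 /(opposite_ratio n3 n4)[] nz' s01.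
eexists; eexists; split; [exact: s01|exact: u01|].
have E : orient (q a) (q b) (q c) - orient (q a) (q b) (q d) =
  - (orient (q c) (q d) (q a) - orient (q c) (q d) (q b)) by rewrite /orient; ring.
rewrite E /segment_point; congr (_, _); move: nz'; rewrite /orient => nz'; field; exact: nz'.
Qed.

End Points.

(** The [size P] distinct candidates [e / (n + 2)] outnumber the roots. *)
Lemma poly_nonroot (P : {poly R}) e : P != 0 -> 0 < e ->
  exists x, [/\ 0 < x, x < e & P.[x] != 0].
Proof.
move=> P0 e0.
pose xs := [seq e / n.+2%:R | n <- iota 0 (size P)].
have inj : {in iota 0 (size P) &, injective (fun n => e / n.+2%:R : R)}.
  move=> m n _ _ /(mulfI (lt0r_neq0 e0))/invr_inj/eqP.
  by rewrite eqr_nat => /eqP[].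
have /allPn[x /mapP[n _ ->] nx] : ~~ all (root P) xs.
  apply/negP => h; have := max_poly_roots P0 h.
  by rewrite map_inj_in_uniq // iota_uniq size_map size_iota ltnn => /(_ isT).
exists (e / n.+2%:R); split=> //; first by rewrite divr_gt0.
by rewrite ltr_pdivrMr // ltr_pMr // ltr1n.
Qed.

(* A nondegenerate line meets the parabola p + (x, x^2) in at most two points. *)
Lemma perturb_point (s : seq (R * R)) p eps : 0 < eps -> uniq s ->
  exists q, [/\ near_points eps q p, q \notin s &
    {in s &, forall a b, a != b -> orient a b q != 0}].
Proof.
move=> eps0 us.
(* Along the parabola, [L a b] is the orientation of [a], [b] and the moving point. Its coefficients
   of degree 2 and 1 are differences of coordinates up to sign, so it is the zero polynomial only if
   [a = b]. *)
pose L (a b : R * R) : {poly R} := (b.1 - a.1) *: ((p.2 - a.2)%:P + 'X^2) -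
  (b.2 - a.2) *: ((p.1 - a.1)%:P + 'X).
pose N (a : R * R) : {poly R} := (p.1 - a.1)%:P + 'X.
pose F := (\prod_(a <- s) N a) * (\prod_(ab <- [seq (a, b) | a <- s, b <- s] | ab.1 !=
  ab.2) L ab.1 ab.2).
have F0 : F != 0.
  rewrite mulf_neq0 // prodf_seq_neq0; apply/allP => a _ /=.
    by apply/eqP => /(congr1 (fun P : {poly R} => P`_1)); rewrite !coefE /=; lra.
  case: a => a b /=; apply/implyP; apply: contra => /eqP E.
  have := congr1 (fun P : {poly R} => P`_1) E; have := congr1 (fun P : {poly R} => P`_2) E.
  rewrite !coefE /= => h1 h2; apply/eqP; rewrite [a]surjective_pairing [b]surjective_pairing.
  congr (_, _); lra.
pose e1 := Num.min eps 1.
have [|x [x0 xe Fx]] := @poly_nonroot F e1 F0; first by rewrite lt_min eps0 ltr01.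
move: xe; rewrite lt_min => /andP[xe x1].
exists (p.1 + x, p.2 + x ^+ 2).
have : (F.[x] != 0) by [].
rewrite hornerM mulf_eq0 negb_or !horner_prod !prodf_seq_neq0 => /andP[/allP hN /allP hL].
split.
- rewrite /near_points /= (addrC p.1) addrK (addrC p.2) addrK.
  rewrite !ger0_norm ?exprn_ge0 ?(ltW x0) // xe /=.
  by apply: le_lt_trans xe; rewrite expr2 ler_piMr // ltW.
- apply/negP => /hN /=; rewrite !hornerE /=; move/eqP; apply; ring.
- move=> a b sa sb ab; have := hL (a, b); rewrite /= ab => /(_ (allpairs_f _ sa sb)).
  apply: contra => /eqP E; apply/eqP; rewrite -E /L /orient !hornerE /=; ring.
Qed.

Lemma perturbation (I : finType) (p : I -> R * R) eps : 0 < eps ->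
  exists2 q, general_position q & forall i, near_points eps (q i) (p i).
Proof.
move=> eps0.
suff [q [h1 h2 h3]] : exists q : I -> R * R, [/\ {in enum I &, injective q},
    {in enum I, forall i, near_points eps (q i) (p i)} &
    {in enum I & &, forall a b c, uniq [:: a; b; c] -> orient (q a) (q b) (q c) != 0}].
  by exists q => [a b c|i]; [apply: h3|apply: h2]; rewrite mem_enum.
elim: (enum I) (enum_uniq I) => [_|i s IH /= /andP[iN us]].
  by exists p; split.
have [q [qi qp qg]] := IH us.
have [|x [xp xN xg]] := @perturb_point (map q s) (p i) eps eps0.
  by rewrite map_inj_in_uniq.
have old j : j \in s -> (j == i) = false by apply: contraTF => /eqP->.
pose q' j := if j == i then x else q j.
have xq j : j \in s -> x != q j by move=> sj; apply: contraNneq xN => ->; apply: map_f.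
have xqq : {in s &, forall a b, a != b -> orient (q a) (q b) x != 0}.
  move=> a b sa sb ab; apply: xg; rewrite ?map_f //.
  by apply: contra ab => /eqP/(qi _ _ sa sb)->.
exists q'; rewrite /q'; split.
- move=> a b; rewrite !inE => /orP[/eqP->|sa] /orP[/eqP->|sb] //; rewrite ?eqxx ?old //.
  + by move=> E; move: (xq _ sb); rewrite E eqxx.
  + by move=> E; move: (xq _ sa); rewrite E eqxx.
  + exact: qi.
- by move=> j; rewrite inE => /orP[/eqP->|sj]; rewrite ?eqxx ?old //; apply: qp.
have rt (a b c : R * R) : orient a b c = orient b c a by rewrite /orient; ring.
move=> a b c; rewrite !inE => ha hb hc; rewrite !negb_or andbT => /andP[/andP[ab ac] bc].
move: ha ab ac; case: eqVneq => [->|_] //= sa ab ac.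
  move: hb; rewrite eq_sym (negPf ab) /= => sb; move: hc; rewrite eq_sym (negPf ac) /= => sc.
  by rewrite rt xqq.
move: hb bc; case: eqVneq => [->|_] //= sb bc.
  by move: hc; rewrite eq_sym (negPf bc) /= => sc; rewrite -rt xqq // eq_sym.
move: hc; case: eqVneq => [->|_] //= sc; first by rewrite xqq.
by rewrite qg //= !inE negb_or ab ac bc.
Qed.

End Orientation.

(** * Dense minors *)

Section Minor.
Variables (V : finType) (e : rel V).
Hypothesis e_sym : symmetric e.

Definition inside (B : {set V}) : rel V := [rel x y | [&& e x y, x \in B & y \in B]].

Definition connected_in (B : {set V}) := [forall x in B, forall y in B, connect (inside B) x y].

Definition touch (B C : {set V}) := [exists x in B, exists y in C, e x y].

Definition clique_minor (Cs : seq {set V}) :=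
  all (fun B => (B != set0) && connected_in B) Cs &&
  pairwise (fun B C : {set V} => [disjoint B & C] && touch B C) Cs.

Lemma touch_sym B C : touch B C = touch C B.
Proof.
by apply/exists_inP/exists_inP => -[x xB /exists_inP[y yC xy]]; exists y => //;
  apply/exists_inP; exists x; rewrite // e_sym.
Qed.

Lemma touchS (B B' C C' : {set V}) : B \subset B' -> C \subset C' -> touch B C -> touch B' C'.
Proof.
move=> /subsetP BB /subsetP CC /exists_inP[x /BB xB /exists_inP[y /CC yC xy]].
by apply/exists_inP; exists x => //; apply/exists_inP; exists y.
Qed.

Lemma connected_inU B C : connected_in B -> connected_in C -> touch B C ->
  connected_in (B :|: C).
Proof.
move=> cB cC /exists_inP[x xB /exists_inP[y yC xy]].
have mono (A : {set V}) : A \subset B :|: C -> connected_in A -> {in A &, forall a b,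
    connect (inside (B :|: C)) a b}.
  move=> /subsetP sA cA a b aA bA.
  have : connect (inside A) a b by move/forall_inP/(_ a aA)/forall_inP/(_ b bA): cA.
  apply: connect_sub => c d /= /and3P[cd cA' dA]; apply: connect1.
  by rewrite /inside /= cd !sA.
have cx z : z \in B :|: C -> connect (inside (B :|: C)) x z.
  rewrite inE => /orP[zB|zC]; first by apply: mono cB _ _ _ _; rewrite ?subsetUl.
  apply: (@connect_trans _ _ y); first by apply: connect1; rewrite /inside /= xy !inE xB yC orbT.
  by apply: mono cC _ _ _ _; rewrite ?subsetUr.
have sy : symmetric (inside (B :|: C)) by move=> a b; rewrite /inside /= e_sym [X in _ && X]andbC.
apply/forall_inP => a aU; apply/forall_inP => b bU.
by apply: (@connect_trans _ _ x); rewrite ?cx // (sym_connect_sym sy) cx.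
Qed.

Section Mader.
Variable T : finType.
Implicit Types (D : {set T}) (B : T -> {set V}).

Definition branch_family D B :=
  (forall i, i \in D -> (B i != set0) && connected_in (B i)) /\
  {in D &, forall i j, i != j -> [disjoint B i & B j]}.

(** Ordered pairs, so every edge of the quotient graph on [D] is counted twice. *)
Definition touching D B : {set T * T} :=
  [set p | [&& p.1 \in D, p.2 \in D, p.1 != p.2 & touch (B p.1) (B p.2)]].

(** Merging [v] into [u] loses the edge between them and identifies two edges at each common
    neighbour; both losses count twice. *)
Lemma touching_contract D B u v : u \in D -> v \in D -> u != v -> touch (B u) (B v) ->
  let B' i := if i == u then B u :|: B v else B i in
  branch_family D B ->
  branch_family (D :\ v) B' /\
  #|touching D B| <= #|touching (D :\ v) B'| + 2 +
    2 * #|[set w in D | [&& w != u, w != v, touch (B u) (B w) & touch (B v) (B w)]]|.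
Proof.
move=> uD vD uv tuv B' [Bn Bd]; have vu : v != u by rewrite eq_sym.
have B'u : B' u = B u :|: B v by rewrite /B' eqxx.
have B'n i : i != u -> B' i = B i by rewrite /B' => /negPf->.
split.
  split=> [i|i j]; rewrite !inE => /andP[iv iD].
    rewrite /B'; have [_|_] := eqVneq i u; last exact: Bn.
    have /andP[u0 uc] := Bn u uD; have /andP[_ vc] := Bn v vD.
    by rewrite connected_inU // setU_eq0 negb_and u0.
  move=> /andP[jv jD] ij; rewrite /B'.
  have [iu|iu] := eqVneq i u; have [ju|ju] := eqVneq j u; last exact: Bd.
  - by rewrite iu ju eqxx in ij.
  - by rewrite disjoints_subset subUset -!disjoints_subset !Bd // eq_sym.
  - by rewrite disjoint_sym disjoints_subset subUset -!disjoints_subset !Bd // eq_sym.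
set W := [set w in D | _].
(* The pairs given up; on all others, renaming [v] to [u] is injective. *)
pose bad : {set T * T} := [set p | [|| (p.1 == u) && (p.2 == v), (p.1 == v) && (p.2 == u),
  (p.1 == v) && (p.2 \in W) | (p.2 == v) && (p.1 \in W)]].
pose m i := if i == v then u else i.
pose f (p : T * T) := (m p.1, m p.2).
have badN : #|bad| <= 2 + 2 * #|W|.
  pose bad' := [set (u, v); (v, u)] :|: ([set (v, w) | w in W] :|: [set (w, v) | w in W]).
  apply: (@leq_trans #|bad'|).
    apply/subset_leq_card/subsetP => -[i j]; rewrite in_set /= !in_setU !in_set1.
    case/or4P=> /andP[/eqP-> h]; rewrite ?(eqP h) ?eqxx ?orbT //.
      by apply/orP; right; apply/orP; left; apply/imsetP; exists j.
    by apply/orP; right; apply/orP; right; apply/imsetP; exists i.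
  apply: (leq_trans (leq_card_setU _ _)); apply: leq_add; first by rewrite cards2; case: (_ == _).
  apply: (leq_trans (leq_card_setU _ _)); rewrite mul2n -addnn.
  by apply: leq_add; apply: leq_imset_card.
rewrite -addnA; apply: (@leq_trans (#|touching D B :\: bad| + #|bad|)).
  by rewrite -(cardsID bad (touching D B)) addnC leq_add2l subset_leq_card // subsetIr.
apply: leq_add => //.
have Tsym D' B1 i j : ((i, j) \in touching D' B1) = ((j, i) \in touching D' B1).
  by rewrite !inE /= andbCA eq_sym touch_sym.
have sym2 i j : ((i, j) \in touching D B :\: bad) = ((j, i) \in touching D B :\: bad).
  rewrite !in_setD Tsym; congr (~~ _ && _); rewrite [LHS]in_set [RHS]in_set /=.
  by do 4 case: (_ == _); do 2 case: (_ \in W).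
have BB' i : B i \subset B' i by rewrite /B'; case: eqP => // ->; rewrite subsetUl.
have Tvj j : (v, j) \in touching D B :\: bad ->
    [/\ j \in D, j != v, j != u, touch (B v) (B j) & ~~ touch (B u) (B j)].
  rewrite !inE /= eqxx !negb_or -!andbA => /and5P[_ /= ju jW _ /and4P[_ jD vj tvj]].
  rewrite jD eq_sym vj ju tvj; split=> //; apply: contra jW => tuj.
  by rewrite jD ju eq_sym vj tuj tvj.
have Tij i j : (i, j) \in touching D B :\: bad -> [/\ i \in D, j \in D, i != j & touch (B i) (B j)].
  by rewrite inE => /andP[_]; rewrite inE /= => /and4P.
have fv j : (v, j) \in touching D B :\: bad -> (u, j) \in touching (D :\ v) B'.
  case/Tvj => jD jv ju tvj _; rewrite !inE /= uv uD jv jD eq_sym ju B'u B'n //=.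
  by apply: touchS tvj; rewrite ?subsetUr.
have fimg i j : (i, j) \in touching D B :\: bad -> f (i, j) \in touching (D :\ v) B'.
  rewrite /f /m /=; have [->|iv] := eqVneq i v => ij.
    by have [_ /negPf-> _ _ _] := Tvj _ ij; exact: fv.
  have [jv|jv] := eqVneq j v; first by rewrite Tsym fv // -sym2 -jv.
  have [iD jD nij tij] := Tij _ _ ij; rewrite !inE /= iv jv iD jD nij.
  by apply: touchS tij; exact: BB'.
have finj : {in touching D B :\: bad &, injective f}.
  have half i j i' j' : (i, j) \in touching D B :\: bad -> (i', j') \in touching D B :\: bad ->
      i = v -> f (i, j) = f (i', j') -> i = i'.
    move=> ij ij' iv; move: ij; rewrite iv => vj; have [jD jv ju tvj ntuj] := Tvj _ vj.
    rewrite /f /m /= eqxx (negPf jv); have [//|i'v] := eqVneq i' v.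
    have [j'v|j'v] := eqVneq j' v; first by case=> _ E; rewrite E eqxx in ju.
    case=> E1 E2; have [_ _ _] := Tij _ _ ij'; rewrite -E1 -E2 => tuj.
    by rewrite tuj in ntuj.
  have full i j i' j' : (i, j) \in touching D B :\: bad -> (i', j') \in touching D B :\: bad ->
      f (i, j) = f (i', j') -> i = i'.
    move=> ij ij' E; have [iv|iv] := eqVneq i v; first exact: half ij ij' iv E.
    have [iv'|iv'] := eqVneq i' v; first exact/esym/(half _ _ _ _ ij' ij iv' (esym E)).
    by case: E; rewrite /m (negPf iv) (negPf iv').
  move=> [i j] [i' j'] ij ij' E; congr (_, _); first exact: full E.
  by apply: (full j i j' i'); rewrite 1?sym2 //; case: E => E1 E2; congr (_, _).
rewrite -(card_in_imset finj); apply/subset_leq_card/subsetP => _ /imsetP[[i j] ij ->].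
exact: fimg.
Qed.

(** If some edge has fewer than [2 ^ k] common neighbours, contracting it keeps the density
    [2 ^ k.+1]. Otherwise the neighbours of any touched index [a] have degree at least [2 ^ k] among
    themselves; they contain a clique minor with one branch set less, which [B a] completes. For
    this last step each branch set must contain some [B i] and all must stay inside the union of the
    [B i]. *)
Lemma mader k D B : branch_family D B -> D != set0 ->
  2 ^ k * #|D| <= #|touching D B| ->
  exists Cs, [/\ size Cs = k.+2, clique_minor Cs &
    forall C, C \in Cs -> (C \subset \bigcup_(i in D) B i) /\ exists2 i, i \in D & B i \subset C].
Proof.
elim: k D B => [|k IHk] D.
  move=> B [Bn Bd] /set0Pn[i0 i0D]; rewrite mul1n => h.
  have /card_gt0P[[i j]] : 0 < #|touching D B|.
    by apply: leq_trans h; apply/card_gt0P; exists i0.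
  rewrite inE /= => /and4P[iD jD ij tij]; exists [:: B i; B j].
  split=> //; first by rewrite /clique_minor /= !Bn //= tij Bd.
  move=> C; rewrite !inE => /orP[] /eqP->; (split; first exact: bigcup_sup).
    by exists i.
  by exists j.
have [n] := ubnP #|D|; elim: n D => // n IHn D Dn B fB D0 h.
have [Bn Bd] := fB.
pose W u v := [set w in D | [&& w != u, w != v, touch (B u) (B w) & touch (B v) (B w)]].
have [/existsP[[u v] /= /andP[]]|] := boolP [exists p in touching D B, #|W p.1 p.2| < 2 ^ k].
  rewrite inE /= => /and4P[uD vD uv tuv] Wuv.
  have [fB' hB'] := touching_contract uD vD uv tuv fB.
  set B' := (fun i => _) in fB' hB'.
  have DN : #|D| = #|D :\ v|.+1 by rewrite (cardsD1 v) vD.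
  have [|||Cs [sCs cCs sub]] := IHn (D :\ v) _ B' fB'.
  - by rewrite -ltnS -DN.
  - by apply/set0Pn; exists u; rewrite !inE uv.
  - move: h Wuv hB'; rewrite DN /W expnS; lia.
  exists Cs; split=> // C /sub[/subsetP Csub [i]]; rewrite !inE => /andP[iv iD] BiC.
  have BB' i' : B i' \subset B' i' by rewrite /B'; case: eqP => // ->; rewrite subsetUl.
  split; last by exists i => //; apply: subset_trans BiC.
  apply/subsetP => x /Csub /bigcupP[j]; rewrite !inE /B' => /andP[jv jD].
  case: eqP => [_|_ xj]; last by apply/bigcupP; exists j.
  by rewrite inE => /orP[] ?; apply/bigcupP; [exists u|exists v].
rewrite negb_exists => /forallP nW.
have {}nW u v : (u, v) \in touching D B -> 2 ^ k <= #|W u v|.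
  by move=> uv; move: (nW (u, v)); rewrite uv /= -leqNgt.
have /card_gt0P[[a b] ab] : 0 < #|touching D B|.
  by apply: leq_trans h; rewrite muln_gt0 expn_gt0 card_gt0.
pose J := [set j in D | (a, j) \in touching D B].
have Jt j : j \in J -> [/\ j \in D, a \in D, a != j & touch (B a) (B j)].
  by rewrite !inE /= => /and5P[].
have [|||Cs [sCs cCs sub]] := IHk J B.
- split=> [i /Jt[iD _ _ _]|i j /Jt[iD _ _ _] /Jt[jD _ _ _]]; [exact: Bn|exact: Bd].
- by apply/set0Pn; exists b; move: ab; rewrite !inE /= => /and4P[-> -> -> ->].
- apply: (@leq_trans (\sum_(u in J) \sum_(v | (u, v) \in touching J B) 1)).
    rewrite mulnC -sum_nat_const; apply: leq_sum => u uJ; rewrite sum1dep_card.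
    have [uD aD au tau] := Jt _ uJ.
    apply: (@leq_trans #|W a u|); first by apply: nW; rewrite inE /= aD uD au.
    apply/subset_leq_card/subsetP => w /setIdP[wD /and4P[wa wu taw tuw]].
    by rewrite !inE /= uD aD wD au tau taw tuw !(eq_sym _ w) wa wu.
  rewrite pair_big_dep sum1dep_card; apply/subset_leq_card/subsetP => -[u v].
  by rewrite inE /= => /andP[].
have [ja jb] : a \in D /\ a \notin J.
  by move: ab; rewrite !inE /= => /and4P[-> _ _ _]; rewrite eqxx andbF.
exists (B a :: Cs); split; first by rewrite /= sCs.
- case/andP: cCs => cA cP; rewrite /clique_minor /= cA cP (Bn a ja) // !andbT /=.
  apply/allP => C /sub[/subsetP Csub [i iJ BiC]]; have [iD aD ai tai] := Jt _ iJ.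
  rewrite (touchS _ BiC tai) // andbT disjoints_subset; apply/subsetP => x xa.
  rewrite inE; apply/negP => /Csub /bigcupP[j jJ xj]; have [jD _ aj _] := Jt _ jJ.
  by move/pred0P: (Bd _ _ aD jD aj) => /(_ x); rewrite /= xa xj.
move=> C; rewrite inE => /orP[/eqP->|/sub[Csub [i /Jt[iD _ _ _] BiC]]].
  by split; [exact: (bigcup_sup a)|exists a].
split; last by exists i.
by apply: subset_trans Csub _; apply/bigcupsP => j /Jt[jD _ _ _]; exact: (bigcup_sup j).
Qed.

End Mader.
End Minor.

(** * Long threads in cores of large girth *)

Section Reach.
Variable V : finType.
Implicit Types (e : rel V) (x y z : V) (m n : nat).

(** At most [n] steps, which makes it monotone in [n] and lets it agree with [within_dist] later. *)
Fixpoint reach e n x y :=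
  (x == y) || (if n is n'.+1 then [exists z, e x z && reach e n' z y] else false).

Lemma reach_refl e n x : reach e n x x.
Proof. by case: n => [|n] /=; rewrite eqxx. Qed.

Lemma reachS e n x y z : e x z -> reach e n z y -> reach e n.+1 x y.
Proof. by move=> xz zy /=; apply/orP; right; apply/existsP; exists z; rewrite xz. Qed.

Lemma reach1 e x y : e x y -> reach e 1 x y.
Proof. by move=> xy; apply: reachS xy _; exact: reach_refl. Qed.

Lemma reachSP e n x y : reach e n.+1 x y ->
  x = y \/ exists2 z, e x z & reach e n z y.
Proof.
move=> /= /orP[/eqP->|/existsP[z /andP[xz zy]]]; [by left|by right; exists z].
Qed.

Lemma reach_mono e e' m n x y : subrel e e' -> m <= n -> reach e m x y -> reach e' n x y.
Proof.
move=> ee; elim: m n x => [|m IH] n x mn; first by rewrite /= orbF => /eqP->; exact: reach_refl.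
case: n mn => // n mn /reachSP[->|[z xz zy]]; first exact: reach_refl.
by apply: reachS (ee _ _ xz) _; exact: IH.
Qed.

Lemma reachW e m n x y : m <= n -> reach e m x y -> reach e n x y.
Proof. exact: reach_mono. Qed.

Lemma reach_trans e m n x y z : reach e m x y -> reach e n y z -> reach e (m + n) x z.
Proof.
elim: m x => [|m IH] x; first by rewrite /= orbF => /eqP->.
move=> /reachSP[->|[w xw wy]] yz; first by apply: reachW yz; rewrite leq_addl.
by apply: reachS xw _; exact: IH.
Qed.

Lemma reach_sym e n x y : symmetric e -> reach e n x y = reach e n y x.
Proof.
move=> sy; suff h u v : reach e n u v -> reach e n v u by apply/idP/idP; exact: h.
elim: n u => [|n IH] u; first by rewrite /= !orbF eq_sym.
move=> /reachSP[->|[w uw /IH wv]]; first exact: reach_refl.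
by rewrite -addn1; apply: reach_trans wv _; apply: reach1; rewrite sy.
Qed.

Lemma reachP e n x y : reflect (exists p, [/\ path e x p, last x p = y & size p <= n]) (reach e n x y).
Proof.
apply: (iffP idP) => [|[p [+ + +]]].
  elim: n x => [|n IH] x; first by rewrite /= orbF => /eqP->; exists [::].
  move=> /reachSP[->|[z xz /IH[p [p1 p2 p3]]]]; first by exists [::].
  by exists (z :: p); rewrite /= xz.
elim: p n x => [|z p IH] n x /=; first by move=> _ -> _; exact: reach_refl.
case: n => // n /andP[xz zp] pl pn; apply: reachS xz _; exact: IH.
Qed.

Lemma reach_seq e (c : nat -> V) m n :
  (forall k, m <= k < m + n -> e (c k) (c k.+1)) -> reach e n (c m) (c (m + n)).
Proof.
elim: n m => [|n IH] m h; first by rewrite addn0 reach_refl.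
apply: (@reachS _ _ _ _ (c m.+1)); first by apply: h; lia.
by rewrite -addSnnS; apply: IH => k ?; apply: h; lia.
Qed.

Definition minus_edge e x y : rel V :=
  [rel a b | e a b && ~~ ((a == x) && (b == y) || (a == y) && (b == x))].

Lemma reach_minusC e x y n : reach (minus_edge e x y) n =2 reach (minus_edge e y x) n.
Proof.
by move=> a b; apply/idP/idP; apply: reach_mono => // u v; rewrite /minus_edge /= [in X in
    _ -> _ && X]orbC.
Qed.

(* No cycle of length at most g + 1. *)
Definition girth_gt e g := forall x y, e x y -> ~~ reach (minus_edge e x y) g x y.

Definition avoiding e x : rel V := [rel a b | [&& e a b, a != x & b != x]].

(** The detour, together with the edge from [x] to [y'], joins the ends of the edge [x y] without
    using it, in at most [n.+1 <= g] steps. *)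
Lemma no_detour e g n x y y' : symmetric e -> irreflexive e -> girth_gt e g -> n < g ->
  e x y -> e x y' -> y != y' -> ~~ reach (avoiding e x) n y y'.
Proof.
move=> sy ir gt ng xy xy' yy'; apply/negP => r.
have nx a : e x a -> a != x by apply: contraTneq => ->; rewrite ir.
have /negP[] := gt x y xy; apply: (@reachW _ n.+1); first exact: ng.
apply: (@reachS _ _ _ _ y').
  by rewrite /minus_edge /= xy' eqxx (eq_sym y') (negPf yy') (eq_sym x y) (negPf (nx _ xy)).
rewrite reach_sym; last first.
  by move=> a b; rewrite /minus_edge /= sy orbC (andbC (b == x)) (andbC (b == y)).
apply: reach_mono r => // a b /and3P[ab ax bx].
by rewrite /minus_edge /= ab (negPf ax) (negPf bx) andbF.
Qed.

(** At the first return [c i = c j], the vertices [c i.+1] and [c j.-1] are distinct neighbours of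
    [c i], joined by a stretch that avoids it. *)
Lemma nonbacktracking_inj e g (c : nat -> V) n : symmetric e -> irreflexive e ->
  girth_gt e g -> n <= g ->
  (forall i, i < n -> e (c i) (c i.+1)) -> (forall i, i.+1 < n -> c i != c i.+2) ->
  forall i j, i < j <= n -> c i != c j.
Proof.
move=> sy ir gt; elim: n => [|n IH] ng ce cb i j /andP[ij jn]; first by lia.
have {}IH := IH (ltnW ng) (fun i h => ce i (ltnW h)) (fun i h => cb i (ltnW h)).
move: jn; rewrite leq_eqVlt => /orP[/eqP jE|jn]; last by apply: IH; lia.
rewrite jE in ij *; apply/eqP => E.
have [iE|] := eqVneq i n; first by have := ce n (leqnn _); rewrite -E iE ir.
move=> ne; have [iE|ne1] := eqVneq i.+1 n.
  by subst n; have := cb i (leqnn _); rewrite -E eqxx.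
have iN : i.+1 < n by lia.
have c1 : e (c i) (c i.+1) by apply: ce; lia.
have c2 : e (c i) (c n) by rewrite E sy; apply: ce.
have c12 : c i.+1 != c n by apply: IH; lia.
have lt_g : n - i.+1 < g by lia.
apply: (negP (no_detour sy ir gt lt_g c1 c2 c12)).
rewrite -[in c n](subnKC (ltnW iN)).
apply: reach_seq => k kn; rewrite /avoiding /= ce; last lia.
by rewrite !(eq_sym _ (c i)) !IH //; lia.
Qed.

End Reach.

Section Thread.
Variables (V : finType) (e : rel V).
Hypotheses (e_sym : symmetric e) (e_irr : irreflexive e).
Implicit Types (R : {set V}) (c : nat -> V).

Definition degree_in R x := #|[set y in R | e x y]|.

Definition thread R L c :=
  (forall i, i < L -> inside e R (c i) (c i.+1)) /\
  (forall i y, 0 < i < L -> inside e R (c i) y -> y = c i.-1 \/ y = c i.+1).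

Definition nonbacktracking R n c :=
  (forall i, i < n -> inside e R (c i) (c i.+1)) /\ (forall i, i.+1 < n -> c i != c i.+2).

Lemma inside_sym R : symmetric (inside e R).
Proof. by move=> a b; rewrite /inside /= e_sym [X in _ && X]andbC. Qed.

Lemma inside_sub R : subrel (inside e R) e.
Proof. by move=> a b /and3P[]. Qed.

Lemma nonbacktracking_exists R z n : {in R, forall x, 1 < degree_in R x} -> z \in R ->
  exists2 c, nonbacktracking R n c & c 0 = z.
Proof.
move=> deg zR.
have next a b : b \in R -> exists2 y, inside e R b y & y != a.
  move=> bR; have := deg b bR; rewrite /degree_in (cardsD1 a) => h.
  have /set0Pn[y] : [set y in R | e b y] :\ a != set0.
    by rewrite -card_gt0; case: (_ \in _) h => //; case: #|_|.
  by rewrite !inE => /and3P[ya yR by_]; exists y; rewrite /inside /= ?by_ ?bR.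
(* The state is the last step of the walk, kept as a pair. *)
pose step (p : V * V) := (p.2, odflt p.2 [pick y | inside e R p.2 y && (y != p.1)]).
have stepP p : p.2 \in R -> inside e R p.2 (step p).2 /\ (step p).2 != p.1.
  rewrite /step /= => pR; case: pickP => [y /andP[]|/= h] //.
  by have [y y1 y2] := next p.1 p.2 pR; move: (h y); rewrite y1 y2.
have [y1 zy1 _] := next z z zR.
pose s i := iter i step (z, y1); exists (fun i => (s i).1) => //.
have sR i : (s i).2 \in R.
  by elim: i => [|i IH]; [case/and3P: zy1|have [/and3P[]] := stepP _ IH].
have s12 i : (s i.+1).1 = (s i).2 by [].
split=> i _.
  case: i => [|i]; first exact: zy1.
  by rewrite !s12; have [] := stepP (s i) (sR i).
by rewrite !s12 eq_sym; have [_] := stepP (s i) (sR i).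
Qed.

Lemma nonbacktracking_thread R L c : nonbacktracking R L c ->
  (forall i, 0 < i < L -> degree_in R (c i) <= 2) -> thread R L c.
Proof.
move=> [ce cb] d2; split=> // i y /andP[i0 iL] iy.
have e1 : inside e R (c i) (c i.-1).
  by rewrite inside_sym; case: i i0 iL {iy} => // i _ iL; apply: ce; exact: ltnW.
have e2 := ce i iL.
have ne : c i.-1 != c i.+1 by case: i i0 iL {iy e1 e2} => // i _ iL; exact: cb.
have [->|y1] := eqVneq y (c i.-1); first by left.
have [->|y2] := eqVneq y (c i.+1); first by right.
have := d2 i; rewrite i0 iL => /(_ isT); rewrite leqNgt => /negP[].
suff sub : {subset [:: y; c i.-1; c i.+1] <= [set z in R | e (c i) z]}.
  have u : uniq [:: y; c i.-1; c i.+1] by rewrite /= !inE negb_or y1 y2 ne.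
  have := subset_leq_card (introT subsetP sub); rewrite (card_uniqP u).
  exact.
move=> z; rewrite !inE => /or3P[] /eqP->.
- by case/and3P: iy => -> _ ->.
- by case/and3P: e1 => -> _ ->.
- by case/and3P: e2 => -> _ ->.
Qed.

(** The walk splits into [K] blocks of length [L]. A block without an inner branch vertex would be a
    thread, and the girth makes the branch vertices of different blocks distinct. *)
Lemma branch_vertices R L K c : girth_gt e (K * L) -> nonbacktracking R (K * L) c ->
  (forall c', ~ thread R L c') ->
  K <= #|[set x in R | 2 < degree_in R x & reach (inside e R) (K * L) (c 0) x]|.
Proof.
move=> gt nb nt; have [ce cb] := nb.
have blk (j : 'I_K) : exists i : 'I_(K * L).+1, (j * L < i < j.+1 * L) && (2 < degree_in R (c i)).
  have jK : j.+1 * L <= K * L by rewrite leq_mul2r ltn_ord orbT.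
  have [/existsP[i /andP[iL d]]|n] := boolP [exists i : 'I_L, (0 < i) && (2 < degree_in R
      (c (j * L + i)))].
    have h : j * L + i < (K * L).+1.
      by rewrite ltnS; apply: leq_trans jK; rewrite mulSn addnC leq_add2r ltnW.
    exists (Ordinal h); rewrite /= d andbT mulSn addnC ltn_add2r ltn_ord.
    by rewrite -[X in X < _]add0n ltn_add2r iL.
  case: (nt (fun i => c (j * L + i))); apply: nonbacktracking_thread.
    split=> i iL.
      by rewrite addnS; apply: ce; apply: leq_trans jK; rewrite mulSn addnC ltn_add2r.
    by rewrite !addnS; apply: cb; apply: leq_trans jK; rewrite mulSn addnC -addSn ltn_add2r.
  move=> i /andP[i0 iL]; rewrite leqNgt; apply: contra n => d.
  by apply/existsP; exists (Ordinal iL); rewrite i0.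
have [b bP] := fin_all_exists blk.
have inj : injective (fun j => c (b j)).
  have cI := nonbacktracking_inj e_sym e_irr gt (leqnn _) (fun i h => inside_sub (ce i h)) cb.
  have lt (j k : 'I_K) : j < k -> c (b j) != c (b k).
    move=> jk; apply: cI; rewrite -(ltnS (b k)) ltn_ord andbT.
    have /andP[/andP[_ bj] _] := bP j; have /andP[/andP[bk _] _] := bP k.
    apply: leq_trans bj _; apply: leq_trans _ (ltnW bk).
    by rewrite leq_mul2r jk orbT.
  move=> j k E; case: (ltngtP j k) => [jk|kj|/ord_inj//].
    by have /eqP[] := lt _ _ jk.
  by have /eqP[] := lt _ _ kj.
rewrite -[X in X <= _]card_ord -(card_imset _ inj); apply/subset_leq_card/subsetP => _ /imsetP[j _ ->].
have /andP[/andP[b1 b2] d] := bP j; have bK : b j < (K * L).+1 := ltn_ord _.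
rewrite inE d andTb; apply/andP; split.
  have : 0 < b j by apply: leq_ltn_trans b1.
  case: (val (b j)) bK => // i iK _; by have /and3P[] := ce i iK.
apply: (@reachW _ _ (b j)) => //.
by have := @reach_seq _ (inside e R) c 0 (b j); rewrite add0n; apply => k /andP[_ kb]; apply: ce; lia.
Qed.

End Thread.

Section LongThread.
Variables (V : finType) (e : rel V).
Hypotheses (e_sym : symmetric e) (e_irr : irreflexive e).
Variables (R : {set V}) (L : nat).
Hypothesis noK5 : forall Cs, clique_minor e Cs -> size Cs <> 5.
Hypothesis girth_e : girth_gt e (48 * L + 1).
Hypothesis deg2 : {in R, forall x, 1 < degree_in e R x}.

Let eR := inside e R.
(** Six blocks of length [L] give every centre six branch vertices within [rho]. Two walks of length
    [4 * rho] inside parts and one more edge make up the [48 * L + 1] of [girth_e]. *)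
Let rho := 6 * L.

(** Centres more than [2 * rho] apart have disjoint balls of radius [rho]; a vertex farther than
    [2 * rho] from all of a maximal [C] could be added to it. *)
Lemma packing_exists : exists C : {set V}, [/\ C \subset R,
  {in C &, forall z z', reach eR (2 * rho) z z' -> z = z'} &
  {in R, forall x, exists2 z, z \in C & reach eR (2 * rho) x z}].
Proof.
pose P (C : {set V}) := (C \subset R) &&
  [forall z in C, forall z' in C, reach eR (2 * rho) z z' ==> (z == z')].
have P0 : P set0.
  by rewrite /P sub0set; apply/forall_inP => z; rewrite inE.
have [C /maxsetP[/andP[CR Cp] Cmax] _] := maxset_exists P0.
have Cp' : {in C &, forall z z', reach eR (2 * rho) z z' -> z = z'}.
  by move=> z z' zC zC' r; apply/eqP; move/forall_inP/(_ z zC)/forall_inP/(_ z' zC')/implyP/(_ r): Cp.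
exists C; split=> // x xR.
have [/exists_inP[z zC r]|n] := boolP [exists z in C, reach eR (2 * rho) x z]; first by exists z.
have far z : z \in C -> ~~ reach eR (2 * rho) x z.
  by move=> zC; apply: contra n => r; apply/exists_inP; exists z.
exists x; last exact: reach_refl.
rewrite -(Cmax (x |: C)) ?setU11 ?subsetUr //; apply/andP; split.
  by rewrite subUset sub1set xR.
apply/forall_inP => z; rewrite !inE => zC; apply/forall_inP => z'; rewrite !inE => zC'.
apply/implyP; case/orP: zC => [/eqP->|zC]; case/orP: zC' => [/eqP->|zC'] //.
- by move=> r; have := far _ zC'; rewrite r.
- by rewrite reach_sym; [move=> r; have := far _ zC; rewrite r|exact: inside_sym].
- by move=> r; apply/eqP; exact: Cp'.
Qed.

Section Parts.
Variable C : {set V}.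
Hypothesis CR : C \subset R.
Hypothesis Cfar : {in C &, forall z z', reach eR (2 * rho) z z' -> z = z'}.
Hypothesis Cnear : {in R, forall x, exists2 z, z \in C & reach eR (2 * rho) x z}.

(** Breadth-first forest grown from the centres. A centre is its own parent, so iterating [parent]
    beyond the root changes nothing. *)
Definition depth x := find (fun n => [exists z in C, reach eR n x z]) (iota 0 (2 * rho).+1).
Definition parent x := odflt x [pick y | eR x y && (depth y < depth x)].
Definition root x := iter (depth x) parent x.

Lemma depth_le x n z : z \in C -> reach eR n x z -> depth x <= n.
Proof.
move=> zC r; rewrite leqNgt; apply/negP => lt.
have := before_find 0 lt; rewrite nth_iota; last first.
  by apply: leq_trans lt _; rewrite -[X in _ <= X](size_iota 0) find_size.
by move/exists_inP; apply; exists z.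
Qed.

Lemma depthP x : x \in R -> depth x <= 2 * rho /\ exists2 z, z \in C & reach eR (depth x) x z.
Proof.
move=> xR; have [z zC r] := Cnear xR; have le := depth_le zC r; split=> //.
have hs : has (fun n => [exists z in C, reach eR n x z]) (iota 0 (2 * rho).+1).
  by rewrite has_find size_iota.
have := nth_find 0 hs; rewrite nth_iota //.
by move=> /exists_inP[z' zC' r']; exists z'.
Qed.

Lemma depth0 x : x \in R -> (depth x == 0) = (x \in C).
Proof.
move=> xR; apply/eqP/idP => [d0|xC].
  by have [_ [z zC]] := depthP xR; rewrite d0 /= orbF => /eqP->.
by apply/eqP; rewrite -leqn0; apply: depth_le xC (reach_refl _ _ _).
Qed.

Lemma parent_center x : x \in C -> parent x = x.
Proof.
move=> xC; have /eqP d0 : depth x == 0 by rewrite depth0 // (subsetP CR).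
by rewrite /parent; case: pickP => //= y /andP[_]; rewrite d0.
Qed.

Lemma parentP x : x \in R -> x \notin C -> eR x (parent x) /\ depth (parent x) < depth x.
Proof.
move=> xR xC; rewrite /parent; case: pickP => [y /andP[] //|/= none].
have [_ [z zC]] := depthP xR; case E : (depth x) (depth0 xR) => [|n]; first by rewrite (negPf xC).
move=> _ /reachSP[xz|[y xy yz]]; first by rewrite xz zC in xC.
by move: (none y); rewrite xy E ltnS (depth_le zC yz).
Qed.

Lemma parent_in x : x \in R -> parent x \in R.
Proof.
move=> xR; have [xC|xC] := boolP (x \in C); first by rewrite parent_center.
by have [/and3P[]] := parentP xR xC.
Qed.

Lemma iter_parent n x : x \in R -> depth x <= n -> iter n parent x \in C.
Proof.
elim: n x => [|n IH] x xR; first by rewrite leqn0 depth0.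
have [xC _|xC dn] := boolP (x \in C).
  by rewrite (_ : iter _ _ _ = x) //; elim: (n.+1) => //= m ->; exact: parent_center.
rewrite iterSr; apply: IH; first exact: parent_in.
by have [_ /leq_trans/(_ dn)] := parentP xR xC.
Qed.

Lemma root_in x : x \in R -> root x \in C.
Proof. by move=> xR; exact: iter_parent. Qed.

Lemma iter_root n x : x \in R -> depth x <= n -> iter n parent x = root x.
Proof.
move=> xR; elim: n => [|n IH]; first by rewrite leqn0 /root => /eqP->.
rewrite leq_eqVlt => /orP[/eqP xn|xn]; first by rewrite /root xn.
by rewrite iterS IH // parent_center // root_in.
Qed.

Lemma root_parent x : x \in R -> root (parent x) = root x.
Proof.
move=> xR; have [xC|xC] := boolP (x \in C); first by rewrite parent_center.
have [_ dx] := parentP xR xC; rewrite [RHS]/root.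
case: (depth x) dx => // d dx; rewrite iterSr iter_root //; exact: parent_in.
Qed.

Lemma root_center x : x \in C -> root x = x.
Proof.
move=> xC; have /eqP d0 : depth x == 0 by rewrite depth0 // (subsetP CR).
by rewrite /root d0.
Qed.

Definition tree_edge : rel V := [rel x y | [&& eR x y, (y == parent x) || (x == parent y) &
  root x == root y]].

Lemma tree_edge_sym : symmetric tree_edge.
Proof.
by move=> x y; rewrite /tree_edge /= [eR x y]inside_sym // orbC [root x == _]eq_sym.
Qed.

Lemma reach_root x : x \in R -> reach tree_edge (depth x) x (root x).
Proof.
have [n] := ubnP (depth x); elim: n x => // n IH x xn xR.
have [xC|xC] := boolP (x \in C); first by rewrite root_center // reach_refl.
have [xp dp] := parentP xR xC; rewrite -root_parent //.
apply: (@reachW _ _ (depth (parent x)).+1) => //.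
apply: (reachS (z := parent x)); first by rewrite /tree_edge /= xp eqxx root_parent // eqxx.
by apply: IH; [exact: leq_trans dp _|exact: parent_in].
Qed.

Lemma reach_same_root x y : x \in R -> y \in R -> root x = root y -> reach tree_edge (4 * rho) x y.
Proof.
move=> xR yR E; apply: (@reachW _ _ (depth x + depth y)).
  by have [? _] := depthP xR; have [? _] := depthP yR; lia.
apply: reach_trans (reach_root xR) _; rewrite E reach_sym; first exact: reach_root.
exact: tree_edge_sym.
Qed.

Definition cross_edges : {set V * V} := [set p | [&& eR p.1 p.2, p.2 != parent p.1 & p.1 != parent p.2]].

Lemma tree_minus x y : (x, y) \in cross_edges -> subrel tree_edge (minus_edge e x y).
Proof.
rewrite inE /= => /and3P[xy yp xp] a b /and3P[ab tab _].
rewrite /minus_edge /= (inside_sub ab) /=; apply/negP => /orP[] /andP[/eqP ax /eqP bY].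
  by move: tab; rewrite ax bY (negPf yp) (negPf xp).
by move: tab; rewrite ax bY (negPf yp) (negPf xp).
Qed.

(** A non-forest edge inside one part would close a cycle of length at most [4 * rho + 1] with a
    forest walk. *)
Lemma cross_root x y : (x, y) \in cross_edges -> root x != root y.
Proof.
move=> xy; apply/eqP => E; have := xy; rewrite inE /= => /andP[/and3P[exy xR yR] _].
apply: (negP (girth_e exy)); apply: reach_mono (tree_minus xy) _ (reach_same_root xR yR E).
by rewrite /rho; lia.
Qed.

(** Two cross edges between the same parts would close a cycle with two forest walks, of length at
    most [8 * rho + 2]. So contracting the parts merges no cross edges. *)
Lemma cross_inj : {in cross_edges &, injective (fun p => (root p.1, root p.2))}.
Proof.
move=> [x y] [x' y'] xy xy' [Ex Ey]; apply/eqP/negPn/negP => ne.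
have := xy; rewrite inE /= => /andP[/and3P[exy xR yR] _].
have := xy'; rewrite inE /= => /andP[/and3P[exy' xR' yR'] _].
apply: (negP (girth_e exy)).
apply: (@reachW _ _ (4 * rho + (4 * rho).+1)); first by rewrite /rho; lia.
apply: reach_trans (reach_mono (tree_minus xy) (leqnn _) (reach_same_root xR xR' Ex)) _.
apply: (reachS (z := y')); last exact: reach_mono (tree_minus xy) (leqnn _)
    (reach_same_root yR' yR (esym Ey)).
rewrite /minus_edge /= exy' -!xpair_eqE negb_or [(x', y') == (x, y)]eq_sym ne /=.
by apply/eqP => -[E1 E2]; have := cross_root xy; rewrite Ex /= E1 eqxx.
Qed.

Definition part z := [set x in R | root x == z].

Lemma part_family : branch_family e C part.
Proof.
split=> [z zC|z z' zC zC' zz'].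
  have zp : z \in part z by rewrite inE (subsetP CR) // root_center ?eqxx.
  apply/andP; split; first by apply/set0Pn; exists z.
  apply/forall_inP => x; rewrite inE => /andP[xR /eqP xz].
  apply/forall_inP => y; rewrite inE => /andP[yR /eqP yz].
  have /reachP[p [p1 <- _]] := reach_same_root xR yR (etrans xz (esym yz)).
  apply/connectP; exists p => //; elim: p x xR xz p1 => //= a p IH x xR xz /andP[/and3P[xa _ xr] ap].
  have /and3P[exa _ aR] := xa.
  have az : root a = z by rewrite -xz; apply/esym/eqP.
  by rewrite /inside /= exa !inE xR aR xz az eqxx /= IH.
apply/pred0P => x /=; rewrite !inE; apply/negbTE.
by apply: contra zz' => /andP[/andP[_ /eqP<-] /andP[_ /eqP<-]].
Qed.

Lemma cross_touching : #|cross_edges| <= #|touching e C part|.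
Proof.
rewrite -(card_in_imset cross_inj); apply/subset_leq_card/subsetP => _ /imsetP[[x y] xy ->].
have := xy; rewrite inE /= => /andP[/and3P[exy xR yR] _].
rewrite inE /= !root_in // cross_root //=.
apply/exists_inP; exists x; first by rewrite inE xR eqxx.
by apply/exists_inP; exists y => //; rewrite inE yR eqxx.
Qed.

(** The minimum degree is 2, so the degree sum is at least [2 * #|R|] plus the number of branch
    vertices. The forest accounts for at most [2 * (#|R| - #|C|)] ordered pairs; the rest are cross
    edges. *)
Lemma cross_count K : (forall z, z \in C -> K <= #|[set x in R | 2 < degree_in e R x & root x == z]|) ->
  (K + 2) * #|C| <= #|cross_edges|.
Proof.
move=> br; pose E : {set V * V} := [set p | eR p.1 p.2].
pose Br := [set x in R | 2 < degree_in e R x].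
have cE : 2 * #|R| + #|Br| <= #|E|.
  apply: (@leq_trans (\sum_(x in R) \sum_(y | (x, y) \in E) 1)).
    have -> : #|Br| = \sum_(x in R) (2 < degree_in e R x).
      rewrite -sum1_card (eq_bigl (fun x => (x \in R) && (2 < degree_in e R x))).
        by rewrite big_mkcondr; apply: eq_bigr => x _; case: (2 < _).
      by move=> x; rewrite inE.
    rewrite mulnC -sum_nat_const -big_split; apply: leq_sum => x xR; rewrite sum1dep_card.
    apply: (@leq_trans (degree_in e R x)).
      by have := deg2 xR; case: (ltnP 2) => /=; lia.
    by apply/subset_leq_card/subsetP => y; rewrite !inE /= => /andP[yR xy]; exact/and3P.
  by rewrite pair_big_dep sum1dep_card; apply/subset_leq_card/subsetP => -[x y]; rewrite
      !inE /= => /andP[].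
have cB : K * #|C| <= #|Br|.
  rewrite -[#|Br|]sum1_card (partition_big root [in C]) /=; last first.
    by move=> x; rewrite inE => /andP[xR _]; exact: root_in.
  rewrite mulnC -sum_nat_const; apply: leq_sum => z zC; apply: leq_trans (br z zC) _.
  by rewrite sum1dep_card; apply/subset_leq_card/subsetP => x; rewrite !inE andbA.
have cT : #|E :\: cross_edges| <= 2 * #|R :\: C|.
  apply: (@leq_trans #|[set (x, parent x) | x in R :\: C] :|: [set (parent x, x) | x in R :\: C]|).
    apply/subset_leq_card/subsetP => -[x y]; rewrite in_setD => /andP[n]; rewrite inE /= => xy.
    have nC a b : eR a b -> b = parent a -> a \in R :\: C.
      move=> ab E1; rewrite inE; case/and3P: (ab) => _ -> _; rewrite andbT.
      by apply/negP => /parent_center E2; move: (inside_sub ab); rewrite E1 E2 e_irr.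
    have /orP[] : (y == parent x) || (x == parent y).
      apply: contraNT n; rewrite negb_or => /andP[yp xp]; rewrite inE; exact/and3P.
    - move=> /eqP E1; apply/setUP; left; apply/imsetP; exists x; [exact: nC E1|by rewrite E1].
    move=> /eqP E1; apply/setUP; right; apply/imsetP; exists y; last by rewrite E1.
    by apply: nC E1; rewrite [eR y x]inside_sym.
  apply: (leq_trans (leq_card_setU _ _)); rewrite mul2n -addnn.
  by apply: leq_add; exact: leq_imset_card.
have sub : cross_edges \subset E by apply/subsetP => p; rewrite !inE => /and3P[].
have := cardsID cross_edges E; rewrite (setIidPr sub) => cI.
have := cardsID C R; rewrite (setIidPr CR) => cR.
by lia.
Qed.

End Parts.

Theorem long_thread : R != set0 -> exists c, thread e R L c.
Proof.
move=> /set0Pn[x0 x0R].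
have [[c cP]|nt] := boolp.EM (exists c, thread e R L c); first by exists c.
exfalso.
have [C [CR Cfar Cnear]] := packing_exists.
have C0 : C != set0 by have [z zC _] := Cnear x0 x0R; apply/set0Pn; exists z.
(* Branch vertices within [rho] of the centre [z] have depth at most [rho], so their root is within
   [2 * rho] of [z] and must be [z]. *)
have cnt z : z \in C -> 6 <= #|[set x in R | 2 < degree_in e R x & root C x == z]|.
  move=> zC; have zR := subsetP CR z zC.
  have [c nb c0] := nonbacktracking_exists (6 * L) deg2 zR.
  have gt6 : girth_gt e (6 * L).
    by move=> x y xy; apply: contra (girth_e xy); apply: reachW; lia.
  have := branch_vertices e_sym e_irr gt6 nb (fun c' h => nt (ex_intro _ c' h)).
  move=> /leq_trans; apply; apply/subset_leq_card/subsetP => x.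
  rewrite !inE c0 => /and3P[xR -> r]; rewrite xR /=; apply/eqP.
  have r' : reach eR rho x z by rewrite reach_sym //; exact: inside_sym.
  apply: Cfar => //; first exact: root_in.
  rewrite mul2n -addnn; apply: (reach_trans _ r'); rewrite reach_sym; last exact: inside_sym.
  apply: reach_mono (depth_le zC r') (reach_root _ _ xR) => // a b /and3P[] //.
(* [6 + 2 = 2 ^ 3] is the density at which [mader] yields five branch sets. *)
have [|Cs [sC cC _]] := @mader V e e_sym V 3 C (part C) (part_family CR Cnear) C0.
  by apply: leq_trans (cross_touching CR Cnear); exact: (cross_count CR Cnear cnt).
exact: noK5 sC.
Qed.

End LongThread.

(** * Greedy colouring along leaves and threads *)

Lemma greedy_recolouring (V : finType) (N : nat) (r : rel V) (Z : {set V}) (c : V -> 'I_N) :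
  symmetric r -> irreflexive r ->
  (forall x y, x \notin Z -> y \notin Z -> r x y -> c x != c y) ->
  (forall z, z \in Z -> #|[set x | r z x]| < N) ->
  exists c' : V -> 'I_N, forall x y, r x y -> c' x != c' y.
Proof.
move=> rs ri; have [n] := ubnP #|Z|; elim: n Z c => // n IH Z c Zn cP dZ.
have [Z0|/set0Pn[z zZ]] := eqVneq Z set0.
  by exists c => x y; apply: cP; rewrite Z0 inE.
have [k kN] : exists k, k \notin [set c x | x in [set x | r z x]].
  apply/existsP; apply: contraTT (dZ z zZ); rewrite negb_exists -leqNgt => /forallP all_in.
  rewrite -[X in X <= _]card_ord; apply: leq_trans (leq_imset_card c _).
  by apply/subset_leq_card/subsetP => k _; move: (all_in k); rewrite negbK.
have [|x y xZ yZ xy|w|c' c'P] := IH (Z :\ z) (fun x => if x == z then k else c x).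
- by move: Zn; rewrite (cardsD1 z) zZ.
- have nk u : r z u -> k != c u.
    by move=> zu; apply: contraNneq kN => ->; apply: imset_f; rewrite inE.
  have [xz|xz] := eqVneq x z; have [yz|yz] := eqVneq y z.
  + by move: xy; rewrite xz yz ri.
  + by apply: nk; rewrite -xz.
  + by rewrite eq_sym; apply: nk; rewrite rs -yz.
  + by apply: cP => //; [move: xZ|move: yZ]; rewrite in_setD1 ?xz ?yz.
- by rewrite in_setD1 => /andP[_]; exact: dZ.
by exists c'.
Qed.

Section Levels.
Variables (V : finType) (e : rel V).
Hypotheses (e_sym : symmetric e) (e_irr : irreflexive e).
Implicit Types (S : {set V}) (lev : V -> nat).

(* Stripping leaves one at a time hangs rooted trees on the core lev = 0. *)
Definition levelling S lev :=
  (forall v, v \in S -> 0 < lev v -> exists p, [/\ inside e S v p, (lev p).+1 = lev v &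
     forall q, inside e S v q -> q != p -> lev q = (lev v).+1]) /\
  (forall v, v \in S -> lev v = 0 -> #|[set q | inside e S v q & lev q == 0]| != 1).

(** A vertex with exactly one neighbour is stripped and gets one level more than that neighbour. A
    tree component thus ends as one isolated vertex of level 0. *)
Lemma levelling_exists S : exists lev, levelling S lev.
Proof.
have [n] := ubnP #|S|; elim: n S => // n IH S Sn.
have [/exists_inP[v vS /cards1P[p vp]]|no1] := boolP [exists v in S, #|[set q | inside e S
    v q]| == 1]; last first.
  exists (fun=> 0); split=> // v vS _; apply: contra no1 => /eqP E.
  apply/exists_inP; exists v; rewrite // -E; apply/eqP/eq_card => q.
  by rewrite !inE eqxx andbT.
have [|lev [l1 l2]] := IH (S :\ v); first by move: Sn; rewrite (cardsD1 v) vS.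
have vpE q : inside e S v q = (q == p) by move/setP/(_ q): vp; rewrite in_set in_set1.
have vp1 : inside e S v p by rewrite vpE.
have pv : p != v by apply: contraTneq (inside_sub vp1) => ->; rewrite e_irr.
have inD x y : inside e (S :\ v) x y = [&& inside e S x y, x != v & y != v].
  by rewrite /inside /= !in_setD1 -!andbA; do !bool_congr.
exists (fun x => if x == v then (lev p).+1 else lev x); split=> x xS.
  have [-> _|xv lx] := eqVneq x v.
    exists p; split=> //; first by rewrite (negPf pv).
    by move=> q; rewrite vpE => ->.
  have [|q [xq lq qu]] := l1 x _ lx; first by rewrite !inE xv.
  exists q; split; first by move: xq; rewrite inD => /andP[].
    by move: xq; rewrite inD => /and3P[_ _ /negPf->].
  move=> w xw wq; have [wv|wv] := eqVneq w v; last by apply: qu => //; rewrite inD xw xv.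
  by move: xw; rewrite wv inside_sym // vpE => /eqP->.
have [//|xv lx] := eqVneq x v.
rewrite (_ : [set _ | _] = [set q | inside e (S :\ v) x q & lev q == 0]).
  by apply: l2; rewrite // !inE xv.
apply/setP => q; rewrite [LHS]in_set [RHS]in_set inD xv.
by have [->|qv] := eqVneq q v; rewrite /= ?andbF ?andbT.
Qed.

Section Fixed.
Variables (S : {set V}) (lev : V -> nat).
Hypothesis lvl : levelling S lev.
Let eS := inside e S.

Definition up v := odflt v [pick p | eS v p && ((lev p).+1 == lev v)].

Lemma upP v : v \in S -> 0 < lev v -> eS v (up v) /\ (lev (up v)).+1 = lev v.
Proof.
move=> vS lv; rewrite /up; case: pickP => [p /andP[vp /eqP lp]|none] //=.
by have [p [vp lp _]] := lvl.1 v vS lv; move: (none p); rewrite [eS v p]vp lp eqxx.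
Qed.

Lemma up_unique v q : 0 < lev v -> eS v q -> lev q <= lev v -> q = up v.
Proof.
move=> lv vq lq; have /and3P[_ vS _] := vq; have [p [vp lp pu]] := lvl.1 v vS lv.
have [vu lu] := upP vS lv.
have -> : q = p by apply/eqP/negPn/negP => /(pu q vq) E; move: lq; rewrite E ltnn.
apply/eqP/negPn/negP; rewrite eq_sym => /(pu _ vu); lia.
Qed.

Lemma neighbour_down x q : 0 < lev x -> eS x q -> q != up x -> lev q = (lev x).+1 /\ up q = x.
Proof.
move=> lx xq qx; have /and3P[_ xS _] := xq; have [p [xp lp pu]] := lvl.1 x xS lx.
have pE : p = up x by apply: up_unique; rewrite // -lp.
have lq : lev q = (lev x).+1 by apply: pu; rewrite ?pE.
by split=> //; apply/esym/up_unique; rewrite ?lq // /eS inside_sym.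
Qed.

Lemma neighbour_core x q : lev x = 0 -> eS x q -> lev q = 0 \/ up q = x /\ lev q = 1.
Proof.
move=> lx xq; case E : (lev q) => [|n]; [by left|right].
have lq : 0 < lev q by rewrite E.
have xu : x = up q by apply: up_unique; rewrite ?lx // /eS inside_sym.
have /and3P[_ _ qS] := xq; have [_] := upP qS lq; rewrite -xu lx E => <-.
by [].
Qed.

Definition below u x := [&& x \in S, lev u <= lev x & iter (lev x - lev u) up x == u].

Lemma below_refl u : u \in S -> below u u.
Proof. by move=> uS; rewrite /below uS leqnn subnn /= eqxx. Qed.

Lemma below_up x q u : x \in S -> q \in S -> up q = x -> (lev x).+1 = lev q -> below u x -> below u q.
Proof.
move=> xS qS qx lq /and3P[_ ux it]; rewrite /below qS -lq leqW //= subSn //.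
by rewrite iterSr qx.
Qed.

Lemma below_step u x q : below u x -> x != u -> eS x q -> below u q.
Proof.
move=> bx xu xq; have /and3P[exq xS qS] := xq; have /and3P[_ ux it] := bx.
have lt : lev u < lev x.
  rewrite ltn_neqAle ux andbT; apply: contra xu => /eqP E.
  by move: it; rewrite E subnn.
have lx : 0 < lev x by exact: leq_ltn_trans lt.
have [E|ne] := eqVneq q (up x); last first.
  by have [lq uq] := neighbour_down lx xq ne; apply: below_up bx.
have [_ lu] := upP xS lx; rewrite /below qS; move: it lt; rewrite -lu ltnS => it lt.
by move: it; rewrite E lt subSn // iterSr.
Qed.

Lemma below_reach u x : below u x -> reach eS (lev x - lev u) x u.
Proof.
have [n] := ubnP (lev x); elim: n x => // n IH x xn bx.
have /and3P[xS ux it] := bx; have [->|xu] := eqVneq x u; first exact: reach_refl.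
have lt : lev u < lev x.
  rewrite ltn_neqAle ux andbT; apply: contra xu => /eqP E.
  by move: it; rewrite E subnn.
have lx : 0 < lev x by exact: leq_ltn_trans lt.
have [xux lux] := upP xS lx.
rewrite -lux subSn; last by rewrite -ltnS lux.
by apply: reachS xux (IH _ _ (below_step bx xu xux)); rewrite -ltnS lux.
Qed.

(** The tree hanging at [u] can only be left through [u], and one step climbs at most one level. *)
Lemma below_walk u v x n : below u v -> reach eS n v x ->
  below u x \/ (lev v - lev u <= n /\ reach eS (n - (lev v - lev u)) u x).
Proof.
elim: n v => [|n IH] v bv; first by rewrite /= orbF => /eqP<-; left.
move=> /reachSP[<-|[w vw wx]]; first by left.
have [vu|vu] := eqVneq v u.
  by right; rewrite vu subnn subn0; split=> //; apply: reachS wx; rewrite -vu.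
have bw := below_step bv vu vw; case: (IH w bw wx) => [|[le r]]; [by left|right].
have lw : lev v <= (lev w).+1.
  have /and3P[_ vS _] := vw; case: (posnP (lev v)) => [->//|lv].
  have [E|ne] := eqVneq w (up v); first by have [_] := upP vS lv; rewrite E => ->.
  by have [-> _] := neighbour_down lv vw ne; lia.
split; first lia.
apply: reachW r; lia.
Qed.

Lemma iter_up v n : v \in S -> n <= lev v ->
  [/\ iter n up v \in S, lev (iter n up v) = lev v - n & below (iter n up v) v] /\
  (forall i, i < n -> e (iter i up v) (iter i.+1 up v)).
Proof.
move=> vS; elim: n => [|n IH] nv; first by rewrite subn0 below_refl.
have [[uS lu bu] st] := IH (ltnW nv); have l0 : 0 < lev (iter n up v) by lia.
have [/and3P[es _ uS'] ls] := upP uS l0; split; last first.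
  by move=> i; rewrite ltnS leq_eqVlt => /orP[/eqP->|/st].
have lE : lev (iter n.+1 up v) = lev v - n.+1 by rewrite /=; lia.
split=> //; rewrite /below lE vS leq_subr /= (_ : lev v - (lev v - n.+1) = n.+1) ?eqxx //; lia.
Qed.

(** A visit to the leaf [v] enters and leaves through the same vertex, so it can be cut out of the
    walk. *)
Lemma reach_avoid_leaf v p n x y : (forall q, eS v q -> q = p) -> x != v -> y != v ->
  reach eS n x y -> reach (inside e (S :\ v)) n x y.
Proof.
move=> leaf + yv; have [k] := ubnP n; elim: k n x => // k IH [|n] x nk xv.
  by rewrite /= !orbF.
move=> /reachSP[->|[w xw]]; first by rewrite reach_refl.
have [wv|wv] := eqVneq w v; last first.
  move=> wy; apply: (reachS (z := w)); last exact: IH.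
  by move: xw; rewrite /eS /inside /= !in_setD1 xv wv.
rewrite {}wv in xw *; case: n nk => [|n] nk; first by rewrite /= orbF eq_sym (negPf yv).
move=> /reachSP[E|[w' vw' w'y]]; first by rewrite -E eqxx in yv.
have -> : x = w' by rewrite (leaf _ vw') (leaf x) // /eS inside_sym.
have w'v : w' != v by apply: contraTneq (inside_sub vw') => ->; rewrite e_irr.
by apply: reachW (IH n w' _ w'v w'y); lia.
Qed.

End Fixed.
End Levels.

Section Upper.
Variables (V : finType) (e : rel V).
Hypotheses (e_sym : symmetric e) (e_irr : irreflexive e).
Variables (X : {set V}) (t N M : nat).
Hypothesis noK5 : forall Cs, clique_minor e Cs -> size Cs <> 5.
Hypothesis girth_e : girth_gt e (48 * (8 * t + 2) + 1).
(** The centre ends a walk of [t] steps from an element of [X]. In the subdivision this fixes its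
    parity, and thereby that it is a vertex of the graph. *)
Hypothesis ball_N : forall (w : nat -> V), w 0 \in X ->
  (forall i, i < t -> e (w i) (w i.+1)) -> #|[set x in X | reach e t (w t) x]| <= N.
Hypothesis ball_M : forall u, #|[set x in X | reach e t.-1 u x]| <= M.
Hypothesis t_gt0 : 0 < t.
Hypothesis MN : (8 * t + 1) * M < N.

(** Distances are taken inside [S], so that the hanging trees and threads of [S] control them. The
    price is that deleting vertices can destroy conflicts. *)
Definition conflict (S : {set V}) : rel V := [rel x y |
  [&& x \in X :&: S, y \in X :&: S, x != y & reach (inside e S) (2 * t) x y]].

Definition colourable (S : {set V}) :=
  exists c : V -> 'I_N, forall x y, conflict S x y -> c x != c y.

Lemma conflict_sym S : symmetric (conflict S).
Proof.
move=> x y; rewrite /conflict /= eq_sym reach_sym; last exact: inside_sym.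
by rewrite andbCA.
Qed.

(** The colouring of [S'] is kept outside [Z], where no conflict may have been lost; [Z] is then
    coloured greedily. *)
Lemma recolour (S S' Z : {set V}) : colourable S' -> S :\: S' \subset Z ->
  (forall x y, x \in S -> y \in S -> x \notin Z -> y \notin Z ->
     reach (inside e S) (2 * t) x y -> reach (inside e S') (2 * t) x y) ->
  (forall z, z \in Z -> z \in X :&: S -> #|[set x | conflict S z x]| < N) -> colourable S.
Proof.
move=> [c cP] SZ rS dZ; apply: (greedy_recolouring (Z := Z :&: (X :&: S)) (c := c)).
- exact: conflict_sym.
- by move=> x; rewrite /conflict /= eqxx !andbF.
- have out (x : V) : x \in X :&: S -> x \notin Z :&: (X :&: S) -> [/\ x \in S, x \notin Z &
  x \in X :&: S'].
    move=> xXS; rewrite in_setI xXS andbT => xZ; move: xXS; rewrite !inE => /andP[xX xS].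
    rewrite xX; split=> //; apply: contraNT xZ => xS'; apply: (subsetP SZ).
    by rewrite inE xS' xS.
  move=> x y xn yn /and4P[xXS yXS xy r]; apply: cP.
  have [xS xZ xX'] := out x xXS xn; have [yS yZ yX'] := out y yXS yn.
  by apply/and4P; split=> //; apply: rS r.
- by move=> z; rewrite inE => /andP[zZ]; exact: dZ.
Qed.

Lemma conflict_reach S x y : conflict S x y ->
  [/\ y \in X, y \in S, x != y & reach (inside e S) (2 * t) x y].
Proof. by case/and4P => _; rewrite inE => /andP[]. Qed.

(** Three deletions are possible: a deepest leaf of level at least [t], a whole tree hanging at an
    isolated core vertex, or the middle of a thread. In the last two cases all levels are below [t],
    so each hanging tree has at most [M] elements of [X]. *)
Lemma colour_step (S : {set V}) : (forall S' : {set V}, S' \proper S -> colourable S') -> colourable S.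
Proof.
move=> IH; have N0 : 0 < N by exact: leq_ltn_trans MN.
have [S0|Sn0] := eqVneq S set0.
  by exists (fun=> Ordinal N0) => x y /and3P[]; rewrite S0 setI0 inE.
have [lev lvl] := levelling_exists e_sym e_irr S.
pose eS := inside e S.
pose U := up e S lev; pose bl := below e S lev.
have [/exists_inP[v0 v0S lv0]|low] := boolP [exists v in S, t <= lev v].
  (* As [v] has maximal level, everything below its [t]-th ancestor is within [t] of that ancestor;
     a walk to any other conflict spends [t] of its [2 * t] steps getting there. So [v] and its
     conflicts share one ball with at most [N] elements of [X]. *)
  have [v /andP[vS tv] vmax] := @arg_maxnP _ v0 (fun v => (v \in S) && (t <= lev v)) lev
      (introT andP (conj v0S lv0)).
  have vm q : q \in S -> lev q <= lev v.
    by move=> qS; case: (leqP t (lev q)) => [tq|/ltnW/leq_trans->//]; apply: vmax; rewrite qS.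
  have l0 : 0 < lev v by exact: leq_trans tv.
  have leaf q : eS v q -> q = U v.
    move=> vq; apply/eqP/negPn/negP => /(neighbour_down e_sym lvl l0 vq)[lq _].
    by have /and3P[_ _ /vm] := vq; rewrite lq ltnn.
  have [[uS lu bu] st] := iter_up lvl vS tv.
  apply: (@recolour S (S :\ v) [set v]).
  - by apply: IH; apply: properD1.
  - by apply/subsetP => x; rewrite !inE negb_and negbK => /andP[/orP[//|/negPf->]].
  - by move=> x y _ _; rewrite !inE => xv yv; apply: reach_avoid_leaf leaf xv yv.
  move=> z; rewrite inE => /eqP->; rewrite inE => /andP[vX _].
  apply: leq_trans (ball_N vX st); rewrite [X in _ < X](cardsD1 v).
  have -> : v \in [set x in X | reach e t (iter t U v) x].
    rewrite inE vX reach_sym //; apply: reach_mono (below_reach e_sym lvl bu).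
      exact: inside_sub.
    by rewrite lu; clear -tv; lia.
  rewrite ltnS; apply/subset_leq_card/subsetP => x; rewrite inE => /conflict_reach[xX xS xv r].
  rewrite !inE eq_sym xv xX /=; case: (below_walk e_sym lvl bu r) => [bx|[_ r']].
    rewrite reach_sym //; apply: reach_mono (below_reach e_sym lvl bx); first exact: inside_sub.
    by have vx := vm x xS; rewrite lu; clear -vx tv; lia.
  apply: reach_mono r'; first exact: inside_sub.
  by rewrite lu; clear -tv; lia.
have {}low v : v \in S -> lev v < t.
  by move=> vS; rewrite ltnNge; apply: contra low => tv; apply/exists_inP; exists v.
have below_M u : #|[set x in X | bl u x]| <= M.
  apply: leq_trans (ball_M u); apply/subset_leq_card/subsetP => x; rewrite !inE => /andP[-> bx].
  have /and3P[xS ux _] := bx; rewrite reach_sym //=.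
  apply: reach_mono (below_reach e_sym lvl bx); first exact: inside_sub.
  by have lx := low x xS; clear -lx; lia.
pose R := [set v in S | lev v == 0].
have R0 : R != set0.
  have [v vS] := set0Pn _ Sn0; have [[uS lu _] _] := iter_up lvl vS (leqnn _).
  by apply/set0Pn; exists (iter (lev v) U v); rewrite inE uS lu subnn.
have RS q : q \in R -> q \in S by rewrite inE => /andP[].
have core_step x q : x \in R -> eS x q -> q \in R \/ bl x q.
  rewrite inE => /andP[xS /eqP lx] xq; have /and3P[_ _ qS] := xq.
  case: (neighbour_core e_sym lvl lx xq) => [lq|[uq lq]]; first by left; rewrite inE qS lq.
  by right; apply: below_up qS uq _ _; rewrite ?lq ?lx //; exact: below_refl.
have N_M m (T : {set V}) : m <= 8 * t + 1 -> #|T| <= m * M -> #|T| < N.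
  move=> m8 /leq_ltn_trans; apply; apply: leq_ltn_trans MN.
  by rewrite leq_mul2r m8 orbT.
(* The tree at an isolated core vertex is closed under adjacency, so removing it affects no distance
   elsewhere. *)
have [/exists_inP[v vR iso]|core] := boolP [exists v in R, [forall q in R, ~~ e v q]].
  have closed x q : bl v x -> eS x q -> bl v q.
    move=> bx xq; have [xv|xv] := eqVneq x v; last exact: (below_step e_sym lvl bx xv xq).
    rewrite xv in xq; case: (core_step _ _ vR xq) => // qR.
    by move/forall_inP/(_ q qR): iso; rewrite (inside_sub xq).
  have closed_reach n x y : bl v x -> reach eS n x y -> bl v y.
    elim: n x => [|n IHn] x bx; first by rewrite /= orbF => /eqP<-.
    by move=> /reachSP[<-//|[w xw]]; apply: IHn; apply: closed xw.
  apply: (@recolour S (S :\: [set x | bl v x]) [set x | bl v x]).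
  - apply: IH; apply/properP; split; first exact: subsetDl.
    by exists v; rewrite ?RS // !inE negb_and negbK [bl v v]below_refl ?RS.
  - by apply/subsetP => x; rewrite !inE negb_and negbK => /andP[/orP[//|/negPf->]].
  - move=> x y _ _; rewrite !inE; move: (2 * t) => n + _.
    elim: n x => [|n IHn] x nx; first by rewrite /= !orbF.
    move=> /reachSP[->|[w xw wy]]; first exact: reach_refl.
    have nw : ~~ bl v w.
      by apply: contra nx => /closed; apply; rewrite /eS inside_sym.
    apply: reachS (IHn w nw wy); case/and3P: xw => exw xS wS.
    by rewrite /inside /= exw !inE nx nw xS wS.
  move=> z; rewrite inE => bz _; apply: (N_M 1); first by rewrite addn1.
  rewrite mul1n; apply: leq_trans (below_M v); apply/subset_leq_card/subsetP => x.
  by rewrite inE => /conflict_reach[xX _ _ r]; rewrite !inE xX; apply: closed_reach r.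
have degR : {in R, forall x, 1 < degree_in e R x}.
  move=> x xR; have := xR; rewrite inE => /andP[xS /eqP lx].
  have := lvl.2 x xS lx; rewrite (_ : [set _ | _] = [set y in R | e x y]); last first.
    by apply/setP => q; rewrite /inside !inE /= xS /=; case: (e x q); rewrite ?andbT ?andbF.
  rewrite /degree_in; case E : #|_| => [|[|n]] // _; case/negP: core.
  apply/exists_inP; exists x => //; apply/forall_inP => q qR; apply/negP => xq.
  by have /card0_eq/(_ q) := E; rewrite inE qR xq.
have [c [cR cT]] := long_thread e_sym e_irr noK5 girth_e degR R0.
(* The middle of the thread. Vertices to be recoloured hang within [2 * t] positions of it and their
   conflicts within [4 * t], at positions 1 to [8 * t + 1]: hence the thread length [8 * t + 2] and
   the factor in [MN]. *)
pose m := 4 * t + 1.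
have cRi i : i < 8 * t + 2 -> c i \in R by move/cR => /and3P[].
(* A walk of [n] steps moves at most [n] positions along the thread; the bounds on [j] keep it from
   leaving through the ends. *)
have walk n j x y : n <= j -> j + n <= 8 * t + 2 -> bl (c j) x -> reach eS n x y ->
    exists i, [/\ i <= j + n, j <= i + n & bl (c i) y].
  elim: n j x => [|n IHn] j x nj jn bx.
    by rewrite /= orbF => /eqP<-; exists j; rewrite addn0.
  move=> /reachSP[<-|[w xw wy]]; first by exists j; rewrite !leq_addr.
  have [k [k1 k2 bw]] : exists k, [/\ k <= j.+1, j <= k.+1 & bl (c k) w].
    have [xc|xc] := eqVneq x (c j); last first.
      by exists j; rewrite leqnSn; split=> //; exact: (below_step e_sym lvl bx xc xw).
    have jR : c j \in R by apply: cRi; clear -nj jn; lia.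
    rewrite xc in xw; case: (core_step _ _ jR xw) => [wR|]; last by exists j; rewrite leqnSn.
    have jw : inside e R (c j) w by rewrite /inside /= jR wR (inside_sub xw).
    have [|->|->] := cT j w _ jw; first by (clear -nj jn; lia).
      by exists j.-1; split; [clear -nj; lia|clear -nj; lia|apply/below_refl/RS/cRi; clear -nj jn; lia].
    exists j.+1; split; [clear; lia|clear; lia|apply/below_refl/RS].
    have jL : j < 8 * t + 2 by clear -jn; lia.
    by case/and3P: (cR j jL).
  have nk : n <= k by clear -nj k2; lia.
  have kn : k + n <= 8 * t + 2 by clear -jn k1; lia.
  have [i [i1 i2 bi]] := IHn k w nk kn bw wy.
  by exists i; split; [clear -i1 k1; lia|clear -i2 k2; lia|].
pose Z := [set x | [exists j : 'I_(8 * t + 2), [&& j <= m + 2 * t, m <= j + 2 * t & bl (c j) x]]].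
have ZP x j : j <= m + 2 * t -> m <= j + 2 * t -> bl (c j) x -> x \in Z.
  move=> j1 j2 bx; have jL : j < 8 * t + 2 by clear -j1; lia.
  by rewrite inE; apply/existsP; exists (Ordinal jL); rewrite j1 j2.
have mR : c m \in R by apply: cRi; clear; lia.
apply: (@recolour S (S :\ c m) Z).
- by apply: IH; apply: properD1; exact: RS.
- apply/subsetP => x; rewrite !inE negb_and negbK => /andP[/orP[/eqP->|/negPf->//] xS].
  by have := @ZP (c m) m; rewrite !leq_addr inE; apply=> //; exact: below_refl.
- move=> x y _ _ + yZ; move=> xZ.
  (* A walk of at most [2 * t] steps that ends outside [Z] cannot pass through [c m], so its
     conflict survives the deletion. *)
  suff gen n w : n <= 2 * t -> reach eS n w y -> reach (inside e (S :\ c m)) n w y /\ w != c m.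
    by move=> r; have [] := gen _ _ (leqnn _) r.
  elim: n w => [|n IHn] w n2 r.
    split; first by move: r; rewrite /= !orbF.
    apply: contraNneq yZ => wm; move: r; rewrite /= orbF wm => /eqP<-.
    by apply: (@ZP _ m); rewrite ?leq_addr //; apply/below_refl/RS.
  have wm : w != c m.
    apply: contraNneq yZ => wm; rewrite wm in r.
    have bm : bl (c m) (c m) by apply/below_refl/RS.
    have n_m : n.+1 <= m by clear -n2; lia.
    have m_n : m + n.+1 <= 8 * t + 2 by clear -n2; lia.
    have [i [i1 i2 bi]] := walk _ _ _ _ n_m m_n bm r.
    by apply: (@ZP _ i) bi; [clear -i1 n2; lia|clear -i2 n2; lia].
  split=> //; case: (reachSP r) => [->|[u wu uy]]; first exact: reach_refl.
  have [r' um] := IHn u (ltnW n2) uy; apply: reachS r'.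
  by move: wu; rewrite /eS /inside /= !in_setD1 wm um.
move=> z; rewrite inE => /existsP[j /and3P[j1 j2 bz]] _; apply: (N_M (8 * t + 1)) => //.
apply: (@leq_trans #|\bigcup_(i < 8 * t + 1) [set x in X | bl (c i.+1) x]|).
  apply/subset_leq_card/subsetP => x; rewrite inE => /conflict_reach[xX _ _ r].
  have tj : 2 * t <= j by clear -j2; lia.
  have jt : j + 2 * t <= 8 * t + 2 by clear -j1; lia.
  have [i [i1 i2 bi]] := walk _ _ _ _ tj jt bz r.
  have i8 : i.-1 < 8 * t + 1 by clear -i1 j1; lia.
  have i0 : 0 < i by clear -i2 j2; lia.
  apply/bigcupP; exists (Ordinal i8) => //; by rewrite !inE xX /= prednK.
apply: leq_trans (_ : \sum_(i < 8 * t + 1) M <= _); last by rewrite sum_nat_const card_ord.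
elim/big_rec2: _ => [|i A k _ h]; first by rewrite cards0.
apply: leq_trans (leq_card_setU _ _) _; apply: leq_add => //; exact: below_M.
Qed.

Theorem sparse_colouring : exists c : V -> 'I_N, forall x y, x \in X -> y \in X ->
  x != y -> reach e (2 * t) x y -> c x != c y.
Proof.
have col S : colourable S.
  have [n] := ubnP #|S|; elim: n S => // n IH S Sn; apply: colour_step => S' /proper_card S'S.
  by apply: IH; exact: leq_trans S'S _.
have [c cP] := col [set: V]; exists c => x y xX yX xy r; apply: cP.
apply/and4P; split; rewrite ?inE ?xX ?yX //.
by apply: reach_mono r => // a b ab; rewrite /inside /= ab !inE.
Qed.

End Upper.

(** * Subdivisions and the sizes of their balls *)

Section Subdivision.
Variable G : sgraph.

(** In the subdivision, distances between vertices and distances between edges are both doubled, so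
    vertex and edge colourings become one problem, restricted to one of two classes. *)
Definition sub_adj : rel (G + edge G) := fun a b =>
  match a, b with
  | inl x, inr e | inr e, inl x => x \in val e
  | _, _ => false
  end.

Lemma sub_adj_sym : symmetric sub_adj.
Proof. by move=> [x|e] [y|f]. Qed.

Lemma sub_adj_irr : irreflexive sub_adj.
Proof. by case. Qed.

End Subdivision.

Lemma ohead_filter_iota (P : pred nat) m k n : n \in iota m k -> P n ->
  exists2 n', ohead [seq i <- iota m k | P i] = Some n' & P n' && (n' <= n).
Proof.
move=> nm Pn; have: n \in [seq i <- iota m k | P i] by rewrite mem_filter Pn.
have: sorted leq [seq i <- iota m k | P i].
  by apply: sorted_filter (iota_sorted m k); exact: leq_trans.
have: all P [seq i <- iota m k | P i] by exact: filter_all.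
case: [seq i <- iota m k | P i] => [//|n' s] /= /andP[Pn' _] ps.
rewrite inE => ns; exists n'; rewrite // Pn' /=; case/orP: ns => [/eqP->//|ns].
by have /allP := order_path_min leq_trans ps; apply.
Qed.

Lemma ohead_filter (P : pred nat) s n : ohead [seq i <- s | P i] = Some n -> P n.
Proof.
have : all P [seq i <- s | P i] by exact: filter_all.
by case: [seq i <- s | P i] => //= m s' /andP[Pm _] [<-].
Qed.

Section Graph.
Variable G : sgraph.
Implicit Types (x y : G) (e f : edge G).

Lemma within_distE t x y : within_dist t x y = reach (@adj G) t x y.
Proof.
apply/idP/reachP => [|[p [xp px pt]]].
  rewrite /within_dist /gdist; case E : ohead => [n|//] nt.
  have /existsP[p /andP[p1 /eqP p2]] := ohead_filter E.
  by exists p; rewrite size_tuple.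
case/shortenP: xp px pt => p' xp' up' sub px pt.
have sp : size p' < #|G|.
  by have := max_card [in x :: p']; rewrite (card_uniqP up').
have := @ohead_filter_iota (fun n => joined n x y) 0 #|G| (size p').
rewrite mem_iota sp /within_dist /gdist => /(_ isT)[|n -> /andP[_ np]].
  by apply/existsP; exists (in_tuple p'); rewrite xp' px eqxx.
apply: leq_trans np _; apply: leq_trans pt.
by apply: uniq_leq_size sub; case/andP: up'.
Qed.

Lemma edge_vertex e x : x \in val e -> exists2 y, adj x y & val e = [set x; y].
Proof.
have /imsetP[[a b] /= + ->] := valP e; rewrite inE => /= ab.
rewrite !inE => /orP[] /eqP->; [by exists b|exists a; last exact: setUC].
by rewrite adj_sym.
Qed.

Lemma adj_edge x y : adj x y -> exists e, val e = [set x; y].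
Proof.
move=> xy; have h : [set x; y] \in edge_set G by apply/imsetP; exists (x, y); rewrite ?inE.
by exists (Sub [set x; y] h); rewrite SubK.
Qed.

Lemma edge_adj e x y : x \in val e -> y \in val e -> x != y -> adj x y /\ val e = [set x; y].
Proof.
move=> /edge_vertex[z xz ->]; rewrite !inE => /orP[/eqP->|/eqP-> _]; last by [].
by rewrite eqxx.
Qed.

Lemma reach_sub_vertex n x y : reach (@adj G) n x y -> reach (@sub_adj G) (2 * n) (inl x) (inl y).
Proof.
elim: n x => [|n IH] x; first by rewrite /= !orbF => /eqP->.
move=> /reachSP[->|[z xz /IH zy]]; first exact: reach_refl.
have [e eE] := adj_edge xz; rewrite mulnS.
by apply: (reachS (z := inr e)); [|apply: reachS zy]; rewrite /= eE !inE eqxx ?orbT.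
Qed.

Lemma reach_sub_edge n e f : reach (@line_adj G) n e f -> reach (@sub_adj G) (2 * n) (inr e) (inr f).
Proof.
elim: n e => [|n IH] e; first by rewrite /= !orbF => /eqP->.
move=> /reachSP[->|[h /andP[_ /set0Pn[z zeh]] /IH hf]]; first exact: reach_refl.
move: zeh; rewrite inE => /andP[ze zh]; rewrite mulnS.
by apply: (reachS (z := inl z)) => //; apply: reachS hf.
Qed.

(** A detour of at most [g] edges closes with the edge [x y] to a cycle of length at most
    [g + 1]. *)
Lemma girth_gt_adj g : girth_at_least G (g + 2) -> girth_gt (@adj G) g.
Proof.
move=> gG x y xy; apply/negP => /reachP[p [xp px pg]].
have yx : y != x by apply: contraTneq xy => ->; rewrite adj_irrefl.
case/shortenP: xp px pg => p' xp' up' sub px pg.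
have sp : size p' <= g.
  by apply: leq_trans pg; apply: uniq_leq_size sub; case/andP: up'.
have s2 : 1 < size p'.
  case: p' xp' px {up' sub sp} => [|z [|//]] /=; first by move=> _ E; rewrite E eqxx in yx.
  by rewrite andbT /minus_edge /= => + E; rewrite E !eqxx andbF.
have cy : ucycleb (@adj G) (x :: p').
  apply/andP; split; last exact: up'.
  rewrite [cycle _ _]rcons_path px adj_sym xy andbT.
  by apply: sub_path xp' => a b /andP[].
have := @ohead_filter_iota (fun n => [exists c : n.-tuple G, ucycleb (@adj G) c]) 3 #|G| (size p').+1.
move: gG; rewrite /girth_at_least /girth => gG /(_ _)/(_ _)[||n E /andP[_ np]].
- have := max_card [in x :: p']; rewrite (card_uniqP up') mem_iota => /= hc.
  by apply/andP; split; [exact: s2|clear -hc; lia].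
- by apply/existsP; exists (in_tuple (x :: p')).
by move: gG; rewrite E; lia.
Qed.

(** A detour from [x] to the edge node [e] that avoids their link must enter [e] from its other end
    [y]; forgetting edge nodes gives a detour from [x] to [y] in [G]. *)
Lemma girth_gt_sub g : girth_gt (@adj G) g -> girth_gt (@sub_adj G) g.
Proof.
move=> gG.
have key x e : x \in val e -> ~~ reach (minus_edge (@sub_adj G) (inl x) (inr e)) g (inl x) (inr e).
  move=> xe; have [y xy eE] := edge_vertex xe; apply: contra (gG x y xy) => r.
  suff proj n u : reach (minus_edge (@sub_adj G) (inl x) (inr e)) n (inl u) (inr e) ->
      reach (minus_edge (@adj G) x y) n u y by exact: proj.
  have [k] := ubnP n; elim: k n u {r} => // k IH [|n] u nk; first by rewrite /= orbF.
  move=> /reachSP[//|[[//|f] /andP[uf]]]; rewrite negb_or negb_and => /andP[ne _] r.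
  have [fe|fe] := eqVneq f e.
    move: (uf : u \in val f) ne; rewrite fe eqxx orbF eE !inE => /orP[/eqP->|/eqP-> _];
      first by rewrite eqxx.
    exact: reach_refl.
  case: n nk r => [|n] nk; first by rewrite /= orbF => /eqP[E]; rewrite E eqxx in fe.
  move=> /reachSP[[E]|[[w|//] /andP[wf _] r]]; first by rewrite E eqxx in fe.
  have {}r : reach (minus_edge (@adj G) x y) n w y by apply: IH r; lia.
  have [->|uw] := eqVneq u w; first by apply: reachW r; lia.
  have [auw fE] := edge_adj uf wf uw.
  apply: reachW (leqnSn _) _; apply: reachS r; rewrite /minus_edge /= auw /=.
  apply: contra fe => h; apply/eqP/val_inj; rewrite /= fE eE.
  by case/orP: h => /andP[/eqP-> /eqP->] //; exact: setUC.
move=> [x|e] [y|f] //= xe; first exact: key.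
rewrite reach_sym; last first.
  by move=> a b; rewrite /minus_edge /= sub_adj_sym orbC (andbC (b == _)) (andbC (b == _)).
by rewrite reach_minusC; exact: key.
Qed.

End Graph.

Section Darts.
Variables (V : finType) (e : rel V).
Hypothesis e_sym : symmetric e.

(* The last steps of the non-backtracking walks of length n.+1 from u. *)
Fixpoint darts u n : {set V * V} :=
  if n is n'.+1 then
    [set p | e p.1 p.2 & [exists x, ((x, p.1) \in darts u n') && (x != p.2)]]
  else [set p | (p.1 == u) && e u p.2].

Lemma dart_edge u n p : p \in darts u n -> e p.1 p.2.
Proof. by case: n => [|n] /=; rewrite inE => /andP[] // /eqP->. Qed.

Lemma reach_last n u x : reach e n.+1 u x -> u = x \/ exists2 y, reach e n u y & e y x.
Proof.
rewrite reach_sym // => /reachSP[->|[y xy yu]]; [by left|right].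
by exists y; [rewrite reach_sym|rewrite e_sym].
Qed.

(** A vertex first reached at step [n.+1] ends a shortest walk, and shortest walks do not
    backtrack. *)
Lemma new_reach_dart n u x : reach e n.+1 u x -> ~~ reach e n u x ->
  exists2 y, (y, x) \in darts u n & reach e n u y.
Proof.
elim: n x => [|n IH] x /reach_last[->|[y uy yx]]; rewrite ?reach_refl // => nx.
  by move: (uy); rewrite /= orbF => /eqP uE; exists y; rewrite // inE /= uE eqxx.
have ny : ~~ reach e n u y.
  by apply: contra nx => ny; rewrite -addn1; apply: reach_trans ny (reach1 yx).
have [z zy uz] := IH y uy ny; exists y => //; rewrite inE /= yx /=.
apply/existsP; exists z; rewrite zy /=; apply: contraNneq nx => <-.
by apply: reachW uz.
Qed.

Lemma reach_dart n u x : reach e n u x -> x = u \/ exists2 j, j < n & exists y, (y, x) \in darts u j.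
Proof.
elim: n => [|n IH]; first by rewrite /= orbF => /eqP->; left.
move=> r; have [/IH[->|[j jn h]]|nr] := boolP (reach e n u x); first by left.
  by right; exists j; rewrite // ltnW.
by have [y yx _] := new_reach_dart r nr; right; exists n => //; exists y.
Qed.

Lemma darts_step u n k : {in darts u n, forall p, #|[set z | e p.2 z]| <= k.+1} ->
  #|darts u n.+1| <= #|darts u n| * k.
Proof.
move=> hk; rewrite -sum_nat_const.
pose F (p : V * V) := [set (p.2, z) | z in [set z | e p.2 z] :\ p.1].
apply: (@leq_trans #|\bigcup_(p in darts u n) F p|).
  apply/subset_leq_card/subsetP => -[y z]; rewrite inE /= => /andP[yz /existsP[x /andP[xy xz]]].
  apply/bigcupP; exists (x, y) => //; apply/imsetP; exists z => //.
  by rewrite !inE eq_sym xz yz.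
elim/big_rec2: _ => [|p A m pu h]; first by rewrite cards0.
apply: leq_trans (leq_card_setU _ _) _; apply: leq_add => //.
apply: leq_trans (leq_imset_card _ _) _; rewrite -ltnS; apply: leq_trans (hk p pu).
by rewrite [X in _ < X](cardsD1 p.1) inE e_sym (dart_edge pu).
Qed.

End Darts.

(** In the [d]-regular tree, the vertices other than the centre within distance [m] of it; equally,
    the edges of these [m] layers. *)
Definition tree_sum d m := \sum_(i < m) d * (d - 1) ^ i.

Section SubCounts.
Variables (G : sgraph) (d : nat).
Hypothesis d_gt0 : 0 < d.
Hypothesis deg_d : forall x : G, #|[set y | adj x y]| <= d.
Let V : finType := (G + edge G)%type.

Definition is_vertex (a : G + edge G) := if a is inl _ then true else false.

Lemma sub_adj_parity (a b : V) : sub_adj a b -> is_vertex b = ~~ is_vertex a.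
Proof. by case: a b => [x|e] [y|f]. Qed.

Lemma sub_degree (a : V) : #|[set z | sub_adj a z]| <= if is_vertex a then d else 2.
Proof.
case: a => [x|e] /=.
  apply: leq_trans (deg_d x).
  pose F (z : V) := if z is inr f then odflt x [pick y | adj x y && (val f == [set x; y])] else x.
  have FP (f : edge G) : x \in val f -> adj x (F (inr f)) /\ val f = [set x; F (inr f)].
    move=> xf; rewrite /F; case: pickP => [y /andP[xy /eqP fE]|none] //=.
    by have [y xy fE] := edge_vertex xf; move: (none y); rewrite xy fE eqxx.
  have inj : {in [set z : V | sub_adj (inl x) z] &, injective F}.
    move=> [y|f] [z|h]; rewrite !inE // => xf xh E.
    have [_ fE] := FP f xf; have [_ hE] := FP h xh.
    by congr inr; apply: val_inj; rewrite fE hE E.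
  rewrite -(card_in_imset inj); apply/subset_leq_card/subsetP => _ /imsetP[[y|f] + ->];
      rewrite !inE // => xf.
  by have [] := FP f xf.
have [x xe] : exists x, x \in val e.
  by have /imsetP[[a b] /= _ ->] := valP e; exists a; rewrite !inE eqxx.
have [y _ eE] := edge_vertex xe.
apply: (@leq_trans #|[set (inl x : V); inl y]|); last by rewrite cards2; case: (_ == _).
apply/subset_leq_card/subsetP => -[z|f]; rewrite inE // => ze.
by move: (ze : z \in val e); rewrite eE !inE => /orP[] /eqP->; rewrite eqxx ?orbT.
Qed.

Lemma darts_parity (u : G) n (p : V * V) : p \in darts (@sub_adj G) (inl u) n -> is_vertex p.2 = odd n.
Proof.
elim: n p => [|n IH] p; rewrite inE; first by move=> /andP[_ /sub_adj_parity].
by move=> /andP[/sub_adj_parity-> /existsP[x /andP[/IH/= -> _]]].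
Qed.

Lemma darts_count (u : G) n : #|darts (@sub_adj G) (inl u) n| <= d * (d - 1) ^ n./2.
Proof.
elim: n => [|n IH].
  rewrite muln1; apply: leq_trans (sub_degree (inl u)).
  apply: leq_trans (leq_imset_card (fun z => (inl u : V, z)) _).
  apply/subset_leq_card/subsetP => -[a z]; rewrite inE /= => /andP[/eqP-> uz].
  by apply/imsetP; exists z; rewrite // inE.
case: (boolP (odd n)) => on.
  have -> : n.+1./2 = n./2.+1 by lia.
  rewrite expnSr mulnA; apply: leq_trans (darts_step (@sub_adj_sym G) (k := d - 1) _) _.
    move=> p /darts_parity; rewrite on => pv; apply: leq_trans (sub_degree _) _.
    by rewrite pv; lia.
  by rewrite leq_mul2r IH orbT.
have -> : n.+1./2 = n./2 by lia.
apply: leq_trans (darts_step (@sub_adj_sym G) (k := 1) _) _; last by rewrite muln1.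
move=> p /darts_parity; rewrite (negPf on) => pv; apply: leq_trans (sub_degree _) _.
by rewrite pv.
Qed.

(** Layers seen in [n] steps of the subdivision from a vertex: vertices ([b] true) come at even
    distances, edges at odd ones. *)
Definition half_of (b : bool) n := if b then n./2 else uphalf n.

Lemma ball_vertex b n (u : G) :
  #|[set a : V | (is_vertex a == b) && reach (@sub_adj G) n (inl u) a]| <= b + tree_sum d (half_of b n).
Proof.
pose W j : {set V} := [set p.2 | p in darts (@sub_adj G) (inl u) j].
apply: (@leq_trans #|[set a : V | b && (a == inl u)] :|: \bigcup_(j < n | odd j == b) W j|).
  apply/subset_leq_card/subsetP => a; rewrite inE => /andP[/eqP ab /reach_dart].
  case=> [|au|[j jn [y ya]]]; first exact: sub_adj_sym.
    by apply/setUP; left; rewrite inE -ab au eqxx.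
  apply/setUP; right; apply/bigcupP; exists (Ordinal jn); last by apply/imsetP; exists (y, a).
  by rewrite /= -(darts_parity ya) /= ab.
apply: leq_trans (leq_card_setU _ _) _; apply: leq_add.
  apply: leq_trans (_ : #|[set a : V in [set inl u] | b]| <= b).
    by apply/subset_leq_card/subsetP => a; rewrite !inE andbC.
  case: b; last by rewrite leqn0 cards_eq0; apply/eqP/setP => a; rewrite !inE andbF.
  rewrite -[true : nat](cards1 (inl u : V)).
  by apply/subset_leq_card/subsetP => a; rewrite !inE => /andP[].
elim: n => [|n IH].
  by rewrite big_ord0 cards0.
rewrite big_mkcond big_ord_recr -big_mkcond /=; apply: leq_trans (leq_card_setU _ _) _.
case: eqP => nb.
  have -> : half_of b n.+1 = n./2.+1 by rewrite /half_of -nb; case: ifP => o; lia.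
  rewrite /tree_sum big_ord_recr /=; apply: leq_add.
    apply: leq_trans IH _; rewrite (_ : half_of b n = n./2) //.
    by rewrite /half_of -nb; case: ifP => o; lia.
  exact: leq_trans (leq_imset_card _ _) (darts_count u n).
rewrite cards0 addn0; apply: leq_trans IH _; rewrite (_ : half_of b n.+1 = half_of b n) //.
by rewrite /half_of; case: b nb => /eqP; rewrite ?eqb_id ?eqbF_neg => o; lia.
Qed.

Lemma tree_sum_mono m n : m <= n -> tree_sum d m <= tree_sum d n.
Proof. by move=> mn; rewrite /tree_sum -(subnKC mn) big_split_ord leq_addr. Qed.

(** The ball around an edge node is covered by the node and the balls of radius [n - 1] at its two
    ends; the 3 pays for the node and both centres. *)
Lemma ball_any b n (c : V) :
  #|[set a : V | (is_vertex a == b) && reach (@sub_adj G) n c a]| <=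
    2 * tree_sum d (maxn (half_of b n.-1) (if is_vertex c then half_of b n else 0)) + 3.
Proof.
case: c => [u|e] /=.
  apply: leq_trans (ball_vertex b n u) _.
  have := tree_sum_mono (leq_maxr (half_of b n.-1) (half_of b n)).
  by case: b; lia.
rewrite maxn0; case: n => [|n].
  apply: (@leq_trans #|[set (inr e : V)]|); last by rewrite cards1; lia.
  apply/subset_leq_card/subsetP => a; rewrite in_set in_set1 => /andP[_].
  by rewrite /= orbF => /eqP<-.
have [x xe] : exists x, x \in val e.
  by have /imsetP[[a b'] /= _ ->] := valP e; exists a; rewrite !inE eqxx.
have [y _ eE] := edge_vertex xe.
pose B z := [set a : V | (is_vertex a == b) && reach (@sub_adj G) n (inl z) a].
apply: (@leq_trans #|[set inr e] :|: (B x :|: B y)|).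
  apply/subset_leq_card/subsetP => a; rewrite in_set => /andP[ab /reachSP[<-|[[z|//] ze r]]].
    by rewrite !inE eqxx.
  move: (ze : z \in val e); rewrite eE !inE ab /= => /orP[] /eqP zE; rewrite -zE r ?orbT //.
apply: leq_trans (leq_card_setU _ _) _; rewrite cards1.
have h := (leq_card_setU (B x) (B y)).1; have hx := ball_vertex b n x.
have hy := ball_vertex b n y; have hb : b <= 1 := leq_b1 b.
rewrite -/(B x) -/(B y) /= in hx hy *; clear -h hx hy hb.
move: #|_ :|: _| #|B x| #|B y| (tree_sum _ _) h hx hy => *; lia.
Qed.

End SubCounts.

(** * Odd cycles with hanging regular trees *)

Section Unicyclic.
Variables (n' q r : nat).
Hypotheses (n_gt2 : 1 < n') (q_gt1 : 1 < q).
Local Notation n := n'.+1.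
Local Notation Q := (q ^ r.+1).

(* Vertex (i, a) is the node a of the tree hanging at the i-th cycle vertex
   (i, 0). The nodes are numbered breadth first: the parent of a > 0 is
   a %/ q, so those of depth at most m are the a < q ^ m. *)
Definition unode : finType := ('I_n * 'I_Q.-1.+1)%type.

Definition cyc (i : nat) : 'I_n := inord (i %% n).
Definition node (i a : nat) : unode := (cyc i, inord a).

(** The graph is that of one map, the parent map in the trees and the backward rotation on the
    cycle, [n'] being -1 modulo [n]. An inner node [a > 0] has the [q] children [a * q + b] with
    [b < q]; a root has only [q - 1], as [b = 0] gives the root itself, but two neighbours on the
    cycle. So inner vertices have degree [q + 1]. *)
Definition toward (x : unode) : unode :=
  if x.2 == 0 :> nat then node (x.1 + n') 0 else (x.1, inord (x.2 %/ q)).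

Lemma Q_gt0 : 0 < Q. Proof. by rewrite expn_gt0 ltnW. Qed.

Lemma cycE i : cyc i = i %% n :> nat.
Proof. by rewrite inordK // ltn_pmod. Qed.

Lemma cyc_val (i : 'I_n) : cyc i = i.
Proof. by apply: val_inj; rewrite /= cycE modn_small. Qed.

Lemma node_a i a : a < Q -> (node i a).2 = a :> nat.
Proof. by move=> aQ; rewrite inordK // prednK // Q_gt0. Qed.

Lemma node_val (x : unode) : x = node x.1 x.2.
Proof. by case: x => i a; rewrite /node cyc_val /= inord_val. Qed.

Lemma unode_lt (x : unode) : x.2 < Q.
Proof. by apply: leq_trans (ltn_ord x.2) _; rewrite prednK // Q_gt0. Qed.

Lemma toward0 i : toward (node i 0) = node (i + n') 0.
Proof.
rewrite /toward node_a ?Q_gt0 //= /node; congr (_, _); apply: val_inj.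
by rewrite /= !cycE modnDml.
Qed.

Lemma toward_pos i a : 0 < a < Q -> toward (node i a) = node i (a %/ q).
Proof. by move=> /andP[a0 aQ]; rewrite /toward node_a // gtn_eqF. Qed.

Lemma toward_snd x : (toward x).2 = x.2 %/ q :> nat.
Proof.
rewrite /toward; case: ifP => [/eqP->|_] /=; first by rewrite node_a ?Q_gt0 // div0n.
by rewrite inordK // (leq_ltn_trans (leq_div _ _) (ltn_ord x.2)).
Qed.

Lemma toward_neq x : toward x != x.
Proof.
apply/eqP; rewrite /toward; case: ifP => [/eqP x0 /(congr1 (fun y : unode => nat_of_ord y.1))|/negbT].
  rewrite /= cycE => E; have : x.1 + n' == x.1 + 0 %[mod n].
    by rewrite addn0 E modn_small ?ltn_ord.
  by rewrite eqn_modDl mod0n modn_small // => /eqP n0; move: n_gt2; rewrite n0.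
rewrite -lt0n => x0 /(congr1 (fun y : unode => nat_of_ord y.2)) /=.
have lt : x.2 %/ q < x.2 by rewrite ltn_Pdiv.
by rewrite inordK ?(ltn_trans lt) // => E; rewrite E ltnn in lt.
Qed.

Lemma toward2_neq x : toward (toward x) != x.
Proof.
apply/eqP; case: (posnP x.2) => [x0|x0].
  rewrite [x]node_val x0 !toward0 => /(congr1 (fun y : unode => nat_of_ord y.1)).
  rewrite /= !cycE => /eqP E.
  have : n' + n' == 0 %[mod n] by rewrite -(eqn_modDl x.1) addn0 addnA.
  have -> : n' + n' = n'.-1 + n by clear -n_gt2; lia.
  by rewrite modnDr mod0n modn_small; clear -n_gt2; lia.
move=> /(congr1 (fun y : unode => nat_of_ord y.2)); rewrite /= !toward_snd => E.
have lt : x.2 %/ q < x.2 by rewrite ltn_Pdiv.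
by have := leq_div (x.2 %/ q) q; rewrite E leqNgt lt.
Qed.

Definition uadj : rel unode := [rel x y | (toward x == y) || (toward y == x)].

Lemma uadj_sym : symmetric uadj.
Proof. by move=> x y; rewrite /uadj /= orbC. Qed.

Lemma uadj_irrefl : irreflexive uadj.
Proof. by move=> x; rewrite /uadj /= orbb (negPf (toward_neq x)). Qed.

Definition unicyclic : sgraph := SGraph uadj_sym uadj_irrefl.
End Unicyclic.

(* On a cycle of the graph of f, a step against f is followed by steps against f only. *)
Lemma functional_path (T : eqType) (f : T -> T) (x y : T) s :
  path [rel a b | (f a == b) || (f b == a)] y s -> f y = x -> uniq [:: x, y & s] ->
  f (last y s) = last x (belast y s).
Proof.
elim: s x y => //= z s IH x y /andP[yz zs] fy; rewrite !inE !negb_or -!andbA.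
move=> /and5P[xy xz xs yz' /and3P[ys zs' us]]; apply: IH => //.
  by case/orP: yz => /eqP // E; rewrite -fy E eqxx in xz.
by rewrite /= inE negb_or yz' ys zs'.
Qed.

(** If the first step goes against [f], so do the later ones. The image of the last vertex is then
    its predecessor, so the closing step can only mean that [f x] is the last vertex. *)
Lemma functional_cycle (T : eqType) (f : T -> T) (c : seq T) : 2 < size c -> uniq c ->
  cycle [rel a b | (f a == b) || (f b == a)] c -> {in c, forall x, f x \in c}.
Proof.
move=> sc uc cc x xc; have [i c' rc] := rot_to xc.
have mr z : (z \in c) = (z \in x :: c') by rewrite -rc mem_rot.
move: sc uc cc; rewrite -(size_rot i) -(rot_uniq i) -(rot_cycle i) rc mr => {rc mr}.
case: c' => [//|y [//|z s]] _ u /=; rewrite rcons_path => /and3P[xy yz /andP[zs cl]].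
case/orP: xy => /eqP xy; first by rewrite xy !inE eqxx orbT.
have lE := @functional_path T f x y (z :: s) (introT andP (conj yz zs)) xy u.
case/orP: cl => /eqP cl; last by rewrite cl 2!in_cons mem_last !orbT.
have : last y (belast z s) \in y :: z :: s.
  have := mem_last y (belast z s); rewrite !inE => /orP[->//|/mem_belast].
  by rewrite inE => /orP[] ->; rewrite ?orbT.
by move: lE u; rewrite /= cl => <- /andP[/negP].
Qed.

Section Girth.
Variables (n' q r : nat).
Hypotheses (n_gt2 : 1 < n') (q_gt1 : 1 < q).
Local Notation n := n'.+1.
Local Notation G := (unicyclic r n_gt2 q_gt1).

(** A cycle is closed under [toward], so it contains a root and then all [n] cycle vertices. *)
Lemma unicyclic_girth g : g <= n -> girth_at_least G g.
Proof.
move=> gn; rewrite /girth_at_least; case E : (girth G) => [m|//].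
apply: leq_trans gn _; have m3 : 2 < m.
  move: E; rewrite /girth => E; have : m \in [seq k <- iota 3 #|G| | [exists c : k.-tuple
    G, ucycleb (@adj G) c]].
    by case: [seq _ <- _ | _] E => //= k s [->]; rewrite mem_head.
  by rewrite mem_filter mem_iota => /and3P[].
have /existsP[c /andP[cc uc]] := ohead_filter E.
have cl := functional_cycle (_ : 2 < size c) uc cc.
rewrite size_tuple in cl; have {}cl := cl m3.
have xc := mem_tnth (Ordinal (ltnW (ltnW m3))) c; move: (tnth _ _) xc => x xc.
have iter_c k z : z \in c -> iter k (@toward n' q r) z \in c.
  by move=> zc; elim: k => //= k IH; exact: cl.
have [i ic] : exists i, node n' q r i 0 \in c.
  have : (iter x.2 (@toward n' q r) x).2 = 0 :> nat.
    suff h k : (iter k (@toward n' q r) x).2 <= x.2 - k by apply/eqP; rewrite -leqn0 -(subnn x.2).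
    elim: k => [|k IH]; first by rewrite subn0.
    rewrite iterS toward_snd //.
    case: (posnP (iter k (@toward n' q r) x).2) => [->|h]; first by rewrite div0n.
    by have := ltn_Pdiv q_gt1 h; lia.
  move=> h; exists (iter x.2 (@toward n' q r) x).1; have := node_val (iter x.2 (@toward n'
    q r) x); rewrite h => <-.
  exact: iter_c.
have all_c (j : 'I_n) : node n' q r j 0 \in c.
  have it k : iter k (@toward n' q r) (node n' q r i 0) = node n' q r (i + k * n') 0.
    elim: k => [|k IHk]; first by rewrite addn0.
    by rewrite iterS IHk toward0 // mulSn (addnC n') addnA.
  (* [m'.+1] is [i + n - j], the number of backward steps that lead from [i] to [j] modulo [n]. *)
  pose m' := i + n' - j.
  suff -> : node n' q r j 0 = node n' q r (i + m'.+1 * n') 0 by rewrite -it; exact: iter_c.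
  have jn : j <= n' by rewrite -ltnS ltn_ord.
  have -> : i + m'.+1 * n' = m' * n + j by rewrite mulSn mulnS /m'; clear -jn; lia.
  by rewrite /node; congr (_, _); apply: val_inj; rewrite /= !cycE modnMDl.
have inj : injective (fun j : 'I_n => node n' q r j 0).
  by move=> j k [] /(congr1 (@nat_of_ord n)); rewrite !cycE !modn_small // => /ord_inj.
have := @uniq_leq_size _ (map (fun j : 'I_n => node n' q r j 0) (enum 'I_n)) c.
rewrite map_inj_uniq // enum_uniq size_map -cardE card_ord size_tuple; apply=> //.
by move=> _ /mapP[j _ ->].
Qed.

(** Preimages under [toward] have different numbers modulo [q]: for a cycle vertex, number 0 is the
    next cycle vertex and the others are children. *)
Lemma unicyclic_degree_le (x : G) : #|[set y | adj x y]| <= q.+1.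
Proof.
pose P := [set y : G | toward y == x].
have PQ : #|P| <= q.
  have q0 : 0 < q by exact: ltnW.
  pose res (y : G) := Ordinal (ltn_pmod y.2 q0).
  have inj : {in P &, injective res}.
    move=> y z; rewrite !inE => /eqP yx /eqP zx /(congr1 val) /= yz.
    have E : y.2 %/ q = z.2 %/ q.
      by rewrite -[LHS](toward_snd q_gt1) -[RHS](toward_snd q_gt1) yx zx.
    have E2 : y.2 = z.2 by apply: ord_inj; rewrite (divn_eq y.2 q) (divn_eq z.2 q) E yz.
    move: yx zx; rewrite /toward -E2; case: ifP => y0.
      move=> <- /(congr1 (fun y : unode n' q r => y.1)) /= /(congr1 (@nat_of_ord n)).
      rewrite !cycE => /eqP; rewrite eqn_modDr !modn_small // => /eqP/ord_inj zy.
      by apply: injective_projections; rewrite ?zy.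
    move=> <- /(congr1 (fun y : unode n' q r => y.1)) /= zy.
    by apply: injective_projections; rewrite ?zy.
  by rewrite -(card_in_imset inj) -[X in _ <= X](card_ord q) max_card.
apply: (@leq_trans #|toward x |: P|).
  apply/subset_leq_card/subsetP => y; rewrite !inE /adj /= => /orP[] /eqP <-; rewrite eqxx ?orbT //.
by rewrite cardsU1; case: (_ \notin _); rewrite ?add0n ?add1n ?ltnS //; exact: leqW.
Qed.

Lemma unicyclic_degree : max_degree G = q.+1.
Proof.
apply/eqP; rewrite eqn_leq; apply/andP; split.
  by apply/bigmax_leqP => x _; exact: unicyclic_degree_le.
pose x : G := node n' q r 0 0.
apply: leq_trans (@leq_bigmax _ (fun x : G => #|[set y | adj x y]|) x).
have qQ : q <= q ^ r.+1 by rewrite expnS leq_pmulr // expn_gt0 ltnW.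
pose F (b : 'I_q) : G := if b == 0 :> nat then node n' q r 1 0 else node n' q r 0 b.
have Fs b : (F b).2 = b :> nat.
  rewrite /F; case: eqP => [->|_] /=; first by rewrite node_a ?Q_gt0.
  by rewrite node_a // (leq_trans (ltn_ord b)).
have Finj : injective F by move=> b c E; apply: ord_inj; rewrite -!Fs E.
have tF b : toward (F b) = x.
  rewrite /F; case: (posnP b) => [b0|b0].
    rewrite toward0 // /x /node; congr (_, _); apply: val_inj.
    by rewrite /= !cycE add1n modnn mod0n.
  rewrite toward_pos ?b0 ?(leq_trans (ltn_ord b)) // divn_small //.
have tx : toward x \notin [set F b | b : 'I_q].
  apply/imsetP => -[b _ E]; have := toward2_neq n_gt2 q_gt1 x.
  by rewrite E tF eqxx.
apply: (@leq_trans #|toward x |: [set F b | b : 'I_q]|).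
  by rewrite cardsU1 tx card_imset // card_ord.
apply/subset_leq_card/subsetP => y; rewrite !inE /adj /= => /orP[/eqP->|/imsetP[b _ ->]].
  by apply/orP; left.
by apply/orP; right; rewrite tF.
Qed.

End Girth.

(* All colours missed by B i.+1 form a set of size mu, which contains the
   colours of Lv i and of Lv i.+2; so these differ little. *)
Lemma colour_drift (T : finType) (N k beta mu lam : nat) (c : T -> 'I_N) (B Lv : nat -> {set T}) :
  (forall i, {in B i &, injective c}) -> (forall i, beta <= #|B i|) ->
  (forall i, {in Lv i &, injective c}) -> (forall i, #|Lv i| = lam) ->
  (forall i x y, x \in Lv i -> y \in B i.+1 -> c x != c y) ->
  (forall i x y, x \in Lv i.+2 -> y \in B i.+1 -> c x != c y) ->
  (forall x y, x \in Lv 0 -> y \in Lv (2 * k) -> c x != c y) ->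
  N <= beta + mu -> k * (mu - lam) < lam -> False.
Proof.
move=> Bi Bb Li Ll LB BL L0 Nb kl; pose A i := c @: Lv i.
have cA i : #|A i| = lam by rewrite card_in_imset.
have step i : #|A i :\: A i.+2| <= mu - lam.
  have sub : A i :|: A i.+2 \subset ~: (c @: B i.+1).
    apply/subsetP => z; rewrite !inE => /orP[] /imsetP[x xL ->]; apply/imsetP => -[y yB /eqP].
      by rewrite (negPf (LB _ _ _ xL yB)).
    by rewrite (negPf (BL _ _ _ xL yB)).
  have le := subset_leq_card sub; have cC := cardsC (c @: B i.+1).
  rewrite card_ord card_in_imset // in cC.
  have := cardsID (A i.+2) (A i :|: A i.+2).
  rewrite (setIidPr (subsetUr _ _)) setDUl setDv setU0 cA.
  by have := Bb i.+1; lia.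
have drift j : #|A 0 :\: A (2 * j)| <= j * (mu - lam).
  elim: j => [|j IH]; first by rewrite muln0 setDv cards0.
  have sub : A 0 :\: A (2 * j.+1) \subset (A 0 :\: A (2 * j)) :|: (A (2 * j) :\: A (2 * j).+2).
    rewrite (_ : 2 * j.+1 = (2 * j).+2); last by lia.
    apply/subsetP => z; rewrite !in_setD in_setU !in_setD; move: (z \in A (2 * j).+2).
    by case: (z \in A 0); case: (z \in A (2 * j)) => -[].
  apply: leq_trans (subset_leq_card sub) _; apply: leq_trans (leq_card_setU _ _) _.
  by rewrite mulSn addnC leq_add.
have := drift k; rewrite cardsD cA (_ : A 0 :&: A (2 * k) = set0) ?cards0 ?subn0; last first.
  apply/setP => z; rewrite !inE; apply/andP => -[/imsetP[x xL ->] /imsetP[y yL /eqP]].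
  by rewrite (negPf (L0 _ _ xL yL)).
by move=> h; have := leq_ltn_trans h kl; rewrite ltnn.
Qed.

(** * Bands and balls around the cycle vertices *)

Section Walks.
Variables (n' q r : nat).
Hypotheses (n_gt2 : 1 < n') (q_gt1 : 1 < q).
Local Notation n := n'.+1.
Local Notation Q := (q ^ r.+1).
Local Notation G := (unicyclic r n_gt2 q_gt1).
Local Notation nd := (node n' q r).
Local Notation reachG := (reach (@adj G)).

Lemma adj_toward (x : G) : @adj G x (toward x).
Proof. by rewrite /adj /= /uadj /= eqxx. Qed.

Lemma reach_root_node m i a : a < q ^ m -> a < Q -> reachG m (nd i a) (nd i 0).
Proof.
elim: m a => [|m IH] a am aQ; first by move: am; rewrite ltnS leqn0 => /eqP->; exact: reach_refl.
case: (posnP a) => [->|a0]; first exact: reach_refl.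
apply: (reachS (adj_toward _)); rewrite toward_pos ?a0 //; apply: IH.
  by rewrite ltn_divLR ?(ltnW q_gt1) // -expnSr.
exact: leq_ltn_trans (leq_div _ _) aQ.
Qed.

Lemma node_mod i a : nd (i + n) a = nd i a.
Proof. by rewrite /node; congr (_, _); apply: val_inj; rewrite /= !cycE modnDr. Qed.

Lemma reach_cycle i m : reachG m (nd (i + m) 0) (nd i 0).
Proof.
elim: m => [|m IH]; first by rewrite addn0 reach_refl.
apply: (reachS (adj_toward _)); rewrite toward0 //.
by rewrite (_ : i + m.+1 + n' = i + m + n) ?node_mod //; lia.
Qed.

Lemma reach_cycle_dist i j m : i <= j + m -> j <= i + m -> reachG m (nd i 0) (nd j 0).
Proof.
move=> ij ji; case: (leqP i j) => h; last first.
  by rewrite -(subnKC (ltnW h)); apply: reachW (reach_cycle _ _); lia.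
rewrite reach_sym; last exact: adj_sym.
by rewrite -(subnKC h); apply: reachW (reach_cycle _ _); lia.
Qed.

Lemma node_inj i j a b : a < Q -> b < Q -> nd i a = nd j b -> i = j %[mod n] /\ a = b.
Proof.
move=> aQ bQ E; split.
  by have := congr1 (fun x : unode n' q r => nat_of_ord x.1) E; rewrite /= !cycE.
have := congr1 (fun x : unode n' q r => nat_of_ord x.2) E.
by rewrite !node_a.
Qed.

(** Nodes of depth exactly [r] in the tree at position [i]. For [r = 0] the lower limit [1 %/ q] is
    0 and the band is the cycle vertex. *)
Definition band (i : nat) : {set G} :=
  [set x : G | (x.1 == cyc n' i) && (q ^ r %/ q <= x.2 < q ^ r)].

Definition width s := minn s (2 * r - s).

(** The ball of radius [r] around the cycle vertex [i]: position [i - r + s] is at distance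
    [|s - r|], which leaves depth [width s] in its tree. Adding [n] keeps the subtraction exact. *)
Definition tree_ball (i : nat) : {set G} :=
  (fun p : 'I_(2 * r).+1 * 'I_Q.-1.+1 => nd (i + n - r + p.1) p.2) @:
    [set p : 'I_(2 * r).+1 * 'I_Q.-1.+1 | p.2 < q ^ width p.1].

Lemma qrQ m : m <= r -> q ^ m < Q.
Proof. by move=> mr; rewrite ltn_exp2l. Qed.

Lemma card_ord_lt m k : k <= m -> #|[set a : 'I_m | a < k]| = k.
Proof.
move=> km; rewrite -sum1dep_card -(big_ord_widen m (fun=> 1) km).
by rewrite sum_nat_const card_ord muln1.
Qed.

Lemma band_card i : #|band i| = q ^ r - q ^ r %/ q.
Proof.
pose A k := [set a : 'I_Q.-1.+1 | a < k].
have AS : A (q ^ r %/ q) \subset A (q ^ r).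
  by apply/subsetP => a; rewrite !inE => /leq_trans; apply; exact: leq_div.
have lQ : q ^ r <= Q.-1.+1 by rewrite prednK ?Q_gt0 // ltnW // qrQ.
have -> : band i = [set (cyc n' i, a) | a in A (q ^ r) :\: A (q ^ r %/ q)].
  apply/setP => -[j a]; rewrite inE /=; apply/andP/imsetP => [[/eqP-> h]|[b + [-> ->]]].
    by exists a; rewrite // !inE -leqNgt.
  by rewrite !inE -leqNgt => h; rewrite eqxx.
rewrite card_imset => [|a b [] //]; rewrite cardsD (setIidPr AS) !card_ord_lt //.
exact: leq_trans (leq_div _ _) lQ.
Qed.

Definition geo m := \sum_(l < m) q ^ l.

Lemma tree_ball_card i : 2 * r < n -> r <= i + n -> geo r + geo r.+1 <= #|tree_ball i|.
Proof.
move=> rn ri; rewrite card_in_imset; last first.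
  have aQ (a : 'I_Q.-1.+1) : a < Q by apply: leq_trans (ltn_ord a) _; rewrite prednK // Q_gt0.
  move=> [s a] [s' a'] _ _ /(node_inj (aQ _) (aQ _))[/eqP E /ord_inj /= ->].
  move: E; rewrite /= eqn_modDl !modn_small; [|exact: leq_trans (ltn_ord _) _..].
  by move=> /eqP/ord_inj->.
rewrite -sum1dep_card -(pair_big_dep xpredT (fun (s : 'I_(2 * r).+1) (a : 'I_Q.-1.+1) => a
    < q ^ width s) (fun _ _ => 1)) /=.
rewrite (eq_bigr (fun s : 'I_(2 * r).+1 => q ^ width s)) => [|s _]; last first.
  rewrite sum1dep_card card_ord_lt // prednK ?Q_gt0 // ltnW // qrQ // /width; clear; lia.
rewrite -(big_mkord xpredT (fun s => q ^ width s)) (big_cat_nat (n := r)) //=; last by clear; lia.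
rewrite /geo -(big_mkord xpredT (fun l => q ^ l)) -(big_mkord xpredT (fun l => q ^ l)) leq_add //.
  by rewrite leq_eqVlt; apply/orP; left; apply/eqP/eq_big_nat => s h; congr (q ^ _);
      rewrite /width; clear -h; lia.
rewrite leq_eqVlt; apply/orP; left; apply/eqP.
rewrite [RHS]big_nat_rev /= -{2}[r]add0n big_addn (_ : (2 * r).+1 - r = r.+1); last by clear; lia.
by apply: eq_big_nat => s h; congr (q ^ _); rewrite /width; clear -h; lia.
Qed.

Lemma tree_ballP i x : x \in tree_ball i ->
  exists s a, [/\ s <= 2 * r, a < q ^ width s, a < Q & x = nd (i + n - r + s) a].
Proof.
case/imsetP => -[s a]; rewrite inE /= => aw ->; exists s, a; split=> //.
  by rewrite -ltnS.
by apply: leq_trans aw (ltnW (qrQ _)); rewrite /width; have := ltn_ord s; lia.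
Qed.

Hypothesis rn : 2 * r < n'.

(** In the two neighbouring trees the ball reaches depth [r - 1] only, one short of the band. *)
Lemma tree_ball_band i x : x \in tree_ball i.+1 ->
  (x.1 = cyc n' i) \/ (x.1 = cyc n' i.+2) -> x.2 < q ^ r %/ q.
Proof.
have q0 : 0 < q by exact: ltnW.
have small s a : 0 < r -> width s = r.-1 -> a < q ^ width s -> a < q ^ r %/ q.
  by case: (r) => // m _ ->; rewrite expnSr mulnK.
have dvd_between m j : n %| m -> j * n < m -> m < j.+2 * n -> m = j.+1 * n.
  case/dvdnP => l ->; rewrite !ltn_pmul2r // => jl lj; congr (_ * _); clear -jl lj; lia.
case/tree_ballP => s [a [s2 aw aQ ->]]; rewrite node_a //= => h.
have [sr s0] : (s = r.-1 \/ s = r.+1) /\ 0 < r.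
  case: h => /(congr1 (@nat_of_ord n)); rewrite !cycE => /eqP.
    rewrite eqn_mod_dvd; last by clear -rn; lia.
    move/(dvd_between _ 0) => h; have {}h : i.+1 + n - r + s - i = 1 * n by apply: h; clear -rn s2; lia.
    by split; [left|]; clear -h rn; lia.
  move=> E; have : i.+1 + n - r + s + n == i.+2 %[mod n] by rewrite modnDr.
  rewrite eqn_mod_dvd; last by clear -rn; lia.
  move/(dvd_between _ 1) => h; have {}h : i.+1 + n - r + s + n - i.+2 = 2 * n by apply: h;
    clear -rn s2; lia.
  by split; [right|]; clear -h rn s2; lia.
apply: (small s) => //; rewrite /width; case: sr => ->; clear -s0; lia.
Qed.

Variable (edges : bool).
Hypothesis edges_r : edges -> 0 < r.

(** With [edges], a vertex stands for the edge from it to its image under [toward], and an end of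
    this edge has to be within [r - 1]. *)
Definition close_to (x y : G) :=
  if edges then reachG r.-1 x y || reachG r.-1 (toward x) y else reachG r x y.

(** The edge named by position [i - r] leads to position [i - r - 1], out of the ball, so it is
    dropped; this is the 1 by which the edge count is smaller. *)
Definition ball_part i := if edges then tree_ball i :\ nd (i + n - r) 0 else tree_ball i.

Lemma close_band i x : x \in band i -> close_to x (nd i 0).
Proof.
rewrite inE => /andP[/eqP xi /andP[lo hi]]; rewrite /close_to [x]node_val xi.
have -> : node n' q r (cyc n' i) x.2 = nd i x.2 by rewrite /node cyc_val.
have := unode_lt q_gt1 x; move: (nat_of_ord x.2) lo hi => a lo hi aQ.
case: ifP => [/edges_r r0|_]; last exact: reach_root_node.
apply/orP; right; have a0 : 0 < a.
  by apply: leq_trans lo; rewrite -(prednK r0) expnSr mulnK ?expn_gt0 ltnW.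
rewrite toward_pos ?a0 //; apply: reach_root_node; last exact: leq_ltn_trans (leq_div _ _) aQ.
by rewrite ltn_divLR ?(ltnW q_gt1) // -expnSr prednK.
Qed.

Lemma close_ball i x : x \in ball_part i -> close_to x (nd i 0).
Proof.
have -> : nd i 0 = nd (i + n) 0 by rewrite node_mod.
rewrite /ball_part /close_to; case: ifP => [/edges_r r0|_].
  rewrite in_setD1 => /andP[ne /tree_ballP[s [a [s2 aw aQ xE]]]]; rewrite xE in ne *.
  have s0 : 0 < s.
    rewrite lt0n; apply: contraNneq ne => s0; move: aw.
    by rewrite /width s0 min0n expn0 ltnS leqn0 => /eqP->; rewrite addn0.
  case: (posnP a) => [a0|a0]; last first.
    apply/orP; right; rewrite toward_pos ?a0 //.
    have w0 : 0 < width s by case: (width s) aw a0 => //; rewrite expn0 ltnS leqn0 => /eqP->.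
    have wr : width s <= r by rewrite /width; clear -s2; lia.
    apply: reachW (_ : (width s).-1 + (r - width s) <= _) _; first by clear -r0 w0 wr; lia.
    apply: (@reach_trans _ _ _ _ _ (nd (i + n - r + s) 0)).
      apply: reach_root_node; last exact: leq_ltn_trans (leq_div _ _) aQ.
      by rewrite ltn_divLR ?(ltnW q_gt1) // -expnSr prednK.
    by apply: reach_cycle_dist; rewrite /width; clear -s2 rn; lia.
  rewrite a0; apply/orP; have [sr|sr] := leqP s r.
    by left; apply: reach_cycle_dist; clear -s0 sr r0 rn; lia.
  right; rewrite toward0 // (_ : i + n - r + s + n' = i + n - r + s.-1 + n); last by clear -s0; lia.
  by rewrite node_mod; apply: reach_cycle_dist; clear -sr s2 rn; lia.
case/tree_ballP => s [a [s2 aw aQ ->]].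
apply: reachW (_ : width s + (r - width s) <= _) _; first by rewrite /width; clear -s2; lia.
apply: (@reach_trans _ _ _ _ _ (nd (i + n - r + s) 0)); first exact: reach_root_node.
by apply: reach_cycle_dist; rewrite /width; clear -s2 rn; lia.
Qed.

Lemma ball_band i j x y : x \in band i -> y \in ball_part j.+1 ->
  (x.1 = cyc n' i -> x.1 = cyc n' j \/ x.1 = cyc n' j.+2) -> x != y.
Proof.
move=> xL yB h; apply: contraTneq xL => xy; rewrite inE; apply/negP => /andP[/eqP/h xj /andP[lo _]].
have xB : x \in tree_ball j.+1.
  by rewrite xy; move: yB; rewrite /ball_part; case: ifP => // _; rewrite in_setD1 => /andP[].
by have := leq_ltn_trans lo (tree_ball_band xB xj); rewrite ltnn.
Qed.

(** A ball leaves at most [q ^ r] colours to the bands on both sides, and each of these uses all but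
    [q ^ r %/ q] of that number. So a double step changes at most [q ^ r %/ q] colours, and for
    [k.+1 < q] the [k] double steps from 0 to [2 * k] cannot exchange all of them, although these
    two positions are adjacent. *)
Lemma no_colouring k N (c : G -> 'I_N) : n' = 2 * k -> k.+1 < q ->
  (forall x x' i j, close_to x (nd i 0) -> close_to x' (nd j 0) ->
     [\/ j = i, j = i.+1 | i = j.+1] -> x != x' -> c x != c x') ->
  N + edges <= geo r + geo r.+1 + q ^ r -> False.
Proof.
move=> nk kq cP NB.
pose beta := geo r + geo r.+1 - edges.
have geo1 : 0 < geo r.+1 by rewrite /geo big_ord_recl.
have lo_le : q * (q ^ r %/ q) <= q ^ r by rewrite mulnC leq_trunc_div.
apply: (@colour_drift G N k beta (q ^ r) (q ^ r - q ^ r %/ q) c ball_part band).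
- move=> i x x' xB x'B; apply: contra_eq => ne.
  by apply: (cP x x' i i); [exact: close_ball|exact: close_ball|exact: Or31|].
- move=> i; have h : geo r + geo r.+1 <= #|tree_ball i| by apply: tree_ball_card; clear -rn; lia.
  rewrite /beta /ball_part.
  case: (edges); last by rewrite subn0.
  by rewrite leq_subLR; apply: leq_trans h _; rewrite (cardsD1 (nd (i + n - r) 0)
      (tree_ball i)) leq_add2r leq_b1.
- move=> i x x' xB x'B; apply: contra_eq => ne.
  by apply: (cP x x' i i); [exact: close_band|exact: close_band|exact: Or31|].
- exact: band_card.
- move=> i x y xL yB; apply: (cP x y i i.+1); [exact: close_band|exact: close_ball|exact: Or32|].
  by apply: (ball_band xL yB); left.
- move=> i x y xL yB; apply: (cP x y i.+2 i.+1); [exact: close_band|exact: close_ball|exact: Or33|].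
  by apply: (ball_band xL yB); right.
- move=> x y xL yL; apply: (cP x y n (2 * k)); [|exact: close_band|by apply: Or33; rewrite -nk|].
    by rewrite -[n]add0n node_mod; exact: close_band.
  apply: contraTneq xL => ->; move: yL; rewrite !inE => /andP[/eqP-> _]; apply/negP => /andP[/eqP].
  move/(congr1 (@nat_of_ord n)); rewrite !cycE -nk modn_small // mod0n => n0 _.
  by move: n_gt2; rewrite n0.
- by rewrite /beta; move: NB geo1; case: (edges); clear; lia.
rewrite subKn ?leq_div // ltn_subRL -mulSn.
have [->|lo0] := posnP (q ^ r %/ q); first by rewrite muln0 expn_gt0 ltnW.
by apply: leq_trans lo_le; rewrite ltn_pmul2r.
Qed.

End Walks.

(** * Continuous drawings *)

From mathcomp Require Import all_classical all_reals all_analysis.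
Import Order.TTheory GRing.Theory Num.Theory.
Import numFieldNormedType.Exports.

Section Arcs.
Local Open Scope ring_scope.
Local Open Scope classical_set_scope.
Variable R : realType.

Lemma within_continuousP (f : R -> R * R) :
  {within `[0, 1], continuous f} -> forall s eps, 0 <= s <= 1 -> 0 < eps ->
  exists2 d, 0 < d & forall u, 0 <= u <= 1 -> `|s - u| < d -> near_points eps (f s) (f u).
Proof.
move/subspace_continuousP => fc s eps s01 eps0.
have sA : `[0, 1] s by rewrite /= in_itv.
have /cvgrPdist_lt/(_ _ eps0) := fc s sA.
rewrite near_withinE => /nbhs_ballP[d /= d0 h].
exists d => // u u01 su; have := h u su; rewrite in_itv => /(_ u01).
by rewrite prod_normE /= gt_max.
Qed.

Lemma within_continuousI (f : R -> R * R) :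
  (forall s eps, 0 <= s <= 1 -> 0 < eps ->
  exists2 d, 0 < d & forall u, 0 <= u <= 1 -> `|s - u| < d -> near_points eps (f s) (f u)) ->
  {within `[0, 1], continuous f}.
Proof.
move=> h; apply/subspace_continuousP => s; rewrite /= in_itv => s01.
apply/cvgrPdist_lt => eps eps0; have [d d0 hd] := h s eps s01 eps0.
rewrite near_withinE; apply/nbhs_ballP; exists d => //= u su; rewrite in_itv => u01.
rewrite prod_normE /= gt_max. exact: hd.
Qed.

(** Compactness of the unit interval, in the form used three times below: what holds near each point
    for all small [e] holds everywhere for a single [e]. *)
Lemma uniformize (P : R -> R -> Prop) :
  (forall s, 0 <= s <= 1 -> exists2 d, 0 < d & forall e u, 0 <= u <= 1 ->
     `|s - u| < d -> 0 < e -> e < d -> P e u) ->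
  exists2 e, 0 < e & forall u, 0 <= u <= 1 -> P e u.
Proof.
move=> loc.
have := @segment_compact R 0 1.
rewrite compact_near_coveringP => /(_ _ 0^'+ (fun e u => 0 <= u <= 1 -> P e u) _).
case=> [s|].
  rewrite /= in_itv => /loc[d d0 h].
  exists (ball s d, [set e | 0 < e < d]) => /=; first split.
  - exact: nbhsx_ballx.
  - near=> e; apply/andP; split; near: e; [exact: nbhs_right_gt|exact: nbhs_right_lt].
  - by move=> [u e] /= [su /andP[e0 ed]] u01; exact: h.
move=> d /= d0 h; exists (d / 2); first by rewrite divr_gt0.
move=> u u01; apply: (h (d / 2)) => //=; rewrite ?in_itv //=.
- by rewrite sub0r normrN ger0_norm ?divr_ge0 ?ltW // ltr_pdivrMr // mulr2n mulrDr mulr1 ltrDl.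
- by rewrite divr_gt0.
Unshelve. all: by end_near.
Qed.

Lemma uniform_continuity (f : R -> R * R) eps :
  {within `[0, 1], continuous f} -> 0 < eps ->
  exists2 d, 0 < d & forall s u, 0 <= s <= 1 -> 0 <= u <= 1 -> `|s - u| < d ->
    near_points eps (f s) (f u).
Proof.
move=> /within_continuousP cf eps0.
have [s s01|d d0 h] := @uniformize (fun d s => forall u, 0 <= u <= 1 -> `|s - u| < d ->
    near_points eps (f s) (f u)).
  have [||d d0 h] := cf s (eps / 2); rewrite ?divr_gt0 //.
  exists (d / 2); first by rewrite divr_gt0.
  move=> e u u01 su e0 ed v v01 uv.
  have := h u u01; have := h v v01; rewrite /near_points.
  have dd : `|s - v| < d.
    apply: le_lt_trans (ler_distD u _ _) _; lra.
  rewrite dd (_ : `|s - u| < d); last lra.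
  move=> /(_ isT)/andP[v1 v2] /(_ isT)/andP[u1 u2].
  apply/andP; split.
    by apply: le_lt_trans (ler_distD (f s).1 _ _) _; rewrite (distrC (f u).1); lra.
  by apply: le_lt_trans (ler_distD (f s).2 _ _) _; rewrite (distrC (f u).2); lra.
by exists d => // s u s01; exact: h.
Qed.

Lemma near_points_sym eps (p q : R * R) : near_points eps p q = near_points eps q p.
Proof. by rewrite /near_points !(distrC _ q.1) !(distrC _ q.2). Qed.

Lemma near_points_trans eps1 eps2 (q p r : R * R) :
  near_points eps1 p q -> near_points eps2 q r -> near_points (eps1 + eps2) p r.
Proof.
move=> /andP[p1 p2] /andP[r1 r2]; apply/andP; split.
  by apply: le_lt_trans (ler_distD q.1 _ _) _; rewrite ltrD.
by apply: le_lt_trans (ler_distD q.2 _ _) _; rewrite ltrD.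
Qed.

Lemma near_pointsW eps1 eps2 (p q : R * R) :
  eps1 <= eps2 -> near_points eps1 p q -> near_points eps2 p q.
Proof. by move=> le12 /andP[h1 h2]; rewrite /near_points !(lt_le_trans _ le12). Qed.

Lemma point_arc_far (f : R -> R * R) (p : R * R) :
  {within `[0, 1], continuous f} -> (forall s, 0 <= s <= 1 -> f s <> p) ->
  exists2 d, 0 < d & forall s, 0 <= s <= 1 -> ~~ near_points d (f s) p.
Proof.
move=> /within_continuousP cf fp.
apply: (@uniformize (fun d s => ~~ near_points d (f s) p)) => s s01.
have [d d0 far] : exists2 d, 0 < d & ~~ near_points (d + d) (f s) p.
  pose m := Num.max `|(f s).1 - p.1| `|(f s).2 - p.2|.
  exists (m / 2); last first.
    by rewrite -splitr /near_points -gt_max ltxx.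
  rewrite divr_gt0 // lt_max !normr_gt0 !subr_eq0 -negb_and; apply/negP => /andP[/eqP E1 /eqP E2].
  by apply: (fp s s01); rewrite [f s]surjective_pairing E1 E2 -surjective_pairing.
have [//|d' d'0 h] := cf s d s01.
exists (Num.min d d') => [|e u u01]; first by rewrite lt_min d0.
rewrite !lt_min => /andP[_ /(h u u01) su] e0 /andP[ed _].
by apply: contra far => /(near_pointsW (ltW ed)); exact: near_points_trans.
Qed.

Lemma arcs_far (f g : R -> R * R) :
  {within `[0, 1], continuous f} -> {within `[0, 1], continuous g} ->
  (forall s u, 0 <= s <= 1 -> 0 <= u <= 1 -> f s <> g u) ->
  exists2 d, 0 < d & forall s u, 0 <= s <= 1 -> 0 <= u <= 1 ->
    ~~ near_points d (f s) (g u).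
Proof.
move=> cf cg fg.
have [s s01|d d0 h] := @uniformize (fun d s => forall u, 0 <= u <= 1 ->
    ~~ near_points d (f s) (g u)); last by exists d => // s u; move/h; apply.
have [u u01|d d0 far] := @point_arc_far g (f s) cg; first exact/nesym/fg.
have [||d' d'0 h] := within_continuousP cf (s := s) (eps := d / 2); rewrite ?divr_gt0 //.
exists (Num.min (d / 2) d') => [|e u u01]; first by rewrite lt_min d'0 divr_gt0.
rewrite !lt_min => /andP[_ /(h u u01) su] e0 /andP[ed _] v v01.
apply: contra (far v v01) => /(near_pointsW (ltW ed)) uv; rewrite near_points_sym [d]splitr.
exact: near_points_trans su uv.
Qed.

Lemma finite_uniform (T : finType) (P : T -> R -> Prop) :
  (forall t d d', 0 < d' -> d' <= d -> P t d -> P t d') ->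
  (forall t, exists2 d, 0 < d & P t d) -> exists2 d, 0 < d & forall t, P t d.
Proof.
move=> mono ex; suff [d d0 h] : exists2 d, 0 < d & forall t, t \in enum T -> P t d.
  by exists d => // t; apply: h; rewrite mem_enum.
elim: (enum T) => [|t s [d d0 IH]]; first by exists 1.
have [d' d'0 h] := ex t; have m0 : 0 < Num.min d d' by rewrite lt_min d0.
exists (Num.min d d') => // x; rewrite inE => /orP[/eqP->|/IH].
  by apply: mono h; rewrite // ge_min lexx orbT.
by apply: mono; rewrite // ge_min lexx.
Qed.

End Arcs.

Section Chained.
Variables (I : Type) (P : I -> I -> Prop).
Fixpoint chained (i : I) (s : seq I) : Prop :=
  if s is j :: s' then P i j /\ chained j s' else True.

Lemma chained_cat i s t : chained i s -> chained (last i s) t -> chained i (s ++ t).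
Proof. by elim: s i => //= j s IH i [ij /IH h] /h. Qed.

Lemma chained_iota (g : nat -> I) m n :
  (forall k, m <= k < m + n -> P (g k) (g k.+1)) ->
  chained (g m) (map g (iota m.+1 n)).
Proof.
elim: n m => //= n IH m h; split; first by apply: h; rewrite leqnn addnS ltnS leq_addr.
by apply: IH => k /andP[mk kn]; apply: h; rewrite (ltnW mk) /= -addSnnS.
Qed.

End Chained.

Lemma chained_seg_cross (I : eqType) (chi : I -> I -> I -> bool) P a b i s :
  (forall j k, P j k -> crossing chi a b j k = false) -> chained P i s ->
  seg_cross chi a b i s = false.
Proof. by move=> h; elim: s i => //= j s IH i [/h-> /IH->]. Qed.

Lemma chained_path_cross (I : eqType) (chi : I -> I -> I -> bool) P Q i s i' s' :
  (forall j k j' k', P j k -> Q j' k' -> crossing chi j k j' k' = false) ->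
  chained P i s -> chained Q i' s' -> path_cross chi i s i' s' = false.
Proof.
move=> h + ch'; elim: s i => //= j s IH i [ij /IH->].
rewrite addbF; exact: chained_seg_cross (fun j' k' => h i j j' k' ij) ch'.
Qed.

Section Drawing.
Local Open Scope ring_scope.
Local Open Scope classical_set_scope.
Variables (R : realType) (V : finType) (e : rel V).
Variables (pt : V -> R * R) (h : V -> V -> R -> R * R).
Hypothesis h_cont : forall x y, e x y -> {within `[0, 1], continuous (h x y)}.
Hypothesis h_ends : forall x y, e x y -> h x y 0 = pt x /\ h x y 1 = pt y.
Hypothesis h_indep : forall x y z w, e x y -> e z w ->
  (x \notin [:: z; w]) && (y \notin [:: z; w]) ->
  forall s u, 0 <= s <= 1 -> 0 <= u <= 1 -> h x y s <> h z w u.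

(** Both ends of a polygon piece are within [2 * eps] of one point of the arc, one [eps] for the
    sampling step and one for the perturbation. Two pieces that met would bring independent arcs
    within [4 * eps]. *)
Lemma separated_sampling : exists N eps, [/\ 0 < eps,
  forall x y z w, e x y -> e z w -> (x \notin [:: z; w]) && (y \notin [:: z; w]) ->
   forall s u, 0 <= s <= 1 -> 0 <= u <= 1 ->
   ~~ near_points (4%:R * eps) (h x y s) (h z w u) &
  forall x y k, e x y -> (k <= N)%N ->
   near_points eps (h x y (k%:R / N.+1%:R)) (h x y (k.+1%:R / N.+1%:R))].
Proof.
have [|[[[x y] z] w] /=|d d0 hd] := @finite_uniform R (V * V * V * V)%type
  (fun q d => let: (x, y, z, w) := q in e x y -> e z w ->
    (x \notin [:: z; w]) && (y \notin [:: z; w]) ->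
    forall s u, 0 <= s <= 1 -> 0 <= u <= 1 -> ~~ near_points d (h x y s) (h z w u)).
- move=> [[[x y] z] w] d d' _ dd' hq xy zw i s u s01 u01.
  by apply: contra (hq xy zw i s u s01 u01); exact: near_pointsW.
- have [/and3P[xy zw i]|/negP n] := boolP [&& e x y, e z w &
      (x \notin [:: z; w]) && (y \notin [:: z; w])]; last first.
    by exists 1 => // xy zw i; case: n; apply/and3P.
  have [d d0 hd] := arcs_far (h_cont xy) (h_cont zw) (h_indep xy zw i).
  by exists d => // *; exact: hd.
pose eps := d / 4%:R; have eps0 : 0 < eps by rewrite divr_gt0.
have [|[x y] /=|c c0 hc] := @finite_uniform R (V * V)%type (fun q c => e q.1 q.2 ->
   forall s u, 0 <= s <= 1 -> 0 <= u <= 1 -> `|s - u| < c ->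
    near_points eps (h q.1 q.2 s) (h q.1 q.2 u)).
- by move=> [x y] c c' _ cc' hq xy s u s01 u01 su; apply: hq => //; exact: lt_le_trans cc'.
- have [xy|_] := boolP (e x y); last by exists 1.
  have [c c0 hc] := uniform_continuity (h_cont xy) eps0; by exists c.
(* Makes the sampling step [1 / (N + 1)] smaller than the modulus of continuity [c]. *)
pose N := Num.truncn c^-1; exists N, eps; split=> //.
  move=> x y z w xy zw i s u s01 u01; rewrite /eps mulrC divfK ?pnatr_eq0 //.
  exact: (hd (x, y, z, w)).
have N0 : 0 < N.+1%:R :> R by [].
move=> x y k xy kN; apply: (hc (x, y)) => //.
- by rewrite divr_ge0 //= ler_pdivrMr // mul1r ler_nat ltnW.
- by rewrite divr_ge0 //= ler_pdivrMr // mul1r ler_nat.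
rewrite -mulrBl -natr1 opprD addrA subrr sub0r mulN1r normrN ger0_norm ?invr_ge0 //.
rewrite invf_plt ?posrE //; exact: truncnS_gt.
Qed.

Lemma segment_near eps (p q r : R * R) (s : R) : 0 <= s <= 1 ->
  near_points eps r p -> near_points eps r q -> near_points eps r (segment_point p q s).
Proof.
move=> /andP[s0 s1] /andP[p1 p2] /andP[q1 q2].
have cvx (a b c : R) : `|a - b| < eps -> `|a - c| < eps ->
    `|a - ((1 - s) * b + s * c)| < eps.
  rewrite !ltr_norml => /andP[b1 b2] /andP[c1 c2].
  have [->|sp] := eqVneq s 0; first by rewrite subr0 mul0r addr0 mul1r b1.
  have {}s0 : 0 < s by rewrite lt0r sp.
  by apply/andP; split; nra.
by rewrite /near_points /= !cvx.
Qed.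

(** Each walk becomes the polygon through perturbed samples of its arcs. Polygons of independent
    pairs then do not cross at all, against [K5_crossing]. *)
Theorem K5_not_drawable (v : nat -> V) (W : nat -> nat -> seq V) :
  (forall i j, (i < 5)%N -> (j < 5)%N -> i != j ->
    path e (v i) (W i j) /\ last (v i) (W i j) = v j) ->
  (forall i j k l, uniq [:: i; j; k; l] -> (i < 5)%N -> (j < 5)%N -> (k < 5)%N ->
     (l < 5)%N -> {in v k :: W k l, forall z, z \notin v i :: W i j}) ->
  False.
Proof.
move=> Wp Wd; have [N [eps [eps0 far close]]] := separated_sampling.
(* Points are indexed formally, by vertices and by samples of ordered edges, so that disjoint walks
   have disjoint index lists; [g] glues the ends of an arc to the vertices. *)
pose I := (V + V * V * 'I_N.+1)%type.
pose g x y k : I :=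
  if k == 0%N then inl x else if k == N.+1 then inl y else inr (x, y, inord k).
pose p0 (i : I) := match i with inl x => pt x
  | inr (x, y, k) => h x y ((k : nat)%:R / N.+1%:R) end.
have p0g x y k : e x y -> (k <= N.+1)%N -> p0 (g x y k) = h x y (k%:R / N.+1%:R).
  move=> xy kN; have [h0 h1] := h_ends xy; rewrite /g.
  case: eqVneq => [->|k0]; first by rewrite mul0r h0.
  case: eqVneq => [->|k1]; first by rewrite divff ?pnatr_eq0 // h1.
  by rewrite /p0 inordK // ltn_neqAle k1.
have [q gp qp0] := perturbation p0 eps0.
pose wpath := fix wpath x (p : seq V) : seq I :=
  if p is y :: p' then map (g x y) (iota 1 N.+1) ++ wpath y p' else [::].
pose on (S : seq V) (i : I) := match i with inl x => x \in S
  | inr (x, y, k) => (x \in S) && (y \in S) end.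
have on_g S x y k : x \in S -> y \in S -> on S (g x y k).
  by move=> xS yS; rewrite /g; do 2 case: ifP => // _; rewrite /= xS yS.
have last_arc x y : last (inl x) (map (g x y) (iota 1 N.+1)) = inl y.
  have -> : iota 1 N.+1 = iota 1 N ++ [:: N.+1] by have := iotaD 1 N 1; rewrite addn1 add1n.
  by rewrite map_cat last_cat /= /g eqxx.
have lastw x p : last (inl x) (wpath x p) = inl (last x p).
  by elim: p x => //= y p IH x; rewrite -IH last_cat -[X in last X]/(last (inl x) (map (g x
      y) (iota 1 N.+1))) last_arc.
have onw S x p : {subset x :: p <= S} -> forall i, i \in inl x :: wpath x p -> on S i.
  elim: p x => [|y p IH] x sub i; rewrite in_cons => /orP[/eqP->|//].
  - by apply: sub; rewrite mem_head.
  - by apply: sub; rewrite mem_head.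
  rewrite mem_cat => /orP[/mapP[k _ ->]|iw].
    by apply: on_g; apply: sub; rewrite !inE eqxx ?orbT.
  apply: (IH y); last by rewrite inE iw orbT.
  by move=> z zp; apply: sub; rewrite inE zp orbT.
have on_disj S S' i : on S i -> on S' i -> exists2 x, x \in S & x \in S'.
  by case: i => [x|[[x y] k]] /=; [|move=> /andP[+ _] /andP[+ _]]; exists x.
pose piece (S : seq V) (i j : I) := exists x y k,
  [/\ e x y, (x \in S) && (y \in S), (k <= N)%N, i = g x y k & j = g x y k.+1].
have pieces x p : path e x p -> chained (piece (x :: p)) (inl x) (wpath x p).
  suff gen S : {subset x :: p <= S} -> path e x p -> chained (piece S) (inl x) (wpath x p).
    exact: gen.
  elim: p x => // y p IH x sub; rewrite [path _ _ _]/= => /andP[xy yp].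
  rewrite -[wpath x (y :: p)]/(map (g x y) (iota 1 N.+1) ++ wpath y p).
  apply: chained_cat.
    apply: (@chained_iota _ _ (g x y) 0) => k /= kN; exists x, y, k; split=> //.
    by rewrite !sub // !inE eqxx ?orbT.
  by rewrite last_arc; apply: IH => // z zp; apply: sub; rewrite inE zp orbT.
have piece_near S i j : piece S i j -> exists x y s, [/\ e x y, (x \in S) && (y \in S),
    0 <= s <= 1, on [:: x; y] i /\ on [:: x; y] j &
    near_points (2%:R * eps) (h x y s) (q i) /\ near_points (2%:R * eps) (h x y s) (q j)].
  move=> [x [y [k [xy xyS kN -> ->]]]]; exists x, y, (k%:R / N.+1%:R).
  have k1 : 0 <= (k%:R / N.+1%:R : R) <= 1.
    by rewrite divr_ge0 //= ler_pdivrMr // mul1r ler_nat ltnW.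
  have e2 : 2%:R * eps = eps + eps by ring.
  split=> //; first by split; apply: on_g; rewrite !inE eqxx ?orbT.
  split.
    rewrite near_points_sym -p0g // ?(leq_trans kN) //.
    by apply: near_pointsW (qp0 _); lra.
  rewrite e2; apply: near_points_trans (close _ _ _ xy kN) _.
  by rewrite near_points_sym -p0g.
have rot := ccw_rot q; have deg := ccw_degenerate q.
have swap := ccw_swap gp; have four := ccw_four gp; have five := ccw_five gp.
apply: (@K5_crossing _ (ccw q) rot swap deg four five (fun i => inl (v i)) (fun i j =>
    wpath (v i) (W i j))).
- by move=> i j i5 j5 ij; rewrite lastw; case: (Wp i j i5 j5 ij) => _ ->.
- move=> i j k l u i5 j5 k5 l5 z /(onw _ _ _ (fun _ => id)) z1.
  apply/negP => /(onw _ _ _ (fun _ => id)) z2; have [x x1 x2] := on_disj _ _ _ z1 z2.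
  by move: (Wd _ _ _ _ u i5 j5 k5 l5 _ x1); rewrite x2.
move=> i j k l u i5 j5 k5 l5.
have ij : i != j by move: u; rewrite /= !inE !negb_or => /andP[/andP[]].
have kl : k != l by move: u; rewrite /= !inE !negb_or => /and4P[_ _ ->].
have [pij _] := Wp _ _ i5 j5 ij; have [pkl _] := Wp _ _ k5 l5 kl.
apply: chained_path_cross (pieces _ _ pij) (pieces _ _ pkl) => a b c d.
move=> /piece_near[x [y [s [xy /andP[xS yS] s01 [oa ob] [na nb]]]]].
move=> /piece_near[z [w [t [zw /andP[zS wS] t01 [oc od] [nc nd]]]]].
have dxy z' : z' \in v k :: W k l -> z' \notin [:: x; y].
  move=> /(Wd _ _ _ _ u i5 j5 k5 l5) n; apply: contra n.
  by rewrite !inE => /orP[] /eqP->; rewrite -in_cons.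
have ind : (x \notin [:: z; w]) && (y \notin [:: z; w]).
  have := dxy z zS; have := dxy w wS; rewrite !inE !negb_or !(eq_sym x) !(eq_sym y).
  by move=> /andP[-> ->] /andP[-> ->].
have odj m n : on [:: x; y] m -> on [:: z; w] n -> m != n.
  move=> om; apply: contraTneq => <-; apply/negP => om'.
  have [x' x1 x2] := on_disj _ _ _ om om'; case/andP: ind => i1 i2.
  by move: x1; rewrite !inE => /orP[] /eqP E; move: x2; rewrite E; apply/negP.
have [->|ab] := eqVneq a b; first by rewrite /crossing !deg.
have [->|cd] := eqVneq c d; first by rewrite crossing_sym /crossing !deg.
apply/negP => cr.
have uu : uniq [:: a; b; c; d].
  by rewrite /= !inE !negb_or ab cd !odj.
have [s' [t' [s'01 t'01 E]]] := crossing_meet gp uu cr.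
have := segment_near s'01 na nb; have := segment_near t'01 nc nd.
rewrite -E near_points_sym => n1 n2; move: (near_points_trans n2 n1).
by apply/negP; rewrite -mulrDl -natrD; apply: far.
Qed.

End Drawing.

Section NoMinor.
Local Open Scope ring_scope.
Local Open Scope classical_set_scope.
Variables (R : realType) (V : finType) (e : rel V).
Hypothesis e_sym : symmetric e.

Definition drawing (pt : V -> R * R) (h : V -> V -> R -> R * R) :=
  [/\ forall x y, e x y -> {within `[0, 1], continuous (h x y)},
      forall x y, e x y -> h x y 0 = pt x /\ h x y 1 = pt y &
      forall x y z w, e x y -> e z w ->
        (x \notin [:: z; w]) && (y \notin [:: z; w]) ->
        forall s u, 0 <= s <= 1 -> 0 <= u <= 1 -> h x y s <> h z w u].

Lemma connect_inside (B : {set V}) x y : connect (inside e B) x y -> x \in B ->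
  exists p, [/\ path e x p, last x p = y & all [in B] (x :: p)].
Proof.
move=> /connectP[p + ->] xB; elim: p x xB => [|z p IH] x xB /=.
  by exists [::]; rewrite /= xB.
move=> /andP[/and3P[xz _ zB] /(IH _ zB)[p' [p1 p2 p3]]].
by exists (z :: p'); rewrite /= xz p1 p2 xB.
Qed.

(** The vertices of K5 are representatives of the branch sets and its edges are walks inside the
    union of two of them; walks for disjoint pairs of indices are disjoint. *)
Lemma drawing_no_K5 pt h Cs : drawing pt h -> clique_minor e Cs -> size Cs <> 5%N.
Proof.
move=> [hc h01 hi] /andP[/allP Cok /(pairwiseP finset.set0) Cpair] sC.
pose C i : {set V} := nth finset.set0 Cs i.
have C0 i : (i < 5)%N -> C i != finset.set0 /\ connected_in e (C i).
  by move=> i5; apply/andP/Cok; rewrite mem_nth // sC.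
have Cd i j : (i < 5)%N -> (j < 5)%N -> i != j -> [disjoint C i & C j] && touch e (C i) (C j).
  move=> i5 j5; rewrite neq_ltn => /orP[ij|ji].
    by apply: Cpair; rewrite // inE sC.
  by rewrite disjoint_sym touch_sym //; apply: Cpair; rewrite // inE sC.
have [x0 _] : exists x, x \in C 0%N by apply/set0Pn; have [] := C0 0%N isT.
pose v i := odflt x0 [pick x in C i].
have vC i : (i < 5)%N -> v i \in C i.
  move=> /C0[/set0Pn[x xC] _]; rewrite /v; case: pickP => //= /(_ x).
  by rewrite xC.
have walk i j : (i < 5)%N /\ (j < 5)%N /\ i != j -> exists p,
    [/\ path e (v i) p, last (v i) p = v j & all [in C i :|: C j] (v i :: p)].
  move=> [i5 [j5 ij]]; have [_ /forall_inP ci] := C0 _ i5; have [_ /forall_inP cj] := C0 _ j5.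
  have /andP[_ /exists_inP[x xi /exists_inP[y yj xy]]] := Cd _ _ i5 j5 ij.
  have /connect_inside/(_ (vC _ i5))[p [p1 p2 p3]] := forall_inP (ci _ (vC _ i5)) _ xi.
  have /connect_inside/(_ yj)[p' [p1' p2' p3']] := forall_inP (cj _ yj) _ (vC _ j5).
  exists (p ++ y :: p'); rewrite cat_path last_cat p2 /= p1 xy p1' p2'; split=> //.
  rewrite all_cat andbA; apply/andP; split.
    by apply: sub_all p3 => z zi; apply/setUP; left.
  by apply: sub_all p3' => z zi; apply/setUP; right.
have /choice[W' W'P] : forall ij : nat * nat, exists p, (ij.1 < 5)%N /\ (ij.2 < 5)%N /\ ij.1 != ij.2 ->
    [/\ path e (v ij.1) p, last (v ij.1) p = v ij.2 & all [in C ij.1 :|: C ij.2] (v ij.1 :: p)].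
  move=> [i j] /=; have [/walk[p hp]|n] := pselect ((i < 5)%N /\ (j < 5)%N /\ i != j).
    by exists p.
  by exists [::] => /n.
apply: (@K5_not_drawable R V e pt h hc h01 hi v (fun i j => W' (i, j))).
  by move=> i j i5 j5 ij; have [|? ? _] := W'P (i, j).
move=> i j k l; rewrite /= !inE !negb_or !andbT => /and3P[/and3P[ij ik il] /andP[jk jl] kl].
move=> i5 j5 k5 l5 z; have [//|_ _ /allP aij] := W'P (i, j).
have [//|_ _ /allP akl /akl] := W'P (k, l).
move=> zkl; apply/negP => /aij; move: zkl; rewrite /= !inE.
have dis a b : (a < 5)%N -> (b < 5)%N -> a != b -> z \in C a -> z \in C b -> False.
  move=> a5 b5 ab za zb; have /andP[/pred0P/(_ z) + _] := Cd _ _ a5 b5 ab.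
  by rewrite /= za zb.
move=> /orP[zk|zl] /orP[zi|zj].
- exact: dis zi zk.
- exact: dis zj zk.
- exact: dis zi zl.
- exact: dis zj zl.
Qed.

End NoMinor.

Section SubdivisionPlanarity.
Local Open Scope ring_scope.
Local Open Scope classical_set_scope.
Variables (R : realType) (G : sgraph).

Lemma within_continuous_comp (f : R -> R * R) (phi : R -> R) :
  {within `[0, 1], continuous f} -> (forall s, 0 <= s <= 1 -> 0 <= phi s <= 1) ->
  (forall s u, `|phi s - phi u| <= `|s - u|) -> {within `[0, 1], continuous (f \o phi)}.
Proof.
move=> /within_continuousP cf p01 lip; apply: within_continuousI => s eps s01 eps0.
have [d d0 h] := cf (phi s) eps (p01 _ s01) eps0.
by exists d => // u u01 su; apply: h; [exact: p01|exact: le_lt_trans su].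
Qed.

(** Arcs are cut at their midpoints. Half arcs of independent edges of the subdivision belong to
    different vertices and to different edges of [G], so the planarity of [G] keeps them
    disjoint. *)
Theorem planar_sub_no_K5 Cs : planar R G -> clique_minor (@sub_adj G) Cs -> size Cs <> 5%N.
Proof.
move=> [pt [arc [pti arcP arc_pt arc_arc]]].
(* The half of the arc from [x] to the midpoint; the given arc may start at either end of [e]. *)
pose half x e s := if arc e 0 == pt x then arc e (s / 2) else arc e (1 - s / 2).
have arc_end x (e : edge G) : x \in val e -> arc e 0 = pt x \/ (arc e 0 != pt x /\ arc e 1 = pt x).
  have [_ _ [a [b [-> Ea Eb]]]] := arcP e.
  have [->|] := eqVneq (arc e 0) (pt x); first by left.
  rewrite !inE Ea => ne /orP[/eqP xa|/eqP ->]; last by right.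
  by rewrite xa eqxx in ne.
have half0 x (e : edge G) : x \in val e -> half x e 0 = pt x.
  by rewrite /half mul0r subr0 => /arc_end[->|[/negPf-> ->]]; rewrite ?eqxx.
have half1 x e : half x e 1 = arc e (1 / 2).
  by rewrite /half; case: ifP => // _; congr (arc e _); lra.
have halfP x (e : edge G) s : x \in val e -> 0 <= s <= 1 -> exists2 s', 0 <= s' <= 1 &
    half x e s = arc e s' /\ (s' \in `]0, 1[%R \/ half x e s = pt x).
  move=> xe /andP[s0 s1]; have [sz|sp] := eqVneq s 0.
    rewrite sz half0 //; have [E|[_ E]] := arc_end x e xe.
      by exists 0; rewrite ?lexx ?ler01 ?E; [|split; [|right]].
    by exists 1; rewrite ?lexx ?ler01 ?E; [|split; [|right]].
  have {}s0 : 0 < s by rewrite lt0r sp.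
  exists (if arc e 0 == pt x then s / 2 else 1 - s / 2); first by case: ifP => _; lra.
  split; first by rewrite /half; case: ifP.
  by left; rewrite in_itv /=; case: ifP => _; lra.
have half_lip (s u : R) : `|s / 2 - u / 2| <= `|s - u|.
  by rewrite -mulrBl normrM ler_piMr // ger0_norm ?invr_ge0 // invf_le1 // ler1n.
have half_cont x e : {within `[0, 1], continuous (half x e)}.
  have [cf _ _] := arcP e.
  have -> : half x e = if arc e 0 == pt x then (fun s => arc e (s / 2)) else (fun s => arc
      e (1 - s / 2)).
    by apply/funext => s; rewrite /half; case: ifP.
  case: ifP => _.
    apply: (within_continuous_comp (phi := fun s : R => s / 2) cf) => [s|s u]; first by lra.
    exact: half_lip.
  apply: (within_continuous_comp (phi := fun s : R => 1 - s / 2) cf) => [s|s u]; first by lra.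
  rewrite opprB addrC addrA subrK distrC; exact: half_lip.
pose ptS (a : G + edge G) := match a with inl x => pt x | inr e => arc e (1 / 2) end.
pose h (a b : G + edge G) : R -> R * R := match a, b with
  | inl x, inr e => half x e
  | inr e, inl x => fun s => half x e (1 - s)
  | _, _ => fun=> 0 end.
suff dr : drawing (@sub_adj G) ptS h by move=> cC; exact: (drawing_no_K5 (@sub_adj_sym G) dr cC).
have hP (a b : G + edge G) s : sub_adj a b -> 0 <= s <= 1 -> exists x (e : edge G) s', [/\ x \in val e,
    (a == inl x) && (b == inr e) || (a == inr e) && (b == inl x), 0 <= s' <= 1 & h a b s = half x e s'].
  case: a b => [x|e] [y|f] //= xe s01.
    by exists x, f, s; rewrite xe !eqxx.
  by exists y, e, (1 - s); rewrite xe !eqxx /= ?orbT; split=> //; lra.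
split.
- move=> [x|e] [y|f] //= xe.
  apply: (within_continuous_comp (phi := fun s : R => 1 - s) (half_cont y e)) => [s|s u]; first by lra.
  by rewrite opprB addrC addrA subrK distrC.
- by move=> [x|e] [y|f] //= xe; rewrite ?subr0 ?subrr half0 ?half1.
move=> a b c d ab cd ind s u s01 u01.
have [x [e [s' [xe E1 s'01 ->]]]] := hP _ _ _ ab s01.
have [y [f [u' [yf E2 u'01 ->]]]] := hP _ _ _ cd u01.
have xy : x != y.
  apply: contraTneq ind => xy; rewrite xy in E1.
  case/orP: E1 => /andP[/eqP-> /eqP->]; case/orP: E2 => /andP[/eqP-> /eqP->];
  by rewrite !inE !eqxx /= ?orbT ?andbF.
have ef : e != f.
  apply: contraTneq ind => ef; rewrite ef in E1.
  case/orP: E1 => /andP[/eqP-> /eqP->]; case/orP: E2 => /andP[/eqP-> /eqP->];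
  by rewrite !inE !eqxx /= ?orbT ?andbF.
have [s2 s201 [Es cs]] := halfP _ _ _ xe s'01.
have [u2 u201 [Eu cu]] := halfP _ _ _ yf u'01.
have itv v : 0 <= v <= 1 -> v \in `[0, 1]%R by rewrite in_itv.
case: cs => [si|Ep].
  by rewrite Es Eu; apply: arc_arc => //; exact: itv.
case: cu => [ui|Ep'].
  by rewrite Eu Ep => E; apply: (arc_pt f x u2) => //.
by rewrite Ep Ep' => /pti E; rewrite E eqxx in xy.
Qed.

End SubdivisionPlanarity.

(** * A planar drawing of the cycle with its trees *)

Section Coordinates.
Variables (n' q r : nat).
Hypotheses (q_gt1 : 1 < q).
Local Notation n := n'.+1.
Local Notation Q := (q ^ r.+1).
Implicit Types x y : unode n' q r.

Definition abscissa x : nat := x.1 * Q + x.2.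
Definition height x : nat := up_log q x.2.+1.

Lemma height_toward x : 0 < x.2 -> height x = (height (toward x)).+1.
Proof.
move=> x0; rewrite /height toward_snd //; move: (nat_of_ord x.2) x0 => a a0.
have up := up_logP (a %/ q).+1 q_gt1; apply: up_log_eq => //; apply/andP; split; last first.
  apply: leq_trans (_ : q * (a %/ q).+1 <= _); last by rewrite expnS leq_mul2l up orbT.
  by rewrite mulnS {1}(divn_eq a q) addnC mulnC ltn_add2r ltn_pmod // ltnW.
rewrite ltnS; case: (posnP (a %/ q)) => [->|d0]; first by rewrite up_log1.
have := up_log_gtn q_gt1 (d0 : 1 < (a %/ q).+1).
have : 0 < up_log q (a %/ q).+1 by rewrite up_log_gt0 q_gt1 ltnS.
case: (up_log _ _) => // m _ /=; rewrite ltnS => h.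
by apply: leq_trans (leq_trunc_div a q); rewrite expnSr leq_mul2r h orbT.
Qed.

Lemma height0 x : (height x == 0) = (x.2 == 0 :> nat).
Proof. by rewrite /height up_log_eq0 leqNgt q_gt1 /= ltnS leqn0. Qed.

Lemma abscissa_inj : injective abscissa.
Proof.
move=> x y; rewrite /abscissa => E.
have Ediv : x.1 = y.1.
  apply: ord_inj; have := congr1 (fun k => k %/ Q) E.
  by rewrite /= !divnMDl ?Q_gt0 // !divn_small ?addn0 //; exact: unode_lt.
apply: injective_projections => //; apply: ord_inj; move: E; rewrite Ediv.
by move/addnI.
Qed.

(** The parent map is monotone for the breadth-first numbering, so tree edges between the same two
    heights keep their left-to-right order and do not cross. *)
Lemma abscissa_toward x y : 0 < x.2 -> 0 < y.2 -> abscissa x < abscissa y ->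
  abscissa (toward x) <= abscissa (toward y).
Proof.
move=> x0 y0; rewrite /abscissa !toward_snd // /toward !gtn_eqF //= => lt.
have := unode_lt q_gt1 x; have := unode_lt q_gt1 y.
have lx := leq_div x.2 q; have ly := leq_div y.2 q => yQ xQ.
have [xy|xy|xy] := ltngtP x.1 y.1.
- apply: (@leq_trans (x.1 * Q + Q)); first by rewrite leq_add2l; exact: leq_trans lx (ltnW xQ).
  by rewrite addnC -mulSn; apply: leq_trans (leq_addr _ _); rewrite leq_mul2r xy orbT.
- have : y.1 * Q + Q <= x.1 * Q by rewrite addnC -mulSn leq_mul2r xy orbT.
  move=> h; suff : x.1 * Q + x.2 < x.1 * Q + x.2 by rewrite ltnn.
  apply: leq_trans lt _; apply: leq_trans (leq_addr _ _); apply: leq_trans h.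
  by rewrite leq_add2l ltnW.
- by move: lt; rewrite xy ltn_add2l leq_add2l => lt; rewrite leq_div2r // ltnW.
Qed.

End Coordinates.

Section Planar.
Local Open Scope ring_scope.
Local Open Scope classical_set_scope.
Variables (R : realType) (n' q r : nat).
Hypotheses (n_gt2 : (1 < n')%N) (q_gt1 : (1 < q)%N).
Local Notation Q := (q ^ r.+1)%N.
Local Notation G := (unicyclic r n_gt2 q_gt1).
Local Notation tw := (@toward n' q r).

Lemma lipschitz_within_continuous (f : R -> R * R) (K : R) : 0 < K ->
  (forall s u, 0 <= s <= 1 -> 0 <= u <= 1 ->
     `|(f s).1 - (f u).1| <= K * `|s - u| /\ `|(f s).2 - (f u).2| <= K * `|s - u|) ->
  {within `[0, 1], continuous f}.
Proof.
move=> K0 lip; apply: within_continuousI => s eps s01 eps0.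
exists (eps / K) => [|u u01]; first by rewrite divr_gt0.
rewrite ltr_pdivlMr // mulrC => lt; have [l1 l2] := lip s u s01 u01.
by apply/andP; split; apply: le_lt_trans lt.
Qed.

Lemma nat_gap (k l : nat) (s u : R) : 0 <= s < 1 -> 0 <= u < 1 ->
  l%:R - s = k%:R - u -> l = k.
Proof.
move=> /andP[s0 s1] /andP[u0 u1] E; case: (ltngtP l k) => // lk; exfalso; move: lk.
  by move=> lk; have : (l.+1)%:R <= k%:R :> R; [by rewrite ler_nat|rewrite -natr1; lra].
by move=> lk; have : (k.+1)%:R <= l%:R :> R; [by rewrite ler_nat|rewrite -natr1; lra].
Qed.

Definition upoint (x : G) : R * R := ((abscissa x)%:R, (height x)%:R).

Definition uarc (x : G) (s : R) : R * R :=
  if (x.2 == 0 :> nat) && (x.1 == 0 :> nat)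
  then (s * (abscissa (tw x))%:R, - (s * (1 - s)))
  else segment_point (upoint x) (upoint (tw x)) s.

Lemma uarc0 x : uarc x 0 = upoint x.
Proof.
rewrite /uarc /segment_point /upoint; case: ifP => [/andP[/eqP x2 /eqP x1]|_] /=.
  have /eqP h0 : height x == 0%N by rewrite height0 // x2.
  by rewrite !mul0r oppr0 h0 /abscissa x1 x2.
by congr (_, _); ring.
Qed.

Lemma uarc1 x : uarc x 1 = upoint (tw x).
Proof.
rewrite /uarc /segment_point /upoint; case: ifP => [/andP[/eqP x2 _]|_] /=.
  have /eqP h0 : height (tw x) == 0%N by rewrite height0 // toward_snd // x2 div0n.
  by rewrite h0 subrr mulr0 oppr0 mul1r.
by congr (_, _); ring.
Qed.

(* The three kinds of edges: tree edges, cycle edges on the axis, closing edge below it. *)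
Lemma uarc_cases (x : G) (s : R) :
  [\/ (0 < x.2)%N /\ uarc x s = ((1 - s) * (abscissa x)%:R + s * (abscissa (tw x))%:R,
    (height x)%:R - s),
      [/\ x.2 = 0 :> nat, (0 < x.1)%N & uarc x s = ((x.1%:R - s) * Q%:R, 0)] |
      [/\ x.2 = 0 :> nat, x.1 = 0 :> nat & uarc x s = (s * (n' * Q)%:R, - (s * (1 - s)))]].
Proof.
rewrite /uarc; case: (posnP x.2) => [x2|x2].
  have h0 : height x = 0%N by apply/eqP; rewrite height0 // x2.
  have ht : height (tw x) = 0%N by apply/eqP; rewrite height0 // toward_snd // x2 div0n.
  have tE : abscissa (tw x) = (((x.1 + n') %% n'.+1) * Q)%N.
    by rewrite /abscissa /toward x2 eqxx /= cycE node_a ?addn0 ?Q_gt0.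
  case: (posnP x.1) => [x1|x1].
    apply: Or33; split; rewrite ?x2 //= tE x1 add0n modn_small //.
  apply: Or32; split; rewrite ?x2 // /segment_point /upoint /= h0 ht tE.
  have -> : ((x.1 + n') %% n'.+1)%N = x.1.-1.
    have -> : (x.1 + n' = x.1.-1 + n'.+1)%N by rewrite -{1}(prednK x1) addSnnS.
    by rewrite modnDr modn_small // (leq_ltn_trans (leq_pred _)) ?ltn_ord.
  have E : (x.1 : nat)%:R = (x.1.-1)%:R + 1 :> R by rewrite -{1}(prednK x1) -natr1.
  rewrite /abscissa x2 addn0 !natrM E; congr (_, _); ring.
apply: Or31; split=> //; rewrite /= /segment_point /upoint /= (height_toward q_gt1 x2) -natr1.
by congr (_, _); ring.
Qed.

Lemma uarc_point (x y : G) (s : R) : 0 < s < 1 -> uarc x s <> upoint y.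
Proof.
move=> /andP[s0 s1]; have Q0 : Q%:R != 0 :> R by rewrite pnatr_eq0 -lt0n Q_gt0.
have s01 : 0 <= s < 1 by rewrite ltW.
have z01 : 0 <= (0 : R) < 1 by rewrite lexx ltr01.
case: (uarc_cases x s) => [[_ ->]|[_ x1 ->]|[_ _ ->]] [] => [E1 E2|E1 E2|E1 E2].
- have E : (height x)%:R - s = (height y)%:R - 0 by rewrite subr0.
  by have := nat_gap s01 z01 E; move=> E'; rewrite E' in E; lra.
- have y2 : y.2 = 0 :> nat by apply/eqP; rewrite -height0 // -(eqr_nat R) -E2.
  move: E1; rewrite /abscissa y2 addn0 natrM => /(mulIf Q0) E1.
  have E : x.1%:R - s = y.1%:R - 0 by rewrite subr0.
  by have := nat_gap s01 z01 E; move=> E'; rewrite E' in E; lra.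
have : 0 <= (height y)%:R :> R by [].
by rewrite -E2; nra.
Qed.

(** The ordinate is positive inside tree edges, zero on cycle edges and negative inside the closing
    edge. Two tree edges at one ordinate have the same height and parameter; their abscissas are
    then ordered as at the upper ends. *)
Lemma uarc_meet (x y : G) (s u : R) : 0 < s < 1 -> 0 < u < 1 -> uarc x s = uarc y u -> x = y /\ s = u.
Proof.
move=> /andP[s0 s1] /andP[u0 u1]; have Q0 : Q%:R != 0 :> R by rewrite pnatr_eq0 -lt0n Q_gt0.
have s01 : 0 <= s < 1 by rewrite ltW.
have u01 : 0 <= u < 1 by rewrite ltW.
have hpos (z : G) : (0 < z.2)%N -> 1 <= (height z)%:R :> R.
  by move=> z0; rewrite ler1n lt0n height0 // -lt0n.
case: (uarc_cases x s) => [[x2 ->]|[x2 x1 ->]|[x2 x1 ->]];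
case: (uarc_cases y u) => [[y2 ->]|[y2 y1 ->]|[y2 y1 ->]] E;
  have /= E1 := congr1 fst E; have /= E2 := congr1 snd E; clear E.
- have hh := nat_gap s01 u01 E2; have su : s = u by rewrite hh in E2; lra.
  split=> //; apply: (@abscissa_inj n' q r q_gt1); rewrite -su in E1.
  have lt (a b : G) : (abscissa a < abscissa b)%N -> (0 < a.2)%N -> (0 < b.2)%N ->
     (1 - s) * (abscissa a)%:R + s * (abscissa (tw a))%:R < (1 - s) * (abscissa b)%:R + s *
       (abscissa (tw b))%:R.
    move=> ab a2 b2; have tab := abscissa_toward q_gt1 a2 b2 ab.
    rewrite ltr_leD // ?ltr_pM2l ?ltr_nat ?ler_pM2l ?ler_nat // subr_gt0 //.
  case: (ltngtP (abscissa x) (abscissa y)) => // xy.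
    by have := lt _ _ xy x2 y2; rewrite E1 ltxx.
  by have := lt _ _ xy y2 x2; rewrite E1 ltxx.
- by have := hpos x x2; lra.
- by have := hpos x x2; nra.
- by have := hpos y y2; lra.
- move/(mulIf Q0): E1 => E1; have xy := nat_gap s01 u01 E1.
  have su : s = u by rewrite xy in E1; lra.
  by split=> //; apply: injective_projections; apply: ord_inj; rewrite ?x2 ?y2.
- by nra.
- by have := hpos y y2; nra.
- by nra.
have su : s = u.
  apply: (mulIf (_ : (n' * Q)%:R != 0 :> R) E1).
  by rewrite pnatr_eq0 muln_eq0 negb_or -!lt0n Q_gt0 // andbT ltnW.
by split=> //; apply: injective_projections; apply: ord_inj; rewrite ?x2 ?y2 ?x1 ?y1.
Qed.

Lemma uarc_continuous x : {within `[0, 1], continuous (uarc x)}.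
Proof.
have key (A B s u : R) :
  `|(1 - s) * A + s * B - ((1 - u) * A + u * B)| <= (`|A| + `|B|) * `|s - u|.
  have -> : (1 - s) * A + s * B - ((1 - u) * A + u * B) = (B - A) * (s - u) by ring.
  by rewrite normrM ler_wpM2r // [X in _ <= X]addrC ler_normB.
have weak (a K s u v : R) : 0 <= v -> a <= K * `|s - u| -> a <= (K + v) * `|s - u|.
  by move=> v0 h; apply: le_trans h _; rewrite ler_wpM2r // lerDl.
case E : ((x.2 == 0 :> nat) && (x.1 == 0 :> nat)).
  have -> : uarc x = fun s => (s * (abscissa (tw x))%:R, - (s * (1 - s))).
    by apply/funext => s; rewrite /uarc E.
  apply: (@lipschitz_within_continuous _ ((abscissa (tw x))%:R + 1)).
    by rewrite ltr_wpDl.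
  move=> s u /andP[s0 s1] /andP[u0 u1] /=; split.
    by rewrite -mulrBl normrM mulrC; apply: (weak); rewrite // ger0_norm.
  have -> : - (s * (1 - s)) - - (u * (1 - u)) = (s + u - 1) * (s - u) by ring.
  by rewrite normrM ler_wpM2r //; apply: (@le_trans _ _ 1); rewrite ?lerDr // ler_norml; lra.
have -> : uarc x = segment_point (upoint x) (upoint (tw x)).
  by apply/funext => s; rewrite /uarc E.
move: (upoint x) (upoint (tw x)) => a b.
apply: (@lipschitz_within_continuous _ (`|a.1| + `|b.1| + (`|a.2| + `|b.2| + 1))).
  by rewrite ltr_wpDl ?addr_ge0 // ltr_wpDl ?addr_ge0.
move=> s u _ _ /=; split; first by apply: weak (key _ _ _ _); rewrite !addr_ge0.
rewrite [X in _ <= X * _]addrC; apply: (weak); first by rewrite addr_ge0.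
by apply: weak (key _ _ _ _).
Qed.

Theorem unicyclic_planar : planar R G.
Proof.
have tail (e : edge G) : exists x : G, val e == [set x; tw x]%SET.
  have /imsetP[[x y] /= + ->] := valP e; rewrite inE => /= /orP[] /eqP <-; [exists x|exists y] => //.
  by rewrite finset.setUC.
pose tl e := xchoose (tail e); have tlP e : val e = [set tl e; tw (tl e)]%SET by apply/eqP;
  exact: (xchooseP (tail e)).
have tl_inj e f : tl e = tl f -> e = f by move=> E; apply: val_inj; rewrite !tlP E.
have upoint_inj : injective upoint.
  by move=> x y [/eqP]; rewrite eqr_nat => /eqP /(abscissa_inj q_gt1).
have ends (s : R) : s \in `[0, 1]%R -> [\/ s = 0, s = 1 | 0 < s < 1].
  rewrite in_itv /= !le_eqVlt => /andP[/orP[/eqP<-|s0] /orP[/eqP->|s1]].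
  - by apply: Or31.
  - by apply: Or31.
  - by apply: Or32.
  - by apply: Or33; rewrite s0 s1.
exists upoint, (fun e => uarc (tl e)); split=> //.
- move=> e; split; [exact: uarc_continuous| |].
    have inner x s u : 0 < s < 1 -> u \in `[0, 1]%R -> uarc x s = uarc x u -> s = u.
      move=> s01 /ends[->|->|u01].
      + by rewrite uarc0 => /(uarc_point s01).
      + by rewrite uarc1 => /(uarc_point s01).
      + by move=> /(uarc_meet s01 u01)[].
    move=> s u s01 u01 E; have [s0|s1|si] := ends s s01; last exact: inner si u01 E.
      have [u0|u1|ui] := ends u u01; [by rewrite s0 u0| |].
        move: E; rewrite s0 u1 uarc0 uarc1 => /upoint_inj E.
        by have := toward_neq n_gt2 q_gt1 (tl e); rewrite -E eqxx.
      by apply/esym/(inner (tl e) u s ui s01); rewrite E.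
    have [u0|u1|ui] := ends u u01; [|by rewrite s1 u1|].
      move: E; rewrite s1 u0 uarc0 uarc1 => /upoint_inj E.
      by have := toward_neq n_gt2 q_gt1 (tl e); rewrite E eqxx.
    by apply/esym/(inner (tl e) u s ui s01); rewrite E.
  by exists (tl e), (tw (tl e)); rewrite uarc0 uarc1 -tlP.
- by move=> e x s; rewrite in_itv => /(uarc_point (y := x)); apply.
move=> e f s u ef; rewrite in_itv => s01 /ends[->|->|u01].
- by rewrite uarc0; exact: uarc_point.
- by rewrite uarc1; exact: uarc_point.
by move=> /(uarc_meet s01 u01)[/tl_inj E]; rewrite E eqxx in ef.
Qed.

End Planar.

(** * Upper bounds *)

Lemma tree_sumS d m : tree_sum d m.+1 = tree_sum d m + d * (d - 1) ^ m.
Proof. by rewrite /tree_sum big_ord_recr. Qed.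

Lemma tree_sum_le d m : (d - 2) * tree_sum d m <= d * (d - 1) ^ m.
Proof.
elim: m => [|m IH]; first by rewrite /tree_sum big_ord0 muln0.
have [d2|d2] := leqP d 2; first by rewrite (_ : d - 2 = 0) //; apply/eqP; rewrite subn_eq0.
rewrite tree_sumS mulnDr expnS [X in _ <= X](_ : _ = (d - 2).+1 * (d * (d - 1) ^ m)).
  by rewrite mulSn leq_add2r.
by rewrite mulnCA; congr (_ * _); clear -d2; lia.
Qed.

(** The outermost layer outweighs [2 * k] balls of radius smaller by one. With [k = 8 * t + 1] this
    is the hypothesis [MN] and gives the threshold for [d]. *)
Lemma tree_sum_gap d m k : 10 * k + 3 <= d -> 0 < k ->
  k * (2 * tree_sum d m + 3) < tree_sum d m.+1.
Proof.
move=> kd k0; rewrite tree_sumS; have := tree_sum_le d m.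
have : d <= d * (d - 1) ^ m by rewrite leq_pmulr // expn_gt0; apply/orP; left; lia.
move: (d * _) (tree_sum d m) => A S dA SA.
have : 10 * k * S <= A by apply: leq_trans SA; rewrite leq_mul2r; apply/orP; right; lia.
by rewrite -!mulnA; move: kd dA {SA} => kd dA; rewrite mulnDr; lia.
Qed.

Lemma dist_chromatic_le (G : sgraph) t k : dist_colourable G t k -> dist_chromatic_number G t <= k.
Proof. by rewrite /dist_chromatic_number; case: ex_minnP => m _ h /h. Qed.

(** Vertices are coloured for even [t] and edges for odd [t]. In both cases [t] steps lead from the
    coloured class to a vertex of [G], whose ball gives the number of colours. *)
Lemma colour_sub (R : realType) (G : sgraph) d t : 0 < t -> planar R G -> max_degree G <= d ->
  10 * (8 * t + 1) + 3 <= d -> girth_at_least G (48 * (8 * t + 2) + 1 + 2) ->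
  exists c : G + edge G -> 'I_(~~ odd t + tree_sum d (half_of (~~ odd t) t)),
  forall a b : (G + edge G)%type, is_vertex a = ~~ odd t -> is_vertex b = ~~ odd t -> a != b ->
    reach (@sub_adj G) (2 * t) a b -> c a != c b.
Proof.
move=> t0 pl md Dd gG; set p := ~~ odd t; set r := half_of p t.
have deg (x : G) : #|[set y | adj x y]| <= d.
  by apply: leq_trans md; apply: (@leq_bigmax _ (fun x : G => #|[set y | adj x y]|)).
have d0 : 0 < d by clear -Dd; lia.
have rE : r = r.-1.+1.
  by rewrite /r /p /half_of; case: ifP => o; clear -t0 o; lia.
pose X : {set (G + edge G)} := [set a | is_vertex a == p].
have [w|c|||c cP] := @sparse_colouring _ _ (@sub_adj_sym G) (@sub_adj_irr G) X t
   (p + tree_sum d r) (2 * tree_sum d r.-1 + 3) (fun Cs => planar_sub_no_K5 pl)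
   (girth_gt_sub (girth_gt_adj gG)).
- move=> w0 ws.
  have par i : i <= t -> is_vertex (w i) = p (+) odd i.
    elim: i => [|i IH] it; first by move: w0; rewrite inE addbF => /eqP.
    by rewrite (sub_adj_parity (ws i it)) IH ?(ltnW it) // addbN.
  have := par t (leqnn _); rewrite /p addNb addbb /=.
  case: (w t) => // u _; apply: leq_trans (ball_vertex d0 deg p t u).
  by apply/subset_leq_card/fintype.subsetP => a; rewrite !inE.
- apply: (@leq_trans #|[set a | (is_vertex a == p) && reach (@sub_adj G) t.-1 c a]|).
    by apply/subset_leq_card/fintype.subsetP => a; rewrite !inE.
  apply: leq_trans (ball_any d0 deg p t.-1 c) _.
  rewrite leq_add2r leq_mul2l; apply: tree_sum_mono.
  rewrite geq_max; apply/andP; split.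
    by rewrite /r /p /half_of; case: ifP => o; clear -t0 o; lia.
  by case: ifP => // _; rewrite /r /p /half_of; case: ifP => o; clear -t0 o; lia.
- exact: t0.
- rewrite rE; apply: leq_trans (tree_sum_gap r.-1 Dd _) _; first by clear; lia.
  by rewrite leq_addl.
exists c => a b av bv; apply: cP; rewrite inE; exact/eqP.
Qed.

Local Open Scope ring_scope.

Lemma tree_sum_ring d m : (2 < d)%N ->
  (tree_sum d m)%:R = (d%:R * (d%:R - 1) ^+ m - d%:R) / (d%:R - 2) :> rat.
Proof.
move=> d2; have ne : d%:R - 2 != 0 :> rat.
  by rewrite subr_eq0 (eqr_nat _ d 2) gtn_eqF.
apply: (mulIf ne); rewrite divfK //; elim: m => [|m IH].
  by rewrite /tree_sum big_ord0 mul0r expr0 mulr1 subrr.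
rewrite tree_sumS natrD mulrDl IH natrM natrX natrB ?(ltnW (ltnW d2)) // exprS; ring.
Qed.

Theorem upper_index (R : realType) t : (1 <= t)%N -> odd t ->
  exists g D : nat, forall (G : sgraph) (d : nat),
    planar R G -> max_degree G = d -> (D <= d)%N -> girth_at_least G g ->
    (dist_chromatic_index t G)%:R <= tau_index t d.
Proof.
move=> t0 ot; exists (48 * (8 * t + 2) + 1 + 2)%N, (10 * (8 * t + 1) + 3)%N => G d pl md Dd gG.
have [|c cP] := colour_sub t0 pl _ Dd gG; first by rewrite md.
rewrite ot /= in c cP *.
rewrite /tau_index ot -tree_sum_ring; last by clear -Dd; lia.
rewrite ler_nat; apply: dist_chromatic_le; apply/existsP.
exists [ffun f : edge G => c (inr f)]; apply/forallP => f; apply/forallP => h.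
apply/implyP => /andP[fh]; rewrite !ffunE within_distE => r.
by apply: cP => //; exact: reach_sub_edge.
Qed.

Theorem upper_vertex (R : realType) t : (2 <= t)%N -> ~~ odd t ->
  exists g D : nat, forall (G : sgraph) (d : nat),
    planar R G -> max_degree G = d -> (D <= d)%N -> girth_at_least G g ->
    (dist_chromatic_number G t)%:R <= tau_vertex t d.
Proof.
move=> t2 et; exists (48 * (8 * t + 2) + 1 + 2)%N, (10 * (8 * t + 1) + 3)%N => G d pl md Dd gG.
have [||c cP] := colour_sub (t := t) _ pl _ Dd gG; rewrite ?md //; first exact: ltnW.
rewrite et /= in c cP *.
have d2 : (2 < d)%N by clear -Dd; lia.
have -> : tau_vertex t d = (1 + tree_sum d t./2)%:R.
  rewrite /tau_vertex (negPf et) natrD tree_sum_ring //.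
  have ne : d%:R - 2 != 0 :> rat by rewrite subr_eq0 (eqr_nat _ d 2) gtn_eqF.
  field; exact: ne.
rewrite ler_nat; apply: dist_chromatic_le; apply/existsP.
exists [ffun x : G => c (inl x)]; apply/forallP => x; apply/forallP => y.
apply/implyP => /andP[xy]; rewrite !ffunE within_distE => r.
by apply: cP => //; exact: reach_sub_vertex.
Qed.

Local Open Scope ring_scope.

(** * Lower bounds *)

Lemma dist_colourable_number (G : sgraph) t : dist_colourable G t (dist_chromatic_number G t).
Proof. by rewrite /dist_chromatic_number; case: ex_minnP. Qed.

Lemma geo_ring q m : (geo q m)%:R * (q%:R - 1) = q%:R ^+ m - 1 :> rat.
Proof.
elim: m => [|m IH]; first by rewrite /geo big_ord0 mul0r expr0 subrr.
by rewrite /geo big_ord_recr /= natrD mulrDl IH natrX exprS; ring.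
Qed.

Lemma geoS q m : geo q m.+1 = (geo q m + q ^ m)%N.
Proof. by rewrite /geo big_ord_recr. Qed.

(** The edges of the walk, placed between [e] and [f], form a chain in the line graph; [m] of them
    make [m.+1] steps. *)
Lemma reach_line (G : sgraph) m (e f : edge G) x y : x \in val e -> y \in val f ->
  reach (@adj G) m x y -> reach (@line_adj G) m.+1 e f.
Proof.
have touch (h h' : edge G) z : z \in val h -> z \in val h' -> reach (@line_adj G) 1 h h'.
  move=> zh zh'; have [->|hh'] := eqVneq h h'; first exact: reach_refl.
  apply: reach1; rewrite /line_adj /= hh' /=; apply/finset.set0Pn; exists z.
  by rewrite finset.in_setI zh zh'.
elim: m e x => [|m IH] e x xe yf; first by rewrite /= orbF => /eqP xy; apply: touch xe _; rewrite xy.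
move=> /reachSP[xy|[z xz zy]].
  by apply: reachW (touch e f x xe _); rewrite ?xy.
have [h hE] := adj_edge xz.
have xh : x \in val h by rewrite hE !inE eqxx.
have zh : z \in val h by rewrite hE !inE eqxx orbT.
rewrite -[m.+2]add1n; apply: reach_trans (touch _ _ _ xe xh) _; exact: IH zh yf zy.
Qed.

(** For [t = 2 * r + 1], vertices within [r] of equal or adjacent cycle vertices conflict, and [tau]
    is [2 * geo q r.+1], that is, a ball of radius [r] and [q ^ r] more. *)
Theorem lower_vertex (R : realType) t : (1 <= t)%N -> odd t ->
  ~ exists g : nat, exists D : nat, forall d : nat, (D <= d)%N ->
      forall G : sgraph,
        planar R G -> max_degree G = d -> girth_at_least G g ->
        (dist_chromatic_number G t)%:R <= tau_vertex t d.
Proof.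
(* On a cycle of [2 * k + 1] vertices, [k] exceeds [g] for the girth and [r] so that balls do not
   wrap around; [q] exceeds [D] for the degree [q + 1], and [k + 1] for the drift. *)
move=> t0 ot [g [D H]]; pose r := t./2; pose k := (g + r + 2)%N; pose q := (D + k + 2)%N.
have n_gt2 : (1 < 2 * k)%N by rewrite /k; clear; lia.
have q_gt1 : (1 < q)%N by rewrite /q; clear; lia.
have tE : t = (2 * r).+1 by rewrite /r; clear -ot; lia.
pose G := unicyclic r n_gt2 q_gt1.
have gG : girth_at_least G g by apply: unicyclic_girth; rewrite /k; clear; lia.
have := H q.+1 _ G (unicyclic_planar R r n_gt2 q_gt1) (unicyclic_degree r n_gt2 q_gt1) gG.
move=> /(_ _)/wrap[|]; first by rewrite /q; clear; lia.
have -> : tau_vertex t q.+1 = (2 * geo q r.+1)%:R.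
  have q1 : q%:R - 1 != 0 :> rat by rewrite subr_eq0 (eqr_nat _ q 1) gtn_eqF.
  have dE : q.+1%:R = q%:R + 1 :> rat by rewrite natr1.
  rewrite /tau_vertex ot (_ : t.+1./2 = r.+1); last by rewrite tE; clear; lia.
  rewrite dE (_ : q%:R + 1 - 2 = q%:R - 1); last by ring.
  apply: (mulIf q1); rewrite divfK // natrM -mulrA geo_ring addrK; ring.
rewrite ler_nat => le.
have /existsP[c /forallP cP] := dist_colourable_number G t.
have rk : (2 * r < 2 * k)%N by rewrite /k; clear; lia.
apply: (@no_colouring _ q r n_gt2 q_gt1 rk false _ k _ c).
- by [].
- by [].
- by rewrite /q; clear; lia.
- move=> x x' i j xi x'j ij xx'.
  move/forallP/(_ x')/implyP: (cP x); rewrite xx' within_distE; apply.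
  apply: (@reachW _ _ (r + (1 + r))); first by rewrite tE; clear; lia.
  apply: reach_trans xi _; apply: reach_trans (_ : reach _ 1 _ (node (2 * k) q r j 0)) _.
    by apply: reach_cycle_dist; case: ij => ->; clear; lia.
  by rewrite reach_sym; [exact: x'j|exact: (@adj_sym G)].
by rewrite addn0; apply: leq_trans le _; rewrite !geoS; clear; lia.
Qed.

(** For [t = 2 * r], edges with an end within [r - 1] of equal or adjacent cycle vertices conflict:
    their ends are within [2 * (r - 1) + 1], and passing to edges adds 1. *)
Theorem lower_index (R : realType) t : (2 <= t)%N -> ~~ odd t ->
  ~ exists g : nat, exists D : nat, forall d : nat, (D <= d)%N ->
      forall G : sgraph,
        planar R G -> max_degree G = d -> girth_at_least G g ->
        (dist_chromatic_index t G)%:R <= tau_index t d.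
Proof.
move=> t0 ot [g [D H]]; pose r := t./2; pose k := (g + r + 2)%N; pose q := (D + k + 2)%N.
have n_gt2 : (1 < 2 * k)%N by rewrite /k; clear; lia.
have q_gt1 : (1 < q)%N by rewrite /q; clear; lia.
have tE : t = (2 * r)%N by rewrite /r; clear -ot; lia.
have r0 : (0 < r)%N by clear -tE t0; lia.
pose G := unicyclic r n_gt2 q_gt1.
have gG : girth_at_least G g by apply: unicyclic_girth; rewrite /k; clear; lia.
have := H q.+1 _ G (unicyclic_planar R r n_gt2 q_gt1) (unicyclic_degree r n_gt2 q_gt1) gG.
move=> /(_ _)/wrap[|]; first by rewrite /q; clear; lia.
have -> : tau_index t q.+1 = (2 * geo q r.+1)%:R - 1.
  have q1 : q%:R - 1 != 0 :> rat by rewrite subr_eq0 (eqr_nat _ q 1) gtn_eqF.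
  have dE : q.+1%:R = q%:R + 1 :> rat by rewrite natr1.
  rewrite /tau_index (negPf ot) -/r dE (_ : q%:R + 1 - 2 = q%:R - 1); last by ring.
  apply: (mulIf q1); rewrite divfK // mulrBl natrM -mulrA geo_ring addrK; ring.
rewrite lerBrDr natr1 ler_nat => le.
have /existsP[c /forallP cP] := dist_colourable_number (line_graph G) t.
have rk : (2 * r < 2 * k)%N by rewrite /k; clear; lia.
(* Each vertex names the edge to its image; [toward] has neither fixed points nor 2-cycles, so
   different vertices name different edges. *)
have ex (x : G) : exists e : edge G, val e = [set x; toward x]%SET.
  by apply: adj_edge; exact: adj_toward.
have [E EP] := fin_all_exists ex.
have E1 x : x \in val (E x) by rewrite EP; exact: finset.set21.
have E2 x : toward x \in val (E x) by rewrite EP; exact: finset.set22.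
have Einj : injective E.
  move=> x y xy; have := E1 x; have := E2 x; rewrite xy EP.
  move=> h /finset.set2P[//|yx]; case/finset.set2P: h => E3.
    by have := toward2_neq n_gt2 q_gt1 y; rewrite -yx E3 eqxx.
  by have := toward_neq n_gt2 q_gt1 x; rewrite E3 -yx eqxx.
apply: (@no_colouring _ q r n_gt2 q_gt1 rk true _ k _ (fun x => c (E x))).
- by [].
- by [].
- by rewrite /q; clear; lia.
- move=> x x' i j xi x'j ij xx'.
  move/forallP/(_ (E x'))/implyP: (cP (E x)); rewrite (inj_eq Einj) xx' within_distE; apply.
  have end_of (y : G) l : @close_to (2 * k) q r n_gt2 q_gt1 true y (node (2 * k) q r l 0) ->
      exists2 z, z \in val (E y) & reach (@adj G) r.-1 z (node (2 * k) q r l 0).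
    by case/orP => h; [exists y|exists (toward y)].
  have [z zx zi] := end_of _ _ xi; have [z' zx' zj] := end_of _ _ x'j.
  apply: (@reachW _ _ (r.-1 + (1 + r.-1)).+1); first by clear -tE r0; lia.
  apply: reach_line zx zx' _.
  apply: reach_trans zi _; apply: reach_trans (_ : reach _ 1 _ (node (2 * k) q r j 0)) _.
    by apply: reach_cycle_dist; case: ij => ->; clear; lia.
  by rewrite reach_sym; [exact: zj|exact: (@adj_sym G)].
by rewrite addn1; apply: leq_trans le _; rewrite !geoS; clear; lia.
Qed.

Theorem theorem1p3 (R : realType) :
  [/\
    (forall t : nat, (1 <= t)%N -> odd t ->
      exists g D : nat, forall (G : sgraph) (d : nat),
        planar R G -> max_degree G = d -> (D <= d)%N -> girth_at_least G g ->
        (dist_chromatic_index t G)%:R <= tau_index t d),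
    (forall t : nat, (2 <= t)%N -> ~~ odd t ->
      exists g D : nat, forall (G : sgraph) (d : nat),
        planar R G -> max_degree G = d -> (D <= d)%N -> girth_at_least G g ->
        (dist_chromatic_number G t)%:R <= tau_vertex t d),
    (forall t : nat, (2 <= t)%N -> ~~ odd t ->
      ~ exists g : nat, exists D : nat, forall d : nat, (D <= d)%N ->
        forall G : sgraph,
          planar R G -> max_degree G = d -> girth_at_least G g ->
          (dist_chromatic_index t G)%:R <= tau_index t d) &
    (forall t : nat, (1 <= t)%N -> odd t ->
      ~ exists g : nat, exists D : nat, forall d : nat, (D <= d)%N ->
        forall G : sgraph,
          planar R G -> max_degree G = d -> girth_at_least G g ->
          (dist_chromatic_number G t)%:R <= tau_vertex t d)].
Proof.
split => t; [exact: upper_index|exact: upper_vertex|exact: lower_index|exact: lower_vertex].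
Qed.
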